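(* Let $\Omega\subset\mathbb{R}^m$ be either a bounded domain with $m\ge2$, in which case let $\phi\in\mathcal{S}(\partial\Omega)$, or $\Omega=\mathbb{R}^m$ with $m\ge3$ (in which case set $\phi=0$). Let $\rho\in\mathcal{Y}(\Omega)^*$, let $u_\rho$ be the minimizer of $I_\rho$ on $\mathcal{Y}_\phi(\Omega)$, and assume that $u_\rho$ has a light segment $\overline{xy}\subset\Omega$, $x\neq y$, with $u_\rho(y)-u_\rho(x)=|y-x|$. Then, for each $\alpha>0$, $u_\rho$ also minimizes on $\mathcal{Y}_\phi(\Omega)$ the functional $I_{\rho_\alpha}$ with $$\rho_\alpha=\rho+\alpha(\delta_y-\delta_x),$$ but $u_\rho$ is not a weak solution of $(\mathcal{BI})$ with source $\rho_\alpha$.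
   Context: Here $\delta_z$ is the Dirac delta at $z$, $2^*=2m/(m-2)$, and $p_1\in(m,\infty)$ is a fixed exponent (with also $p_1\ge2^*$ if $m=3$). Bounded domain ($m\ge 2$, no regularity of $\partial\Omega$ assumed). For $\phi\in C(\partial\Omega)$, ''$u=\phi$ on $\partial\Omega$'' means: for each $x\in\partial\Omega$ and each straight segment $\gamma:(0,1)\to\Omega$ with $\gamma(0^+)=x$, $u(\gamma(t))\to\phi(x)$ as $t\to0^+$. Set $\mathcal{Y}_\phi(\Omega)=\{u\in W^{1,\infty}(\Omega): |Du|\le1 \text{ a.e.},\ u=\phi\text{ on }\partial\Omega\}$. For $x,y\in\overline\Omega$, $d_{\overline\Omega}(x,y)\in[0,\infty]$ is the infimum of the Euclidean lengths of piecewise affine (finitely many pieces) curves $\gamma\in C([0,1],\overline\Omega)$ with $\gamma((0,1))\subset\Omega$, $\gamma(0)=x$, $\gamma(1)=y$ ($+\infty$ if none). $\mathcal{S}(\partial\Omega)$ is the set of $\phi\in C(\partial\Omega)$ with $|\phi(x)-\phi(y)|<d_{\overline\Omega}(x,y)$ for all $x\ne y$ in $\partial\Omega$. $\mathcal{Y}(\Omega)=W^{1,p_1}(\Omega)\cap C(\overline\Omega)$ with norm $\max\{\|v\|_{W^{1,p_1}(\Omega)},\|v\|_{C(\overline\Omega)}\}$; functions in $\mathcal{Y}_\phi(\Omega)$ extend continuously to $\overline\Omega$ by $\phi$, so $\mathcal{Y}_\phi(\Omega)\subset\mathcal{Y}(\Omega)$. Case $\Omega=\mathbb{R}^m$, $m\ge3$.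 $\mathcal{Y}(\mathbb{R}^m)$ is the closure of $C_c^\infty(\mathbb{R}^m)$ in the norm $\max\{\|Dv\|_2,\|Dv\|_{p_1}\}$, and $\mathcal{Y}_0(\mathbb{R}^m)=\{v\in\mathcal{Y}(\mathbb{R}^m):\|Dv\|_\infty\le1\}$. In both cases finite signed Borel measures belong to $\mathcal{Y}(\Omega)^*$. For $\rho\in\mathcal{Y}(\Omega)^*$, $I_\rho(v)=\int_\Omega(1-\sqrt{1-|Dv|^2})\,dx-\langle\rho,v\rangle$ on $\mathcal{Y}_\phi(\Omega)$; it has a unique minimizer $u_\rho$ there. A weak solution of $(\mathcal{BI})$ with source $\rho$ (formally $-\mathrm{div}(Du/\sqrt{1-|Du|^2})=\rho$ in $\Omega$, $u=\phi$ on $\partial\Omega$, or $u\to 0$ at infinity if $\Omega=\mathbb{R}^m$) is $u\in\mathcal{Y}_\phi(\Omega)$ with $(1-|Du|^2)^{-1/2}\in L^1_{\mathrm{loc}}(\Omega)$ and $\int_\Omega \frac{Du\cdot D\eta}{\sqrt{1-|Du|^2}}dx=\langle\rho,\eta\rangle$ for all Lipschitz $\eta$ with compact support in $\Omega$. *)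

(* Defs.v *)
From HB Require Import structures.
From mathcomp Require Import all_boot all_order all_algebra.
From mathcomp Require Import all_classical all_reals all_analysis.
Import numFieldNormedType.Exports.
Import Order.TTheory GRing.Theory Num.Theory.

Set Implicit Arguments.
Unset Strict Implicit.
Unset Printing Implicit Defensive.

Local Open Scope classical_set_scope.
Local Open Scope ring_scope.

(* R^m carries the sigma-algebra generated by the coordinates, i.e. the Borel
   sigma-algebra; every a.e.-class below has Borel representatives, so nothing
   is lost by not completing it. *)
Section MeasurableRow.
Context (R : realType) (m : nat).

Definition rV_coord (i : 'I_m) (z : 'rV[R]_m) : measurableTypeR R := z 0 i.

Lemma rV_measurable0 : g_sigma_preimage rV_coord set0.
Proof. exact: sigma_algebra0. Qed.

Lemma rV_measurableC A :
  g_sigma_preimage rV_coord A -> g_sigma_preimage rV_coord (~` A).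
Proof. exact: sigma_algebraC. Qed.

Lemma rV_measurable_bigcup (F : (set 'rV[R]_m)^nat) :
  (forall i, g_sigma_preimage rV_coord (F i)) ->
  g_sigma_preimage rV_coord (\bigcup_i F i).
Proof. exact: sigma_algebra_bigcup. Qed.

HB.instance Definition _ := @isMeasurable.Build default_measure_display
  'rV[R]_m (g_sigma_preimage rV_coord)
  rV_measurable0 rV_measurableC rV_measurable_bigcup.

End MeasurableRow.

Lemma measurable_rV_coord (R : realType) m (i : 'I_m) :
  measurable_fun setT (@rV_coord R m i).
Proof.
move=> _ Y mY; rewrite setTI; apply: sub_sigma_algebra.
rewrite -bigcup_seq/=; exists i => /=; first by rewrite mem_index_enum.
by exists Y => //; rewrite setTI.
Qed.

Lemma measurable_fun_rV (R : realType) m d (T : measurableType d) (f : T -> 'rV[R]_m) :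
  (forall i : 'I_m, measurable_fun setT (rV_coord i \o f)) -> measurable_fun setT f.
Proof.
move=> mf _ A gA; rewrite setTI.
suff : g_sigma_preimage (@rV_coord R m) `<=`
    [set B | measurable (f @^-1` B)] by exact.
apply: smallest_sub.
  split => /=; first by rewrite preimage_set0.
  - by move=> B mB; rewrite setTD preimage_setC; exact: measurableC.
  - by move=> F mF; rewrite preimage_bigcup; exact: bigcupT_measurable.
move=> B; rewrite -bigcup_seq => -[i _ [Y mY <-]] /=.
rewrite setTI -comp_preimage -[X in measurable X]setTI; exact: mf.
Qed.

Section LebesgueRow.
Context (R : realType) (n : nat).

Definition cons_rV (p : measurableTypeR R * 'rV[R]_n) : 'rV[R]_n.+1 :=
  \row_(i < n.+1) oapp (fun j => p.2 0 j) p.1 (unlift ord0 i).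

Definition uncons_rV (z : 'rV[R]_n.+1) : measurableTypeR R * 'rV[R]_n :=
  (z 0 ord0, \row_(j < n) z 0 (lift ord0 j)).

Lemma cons_rVK : cancel cons_rV uncons_rV.
Proof.
move=> [a v]; rewrite /uncons_rV /cons_rV mxE unlift_none /=; congr pair.
by apply/rowP => j; rewrite !mxE liftK.
Qed.

Lemma measurable_cons_rV : measurable_fun setT cons_rV.
Proof.
apply: measurable_fun_rV => i.
have [j ->|->] := unliftP ord0 i.
  rewrite (_ : _ \o _ = (@rV_coord R n j) \o snd).
    by apply: measurableT_comp; [exact: measurable_rV_coord|exact: measurable_snd].
  by apply/funext => p; rewrite /= /rV_coord mxE liftK.
rewrite (_ : _ \o _ = fst); first exact: measurable_fst.
by apply/funext => p; rewrite /= /rV_coord mxE unlift_none.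
Qed.

Lemma measurable_uncons_rV : measurable_fun setT uncons_rV.
Proof.
apply: measurable_fun_pair; first exact: (measurable_rV_coord ord0).
apply: measurable_fun_rV => j.
rewrite (_ : _ \o _ = rV_coord (lift ord0 j)); first exact: measurable_rV_coord.
by apply/funext => z; rewrite /= /rV_coord mxE.
Qed.

Context (mu : {sigma_finite_measure set 'rV[R]_n -> \bar R}).

Definition lebesgue_cons : set 'rV[R]_n.+1 -> \bar R :=
  pushforward (lebesgue_measure \x mu)%E cons_rV.

Let lebesgue_cons0 : lebesgue_cons set0 = 0%E.
Proof. by rewrite /lebesgue_cons /pushforward preimage_set0 measure0. Qed.

Let lebesgue_cons_ge0 A : (0 <= lebesgue_cons A)%E.
Proof. by rewrite /lebesgue_cons /pushforward. Qed.

Let lebesgue_cons_sigma_additive : semi_sigma_additive lebesgue_cons.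
Proof.
move=> F mF tF mUF; rewrite /lebesgue_cons /pushforward preimage_bigcup.
apply: measure_semi_sigma_additive.
- by move=> k; rewrite -[X in measurable X]setTI; exact: measurable_cons_rV.
- apply/trivIsetP => /= i j _ _ ij; rewrite -preimage_setI.
  by move/trivIsetP : tF => /(_ _ _ _ _ ij) ->//; rewrite preimage_set0.
- by rewrite -preimage_bigcup -[X in measurable X]setTI; exact: measurable_cons_rV.
Qed.

HB.instance Definition _ := isMeasure.Build _ _ _ lebesgue_cons
  lebesgue_cons0 lebesgue_cons_ge0 lebesgue_cons_sigma_additive.

Lemma sigma_finite_lebesgue_cons : sigma_finite setT lebesgue_cons.
Proof.
have /sigma_finiteP[F [FT ndF mF]] := sigma_finiteT (@lebesgue_measure R).
have /sigma_finiteP[G [GT ndG mG]] := sigma_finiteT mu.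
exists (fun k => uncons_rV @^-1` (F k `*` G k)).
  apply/esym/seteqP; split => // z _.
  have [i _ Fi] : (\bigcup_k F k) (uncons_rV z).1 by rewrite -FT.
  have [j _ Gj] : (\bigcup_k G k) (uncons_rV z).2 by rewrite -GT.
  exists (maxn i j) => //; split.
  - by move: Fi; exact/subsetPset/ndF/leq_maxl.
  - by move: Gj; exact/subsetPset/ndG/leq_maxr.
move=> k; have [mFk Fk] := mF k; have [mGk Gk] := mG k; split.
  rewrite -[X in measurable X]setTI; apply: measurable_uncons_rV => //.
  exact: measurableX.
rewrite /lebesgue_cons /pushforward -comp_preimage.
rewrite (_ : uncons_rV \o cons_rV = id); last first.
  by apply/funext => p /=; rewrite cons_rVK.
by rewrite preimage_id product_measure1E// lte_mul_pinfty// ge0_fin_numE.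
Qed.

HB.instance Definition _ := Measure_isSigmaFinite.Build _ _ _
  lebesgue_cons sigma_finite_lebesgue_cons.

End LebesgueRow.

Fixpoint lebesgue_rV (R : realType) (m : nat) :
    {sigma_finite_measure set 'rV[R]_m -> \bar R} :=
  match m with
  | 0 => \d_(0 : 'rV[R]_0)
  | n.+1 => lebesgue_cons (lebesgue_rV R n)
  end.

Lemma lebesgue_rV_box (R : realType) (m : nat) (a b : 'rV[R]_m) :
  (forall i, a 0 i <= b 0 i) ->
  lebesgue_rV R m [set z | forall i, z 0 i \in `[a 0 i, b 0 i]] =
  (\prod_i (b 0 i - a 0 i))%:E.
Proof.
elim: m a b => [|m IHm] a b ab.
  by rewrite big_ord0 /= diracE mem_set//= => -[].
pose a' : 'rV[R]_m := \row_j a 0 (lift ord0 j).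
pose b' : 'rV[R]_m := \row_j b 0 (lift ord0 j).
have box_meas : measurable [set z : 'rV[R]_m | forall i, z 0 i \in `[a' 0 i, b' 0 i]].
  rewrite (_ : [set _ | _] =
      \bigcap_(i in [set: 'I_m]) (rV_coord i @^-1` `[a' 0 i, b' 0 i])).
    apply: fin_bigcap_measurable => // i _.
    by rewrite -[X in measurable X]setTI; exact: measurable_rV_coord.
  by apply/seteqP; split => z /= h i; [move=> _|]; exact: h.
rewrite /= /lebesgue_cons /pushforward.
rewrite (_ : _ @^-1` _ = `[a 0 ord0, b 0 ord0]%classic `*`
    [set z : 'rV[R]_m | forall i, z 0 i \in `[a' 0 i, b' 0 i]]); last first.
  apply/seteqP; split => -[t z] /=.
    move=> h; split; first by have := h ord0; rewrite /cons_rV mxE unlift_none.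
    by move=> i; have := h (lift ord0 i); rewrite /cons_rV !mxE liftK.
  move=> [ht hz] i; rewrite /cons_rV mxE; have [j ->|->] := unliftP ord0 i.
    by have := hz j; rewrite !mxE.
  exact: ht.
rewrite product_measure1E//= lebesgue_measure_itv/= lte_fin big_ord_recl EFinM.
have -> : \prod_(i < m) (b 0 (lift ord0 i) - a 0 (lift ord0 i)) =
          \prod_i (b' 0 i - a' 0 i) by apply: eq_bigr => i _; rewrite !mxE.
rewrite IHm; last by move=> i; rewrite !mxE.
congr mule; case: ltP => // ba.
by have -> : b 0 ord0 = a 0 ord0 by [apply/eqP; rewrite eq_le ba ab]; rewrite subrr.
Qed.

Section Euclidean.
Context (R : realType) (m : nat).
Implicit Types (x y z : 'rV[R]_m) (Omega : set 'rV[R]_m).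

(* The library norm `|z| on 'rV[R]_m is the sup norm; it is only used for
   topological notions (open, compact, bounded, Lipschitz). *)
Definition dot x y : R := \sum_i x 0 i * y 0 i.
Definition enorm x : R := Num.sqrt (dot x x).

Definition bounded_domain Omega :=
  [/\ open Omega, connected Omega, Omega !=set0 & bounded_set Omega].

(* Topological boundary of an open set. *)
Definition bdry Omega : set 'rV[R]_m := closure Omega `\` Omega.

Definition light_segment Omega (u : 'rV[R]_m -> R) x y :=
  [/\ x != y, (forall t : R, 0 <= t <= 1 -> Omega (x + t *: (y - x)))
    & u y - u x = enorm (y - x)].

(* gamma is affine on each interval of the subdivision 0 :: ts of [0, 1]. *)
Definition piecewise_affine (gamma : R -> 'rV[R]_m) (ts : seq R) :=
  [/\ path <%R 0 ts, last 0 ts = 1 &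
    forall k, (k < size ts)%N -> forall s : R, 0 <= s <= 1 ->
      let a := nth 0 (0 :: ts) k in let b := nth 0 ts k in
      gamma ((1 - s) * a + s * b) = (1 - s) *: gamma a + s *: gamma b].

Definition polygonal_length (gamma : R -> 'rV[R]_m) (ts : seq R) : R :=
  \sum_(k < size ts) enorm (gamma (nth 0 ts k) - gamma (nth 0 (0 :: ts) k)).

(* d_{closure Omega}(x, y), for x, y in closure Omega. *)
Definition path_dist Omega x y : \bar R :=
  ereal_inf [set l | exists gamma ts,
    [/\ piecewise_affine gamma ts, gamma 0 = x, gamma 1 = y,
        (forall t : R, 0 < t < 1 -> Omega (gamma t))
      & l = (polygonal_length gamma ts)%:E]].

(* S(bdry Omega); only the values of phi on bdry Omega matter. *)
Definition spacelike_data Omega (phi : 'rV[R]_m -> R) :=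
  {within bdry Omega, continuous phi} /\
  forall x y, bdry Omega x -> bdry Omega y -> x != y ->
    (`|phi x - phi y|%:E < path_dist Omega x y)%E.

End Euclidean.

Section Sobolev.
Context (R : realType) (m : nat).
Implicit Types (Omega : set 'rV[R]_m) (f v eta : 'rV[R]_m -> R).

Definition partial (i : 'I_m) f : 'rV[R]_m -> R :=
  fun z => 'D_(delta_mx 0 i) f z.

Definition smooth f := forall s : seq 'I_m,
  continuous (foldr partial f s) /\
  forall i z, derivable (foldr partial f s) z (delta_mx 0 i).

Definition compact_support_in Omega f :=
  compact (closure [set z | f z != 0]) /\
  closure [set z | f z != 0] `<=` Omega.

Definition test_function Omega f := smooth f /\ compact_support_in Omega f.

Definition locally_integrable_on Omega (f : 'rV[R]_m -> \bar R) :=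
  forall K, compact K -> K `<=` Omega -> (lebesgue_rV R m).-integrable K f.

Definition weak_gradient Omega v (g : 'rV[R]_m -> 'rV[R]_m) :=
  [/\ locally_integrable_on Omega (EFin \o v),
      (forall i, locally_integrable_on Omega (fun z => (g z 0 i)%:E))
    & forall eta i, test_function Omega eta ->
      (\int[lebesgue_rV R m]_(z in Omega) (v z * partial i eta z)%:E =
       - \int[lebesgue_rV R m]_(z in Omega) (g z 0 i * eta z)%:E)%E].

(* A choice of weak gradient, which is unique up to a null set; 0 if there is
   none. *)
Definition grad Omega v : 'rV[R]_m -> 'rV[R]_m :=
  xget (fun=> 0) [set g | weak_gradient Omega v g].

Definition Lpnorm Omega (p : \bar R) f : \bar R :=
  Lnorm (lebesgue_rV R m) p (EFin \o (f \_ Omega)).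

Definition grad_norm Omega v : 'rV[R]_m -> R := fun z => enorm (grad Omega v z).

Definition sobolev Omega (p : \bar R) v :=
  [/\ exists g, weak_gradient Omega v g, (Lpnorm Omega p v < +oo)%E
    & (Lpnorm Omega p (grad_norm Omega v) < +oo)%E].

Definition sobolev_norm Omega (p : \bar R) v : \bar R :=
  (Lpnorm Omega p v + Lpnorm Omega p (grad_norm Omega v))%E.

Definition sup_norm Omega v : \bar R :=
  ereal_sup [set `|v z|%:E | z in closure Omega].

Definition vanishes_at_infinity v :=
  forall e : R, 0 < e -> exists M : R, forall z, M < enorm z -> `|v z| < e.

End Sobolev.

Section BornInfeld.
Context (R : realType) (m : nat).
Implicit Types (Omega : set 'rV[R]_m) (phi u v eta : 'rV[R]_m -> R).
Implicit Types (rho : ('rV[R]_m -> R) -> R).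

(* Elements of Y(Omega) are represented by functions on 'rV[R]_m, of which only
   the restriction to closure Omega is relevant. *)
Definition Y_bounded Omega (p1 : R) : set ('rV[R]_m -> R) :=
  [set v | sobolev Omega p1%:E v /\ {within closure Omega, continuous v}].

Definition Y_bounded_norm Omega (p1 : R) v : \bar R :=
  maxe (sobolev_norm Omega p1%:E v) (sup_norm Omega v).

Definition Y_whole_norm (p1 : R) v : \bar R :=
  maxe (Lpnorm setT 2%:E (grad_norm setT v))
       (Lpnorm setT p1%:E (grad_norm setT v)).

(* The completion of C_c^oo for Y_whole_norm, realized (by Sobolev embedding,
   m >= 3 and p1 > m) as a space of continuous functions vanishing at infinity,
   on which the gradient seminorm is a norm. *)
Definition Y_whole (p1 : R) : set ('rV[R]_m -> R) :=
  [set v | [/\ continuous v, vanishes_at_infinity v,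
    exists g, weak_gradient setT v g
    & forall e : R, 0 < e -> exists2 psi, test_function setT psi &
        (Y_whole_norm p1 (fun z => v z - psi z)%R < e%:E)%E]].

Definition Y Omega (p1 : R) : set ('rV[R]_m -> R) :=
  if `[< Omega = setT >] then Y_whole p1 else Y_bounded Omega p1.

Definition Y_norm Omega (p1 : R) : ('rV[R]_m -> R) -> \bar R :=
  if `[< Omega = setT >] then Y_whole_norm p1 else Y_bounded_norm Omega p1.

(* rho is in Y(Omega)^*.  Boundedness makes rho v independent of the function
   representing an element of Y(Omega). *)
Definition Y_dual Omega (p1 : R) rho :=
  (forall (a : R) u v, Y Omega p1 u -> Y Omega p1 v ->
     rho (fun z => a * u z + v z) = a * rho u + rho v) /\
  exists C : R, forall v, Y Omega p1 v ->
     (`|rho v|%:E <= C%:E * Y_norm Omega p1 v)%E.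

(* u = phi on the boundary, tested along open segments x + ]0, 1[ w in Omega. *)
Definition boundary_value Omega phi u := forall x w, bdry Omega x ->
  (forall t : R, 0 < t < 1 -> Omega (x + t *: w)) ->
  u (x + t *: w) @[t --> 0^'+] --> phi x.

(* An element of W^{1,oo}(Omega) with |Du| <= 1 is represented by its continuous
   version in Omega, and its values on bdry Omega are those of its continuous
   extension to closure Omega, i.e. phi. *)
Definition Yphi_bounded Omega phi : set ('rV[R]_m -> R) :=
  [set u | [/\ sobolev Omega +oo%E u, {within Omega, continuous u},
    {ae lebesgue_rV R m, forall z, Omega z -> grad_norm Omega u z <= 1},
    boundary_value Omega phi u & forall x, bdry Omega x -> u x = phi x]].

Definition Yphi_whole (p1 : R) : set ('rV[R]_m -> R) :=
  [set v | Y_whole p1 v /\ (Lpnorm setT +oo%E (grad_norm setT v) <= 1)%E].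

Definition Yphi Omega (p1 : R) phi : set ('rV[R]_m -> R) :=
  if `[< Omega = setT >] then Yphi_whole p1 else Yphi_bounded Omega phi.

Definition BI_energy Omega rho v : \bar R :=
  (\int[lebesgue_rV R m]_(z in Omega)
     (1 - Num.sqrt (1 - grad_norm Omega v z ^+ 2))%:E - (rho v)%:E)%E.

Definition minimizes (F : ('rV[R]_m -> R) -> \bar R)
    (A : set ('rV[R]_m -> R)) u :=
  A u /\ forall v, A v -> (F u <= F v)%E.

(* The extended-real inverse satisfies 0^-1 = +oo, so that local integrability
   of the Lorentz factor forces |Du| < 1 almost everywhere. *)
Definition lorentz_factor Omega u (z : 'rV[R]_m) : \bar R :=
  ((Num.sqrt (1 - grad_norm Omega u z ^+ 2))%:E^-1)%E.

Definition BI_weak_solution Omega (p1 : R) phi rho u :=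
  [/\ Yphi Omega p1 phi u, locally_integrable_on Omega (lorentz_factor Omega u)
    & forall eta, [lipschitz eta z | z in setT] -> compact_support_in Omega eta ->
      (\int[lebesgue_rV R m]_(z in Omega)
         ((dot (grad Omega u z) (grad Omega eta z))%:E * lorentz_factor Omega u z)
       = (rho eta)%:E)%E].

Definition delta (z : 'rV[R]_m) : ('rV[R]_m -> R) -> R := fun v => v z.

End BornInfeld.

(* Main.v *)
(* If |Dv| <= 1 then v is 1-Lipschitz along segments of Omega, so
   v(y) - v(x) <= |y - x| = u(y) - u(x): adding -alpha (v(y) - v(x)) to I_rho
   raises every other competitor at least as much as u, and u still minimizes.
   For the second claim, prolong the light segment as far as u stays light on it.
   The prolongation cannot leave Omega at both ends, by the strict inequality
   defining S(bdry Omega), nor be unbounded, as u vanishes at infinity when Omega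
   is the whole space; say that it stops inside Omega, at y or beyond.
   Near the remaining light segment S issuing from y, u(z) - u(y) < |z - y| off S,
   since equality would produce a light broken line with a corner at y.
   Hence f(z) = u(z) - u(y) + 2 d - sqrt(d^2 + |z - y|^2) is, for small d, negative
   away from S, positive at y and nonpositive at x, and eta = - P(f), with P a C^1
   function vanishing on the negative half line and 0 <= P' <= 1 on the values of f,
   satisfies eta(y) < eta(x) and
   D eta = a (Du - b) with -1 <= a <= 0 and |b| <= 1.  So u + t eta is admissible for
   0 <= t <= 1, and minimality of u for I_rho yields, by dominated convergence with
   the Lorentz factor as bound, <rho, eta> <= int w Du . D eta.  A weak solution with
   source rho_alpha would make the right-hand side
   <rho, eta> + alpha (eta(y) - eta(x)) < <rho, eta>. *)
Require Import Defs.
From HB Require Import structures.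
From mathcomp Require Import all_boot all_order all_algebra.
From mathcomp Require Import all_classical all_reals all_analysis.
From mathcomp Require Import measurable_realfun ess_sup_inf ring lra.
Import numFieldNormedType.Exports.
Import Order.TTheory GRing.Theory Num.Theory.

Set Implicit Arguments.
Unset Strict Implicit.
Unset Printing Implicit Defensive.

Local Open Scope classical_set_scope.
Local Open Scope ring_scope.

(** * Lebesgue measure on row vectors *)

Section RowMeasure.
Context {R : realType} {m : nat}.
Implicit Types (x y z a b : 'rV[R]_m) (U K : set 'rV[R]_m).
Local Notation mu := (lebesgue_rV R m).

(** The bound on [Du] holds almost everywhere only, while a light segment is a null set.
    Mollification bridges the gap: averaging carries the bound to every point, hence to segments.
    The same device gives the chain rule for P(f), where the delicate term is the product of a
    converging coefficient with mollified gradients.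

    The cone |z - y| is smoothed because b must be continuous with |b| <= 1: Du + t D eta = (1 + t
    a) Du - t a b then stays in the unit ball even where [u] saturates the constraint. Only t >= 0
    being allowed, minimality gives an inequality instead of the Euler-Lagrange equation, and the
    sign of eta(y) - eta(x) is what makes this one-sided information contradictory.

    The functional [rho] is linear on Y(Omega) only, so [u] and eta must be placed there. On a
    bounded domain this means continuity of [u] up to a possibly irregular boundary. On the whole
    space it means approximating eta by test functions: the approximability of Du, built into the
    definition of the space, is passed on to D eta. *)

Lemma norm_rV_le z (e : R) : 0 <= e -> (`|z| <= e) = [forall i, `|z 0 i| <= e].
Proof.
move=> e0; rewrite [leLHS]/Num.norm/= mx_normrE.
apply/bigmax_leP/forallP => [[_ h] i|h]; first by have := h (0, i) isT.
by split => // -[i j] _ /=; rewrite ord1.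
Qed.

Lemma norm_rV_lt z (e : R) : 0 < e -> (`|z| < e) = [forall i, `|z 0 i| < e].
Proof.
move=> e0; rewrite [ltLHS]/Num.norm/= mx_normrE.
apply/bigmax_ltP/forallP => [[_ h] i|h]; first by have := h (0, i) isT.
by split => // -[i j] _ /=; rewrite ord1.
Qed.

Lemma coord_le_norm z i : `|z 0 i| <= `|z|.
Proof.
by have := lexx `|z|; rewrite {1}norm_rV_le ?normr_ge0// => /forallP.
Qed.

Definition obox a b : set 'rV[R]_m := [set z | forall i, a 0 i < z 0 i < b 0 i].

Lemma measurable_coord i : measurable_fun setT (fun z : 'rV[R]_m => z 0 i).
Proof. exact: measurable_rV_coord. Qed.

Lemma measurable_coordwise (P : 'I_m -> set R) :
  (forall i, measurable (P i)) -> measurable [set z : 'rV[R]_m | forall i, P i (z 0 i)].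
Proof.
move=> mP; rewrite (_ : [set _ | _] =
    \bigcap_(i in [set: 'I_m]) (rV_coord i @^-1` P i)).
  apply: fin_bigcap_measurable => // i _.
  by rewrite -[X in measurable X]setTI; apply: measurable_rV_coord => //; exact: mP.
by apply/seteqP; split => z /= h i; [move=> _|]; exact: h.
Qed.

Lemma measurable_obox a b : measurable (obox a b).
Proof.
rewrite (_ : obox a b = [set z | forall i, `]a 0 i, b 0 i[%classic (z 0 i)]).
  apply: (measurable_coordwise (P := fun i => `]a 0 i, b 0 i[%classic)) => i.
  exact: measurable_itv.
by apply/seteqP; split => z /= h i; have := h i; rewrite /= in_itv.
Qed.

Lemma ball_obox z (e : R) : 0 < e -> ball z e = obox (z - const_mx e) (z + const_mx e).
Proof.
move=> e0; rewrite -ball_normE; apply/seteqP; split => y /=; rewrite norm_rV_lt//.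
  move=> /forallP h i; have := h i; rewrite !mxE ltr_norml => /andP[? ?].
  apply/andP; split; lra.
by move=> h; apply/forallP => i; have := h i; rewrite !mxE ltr_norml => /andP[? ?]; apply/andP; split; lra.
Qed.

(** The sigma-algebra is generated by the coordinates; that it contains the topology comes from
    writing an open set as the union of the countably many balls with rational centre and radius
    [n.+1%:R^-1] inside it, each of which is an open box for the sup norm. *)
Lemma open_measurable_rV U : open U -> measurable U.
Proof.
move=> oU.
pose Q (z : 'rV[rat]_m) : 'rV[R]_m := map_mx ratr z.
pose B (p : 'rV[rat]_m * nat) := ball (Q p.1) (p.2.+1%:R^-1 : R).
rewrite (_ : U = \bigcup_(p in [set p | B p `<=` U]) B p).
  rewrite bigcup_mkcond; apply: countable_bigcupT_measurable; first exact: countableP.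
  by move=> p; case: ifP => // _; rewrite /B ball_obox//; exact: measurable_obox.
apply/seteqP; split => [z Uz|z [p /= pU]]; last exact: pU.
have /nbhs_ballP[e /= e0 eU] := open_nbhs_nbhs (conj oU Uz).
have [n ne] : exists n : nat, n.+1%:R^-1 < e / 2.
  by have /ltr_add_invr[n] : 0 < e / 2 by [rewrite divr_gt0]; rewrite add0r; exists n.
have n0 : 0 < n.+1%:R^-1 :> R by rewrite invr_gt0.
have /choice[q hq] : forall i, exists q : rat, `|z 0 i - ratr q| < n.+1%:R^-1.
  move=> i; have : (z 0 i - n.+1%:R^-1 < z 0 i + n.+1%:R^-1) by rewrite ltrBlDr -addrA ltrDl addr_gt0.
  by move=> /rat_in_itvoo[q]; rewrite in_itv/= -ltr_distl distrC; exists q.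
pose q' : 'rV[rat]_m := \row_i q i.
have zq : `|z - Q q'| < n.+1%:R^-1.
  by rewrite norm_rV_lt//; apply/forallP => i; rewrite !mxE.
exists (q', n).
  move=> y; rewrite /B -ball_normE /= => qy; apply: eU; rewrite -ball_normE /=.
  rewrite (_ : z - y = (z - Q q') + (Q q' - y)); last by rewrite addrA subrK.
  apply: le_lt_trans (ler_normD _ _) _; rewrite [ltRHS]splitr.
  by apply: lt_trans (ltrD zq qy) _; rewrite ltrD.
by rewrite /B -ball_normE/= distrC.
Qed.

Lemma closed_measurable_rV U : closed U -> measurable U.
Proof.
by move=> cU; rewrite -(setCK U); apply: measurableC; apply: open_measurable_rV; exact: closed_openC.
Qed.

Lemma compact_measurable_rV K : compact K -> measurable K.
Proof. by move=> cK; apply: closed_measurable_rV; apply: compact_closed cK; exact: norm_hausdorff. Qed.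

Lemma continuous_measurable_rV (f : 'rV[R]_m -> R) : continuous f -> measurable_fun setT f.
Proof.
move=> cf; apply: (measurability _ (RGenOpens.measurableE R)).
move=> _ [_ [a [b ->] <-]]; rewrite setTI; apply: open_measurable_rV.
by move/continuousP : cf; apply; exact: interval_open.
Qed.

(** Boxes generate because a half-space [r < z 0 i] is exhausted by boxes with one face fixed at [r]
    and all others moving to infinity. This feeds the uniqueness of measures below. *)
Lemma measurable_rVE : @measurable _ 'rV[R]_m = <<s [set obox p.1 p.2 | p in [set: 'rV[R]_m * 'rV[R]_m]] >>.
Proof.
set G := [set _ | _ in _].
apply/seteqP; split; last first.
  apply: smallest_sub; first exact: sigma_algebra_measurable.
  by move=> _ [[a b] _ <-] /=; exact: measurable_obox.
apply: smallest_sub; first exact: smallest_sigma_algebra.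
move=> B; rewrite -bigcup_seq => -[i _ [Y mY <-]] /=.
have : measurable_fun setT (rV_coord i : g_sigma_algebraType G -> measurableTypeR R).
  apply: (measurability _ (RGenOInfty.measurableE R)) => _ [_ [r ->] <-].
  rewrite setTI (_ : _ @^-1` _ = \bigcup_n
      obox (\row_j if j == i then r else - n%:R) (const_mx n%:R)).
    apply: bigcupT_measurable => n; apply: sub_sigma_algebra.
    by exists (\row_j if j == i then r else - n%:R, const_mx n%:R).
  apply/seteqP; split => z /=; rewrite in_itv/= andbT; last first.
    by move=> [n _] /(_ i); rewrite !mxE eqxx => /andP[].
  move=> rz; have [n zn] : exists n : nat, `|z| < n%:R.
    by exists (Num.bound `|z|); exact: archi_boundP.
  exists n => // j; rewrite !mxE.
  have := le_lt_trans (coord_le_norm z j) zn; rewrite ltr_norml => /andP[h1 ->].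
  by rewrite andbT; case: eqP => [->|].
by move=> /(_ measurableT _ mY).
Qed.

(** Boxes are stable under intersection and the cubes with faces at [- n%:R] and [n%:R] exhaust the
    space, so the uniqueness theorem for measures on a generating pi-system applies. It serves both
    translation invariance and the fundamental lemma. *)
Lemma obox_measure_unique (m1 m2 : {measure set 'rV[R]_m -> \bar R}) :
  (forall a b, m1 (obox a b) = m2 (obox a b)) ->
  (forall a b, (m1 (obox a b) < +oo)%E) ->
  forall A, measurable A -> m1 A = m2 A.
Proof.
move=> m12 m1oo A mA.
apply: (measure_unique [set obox p.1 p.2 | p in [set: 'rV[R]_m * 'rV[R]_m]]
  (fun n => obox (const_mx (- n%:R)) (const_mx n%:R))) => //.
- exact: measurable_rVE.
- move=> _ _ [[a b] _ <-] [[c d] _ <-] /=.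
  exists (\row_i Num.max (a 0 i) (c 0 i), \row_i Num.min (b 0 i) (d 0 i)) => //=.
  apply/seteqP; split => z /=.
    move=> h; split => i; have := h i; rewrite !mxE gt_max lt_min => /andP[/andP[? ?]] /andP[? ?]; exact/andP.
  by move=> [h1 h2] i; rewrite !mxE gt_max lt_min; have /andP[-> ->] := h1 i; have /andP[-> ->] := h2 i.
- by move=> n; exists (const_mx (- n%:R), const_mx n%:R).
- apply/seteqP; split => // z _.
  have zn : `|z| < (Num.bound `|z|)%:R.
    exact: archi_boundP.
  exists (Num.bound `|z|) => // i; rewrite !mxE -ltr_norml.
  exact: le_lt_trans (coord_le_norm z i) zn.
- by move=> _ [[a b] _ <-]; exact: m12.
Qed.

End RowMeasure.

Lemma lebesgue_rV_obox (R : realType) (m : nat) (a b : 'rV[R]_m) :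
  (forall i, a 0 i <= b 0 i) -> lebesgue_rV R m (obox a b) = (\prod_i (b 0 i - a 0 i))%:E.
Proof.
elim: m a b => [|m IHm] a b ab.
  by rewrite big_ord0 /= diracE mem_set//= => -[].
pose a' : 'rV[R]_m := \row_j a 0 (lift ord0 j).
pose b' : 'rV[R]_m := \row_j b 0 (lift ord0 j).
rewrite /= /lebesgue_cons /pushforward.
rewrite (_ : _ @^-1` _ = `]a 0 ord0, b 0 ord0[%classic `*` obox a' b'); last first.
  apply/seteqP; split => -[t z] /=.
    move=> h; split; first by have := h ord0; rewrite /cons_rV mxE unlift_none in_itv.
    by move=> i; have := h (lift ord0 i); rewrite /cons_rV !mxE liftK.
  move=> [ht hz] i; rewrite /cons_rV mxE; have [j ->|->] := unliftP ord0 i.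
    by have := hz j; rewrite !mxE.
  by move: ht; rewrite in_itv.
rewrite product_measure1E//=; last exact: measurable_obox.
rewrite lebesgue_measure_itv/= lte_fin big_ord_recl EFinM.
have -> : \prod_(i < m) (b 0 (lift ord0 i) - a 0 (lift ord0 i)) =
          \prod_i (b' 0 i - a' 0 i) by apply: eq_bigr => i _; rewrite !mxE.
rewrite IHm; last by move=> i; rewrite !mxE.
congr mule; case: ltP => // ba.
by have -> : b 0 ord0 = a 0 ord0 by [apply/eqP; rewrite eq_le ba ab]; rewrite subrr.
Qed.

(** * Translation invariance of Lebesgue measure *)

Section Translation.
Context {R : realType} {m : nat}.
Implicit Types (x y z a b c : 'rV[R]_m) (U K : set 'rV[R]_m).
Local Notation mu := (lebesgue_rV R m).

Lemma obox_eq0 a b i : b 0 i <= a 0 i -> obox a b = set0.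
Proof.
move=> ba; apply/seteqP; split => // z /(_ i) /andP[h1 h2].
by have := lt_trans h1 h2; rewrite ltNge ba.
Qed.

Lemma obox_fin a b : (mu (obox a b) < +oo)%E.
Proof.
have [/forallP ab|] := boolP [forall i, a 0 i <= b 0 i].
  by rewrite lebesgue_rV_obox// ltry.
rewrite negb_forall => /existsP[i]; rewrite -ltNge => ba.
by rewrite (obox_eq0 (ltW ba)) measure0.
Qed.

Lemma measurable_shift c : measurable_fun setT (fun z => z + c).
Proof.
apply: measurable_fun_rV => i.
rewrite (_ : _ \o _ = fun z : 'rV[R]_m => (z 0 i + c 0 i : measurableTypeR R)).
  by apply: measurable_funD => //; exact: measurable_coord.
by apply/funext => z /=; rewrite /rV_coord mxE.
Qed.

(** A shift preserves the side lengths of a box, and boxes determine the measure. Boxes with a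
    reversed face are empty and treated apart, the product formula requiring ordered faces. *)
Lemma lebesgue_rV_shift c A : measurable A -> pushforward mu (fun z => z + c) A = mu A.
Proof.
have ob a b : (fun z => z + c) @^-1` obox a b = obox (a - c) (b - c).
  apply/seteqP; split => z /= h i; have := h i; rewrite !mxE.
    by rewrite ltrBlDr ltrBrDr.
  by rewrite ltrBlDr ltrBrDr.
pose nu := measure_function_pushforward__canonical__measure_function_Measure mu (measurable_shift c).
apply: (obox_measure_unique (m1 := nu) (m2 := mu)) => a b; last first.
  by rewrite /= /pushforward ob obox_fin.
rewrite /= /pushforward ob.
have [/forallP ab|] := boolP [forall i, a 0 i <= b 0 i].
  rewrite !lebesgue_rV_obox// => [|i]; last by rewrite !mxE lerD2r.
  by congr EFin; apply: eq_bigr => i _; rewrite !mxE opprD addrACA subrr addr0.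
rewrite negb_forall => /existsP[i]; rewrite -ltNge => ba.
rewrite (obox_eq0 (ltW ba)) (@obox_eq0 (a - c) (b - c) i) ?measure0// !mxE lerD2r; exact: ltW.
Qed.

Lemma ge0_integral_shift c (f : 'rV[R]_m -> \bar R) :
  measurable_fun setT f -> (forall z, 0 <= f z)%E ->
  (\int[mu]_z f (z + c)%R = \int[mu]_z f z)%E.
Proof.
move=> mf f0.
rewrite -[LHS](@ge0_integral_pushforward _ _ _ _ _ _ (measurable_shift c) mu setT)//.
apply: (eq_measure_integral mu (m1 := measure_function_pushforward__canonical__measure_function_Measure mu (measurable_shift c))).
by move=> A mA _; exact: lebesgue_rV_shift.
Qed.

Lemma integrable_shift c (f : 'rV[R]_m -> \bar R) :
  mu.-integrable setT f -> mu.-integrable setT (fun z => f (z + c)).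
Proof.
move=> /integrableP[mf fi]; apply/integrableP; split.
  by apply: measurableT_comp => //; exact: measurable_shift.
rewrite (@ge0_integral_shift c (fun z => `|f z|%E))//.
exact: measurableT_comp.
Qed.

Lemma integral_shift c (f : 'rV[R]_m -> \bar R) : mu.-integrable setT f ->
  (\int[mu]_z f (z + c)%R = \int[mu]_z f z)%E.
Proof.
move=> fi; have mf := measurable_int _ fi.
rewrite -[LHS](@integral_pushforward _ _ _ _ _ _ (measurable_shift c) mu setT)//; last exact: integrable_shift.
apply: (eq_measure_integral mu (m1 := measure_function_pushforward__canonical__measure_function_Measure mu (measurable_shift c))).
by move=> A mA _; exact: lebesgue_rV_shift.
Qed.

Lemma compact_fin_measure K : compact K -> (mu K < +oo)%E.
Proof.
move=> cK; have [M [_ Mb]] := compact_bounded cK.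
pose r := M + 1.
apply: le_lt_trans (obox_fin (const_mx (- (r + 1))) (const_mx (r + 1))).
apply: le_measure; rewrite ?inE; [exact: compact_measurable_rV|exact: measurable_obox|].
move=> z Kz i; rewrite !mxE -ltr_norml.
apply: le_lt_trans (coord_le_norm z i) _; apply: le_lt_trans (Mb r _ z Kz) _; rewrite /r ?ltrDl//.
Qed.

Lemma compact_integrable K (f : 'rV[R]_m -> R) (M : R) : compact K ->
  measurable_fun K f -> (forall z, K z -> `|f z| <= M) -> mu.-integrable K (EFin \o f).
Proof.
move=> cK mf fM; have mK := compact_measurable_rV cK.
apply: measurable_bounded_integrable => //; first exact: compact_fin_measure.
exists M; split; first exact: num_real.
by move=> x Mx z /fM /le_trans; apply; exact: ltW.
Qed.

End Translation.

(** * Smooth bump functions *)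

Section DirectionalDerivatives.
Context {R : realType} {V : normedModType R}.
Implicit Types (f : V -> R) (x v : V).

(** The two difference quotients are the same function of [h]. Directional derivatives are computed
    throughout by this reduction to one real variable. *)
Lemma is_derive_line f x v df :
  is_derive x v f df <-> is_derive (0 : R) 1 (fun h : R => f (h *: v + x)) df.
Proof.
have e : (fun h : R => h^-1 *: ((f \o shift x) (h *: v) - f x)) =
         (fun h : R => h^-1 *: (((fun h : R => f (h *: v + x)) \o shift 0) (h *: 1) - f (0 *: v + x))).
  by apply/funext => h /=; rewrite addr0 scale0r add0r [_%:A]mulr1.
split=> -[]; rewrite /derivable /derive => h1 h2; apply: DeriveDef; rewrite /derivable /derive -?e//.
- by move: h1; rewrite /= -e.
- by move: h2; rewrite /= -e.
Qed.

Lemma is_derive_comp1 (g : R -> R) f x v dg df :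
  is_derive (f x) 1 g dg -> is_derive x v f df ->
  is_derive x v (fun z => g (f z)) (dg * df).
Proof.
move=> hg /is_derive_line hf; apply/is_derive_line.
have hg' : is_derive (f (0 *: v + x)) 1 g dg by rewrite scale0r add0r.
exact: (@is_derive1_comp R g (fun h => f (h *: v + x)) 0 dg df).
Qed.

Lemma is_derive_ext f g x v df : f =1 g -> is_derive x v f df -> is_derive x v g df.
Proof. by move=> /funext ->. Qed.

Lemma is_derive_affine f x v df (a c : R) :
  is_derive x v f df -> is_derive x v (fun z => a + c * f z) (c * df).
Proof.
move=> h; apply: is_derive_eq (is_deriveD (is_derive_cst a x v) (is_deriveZ c h)) _.
by rewrite add0r.
Qed.

End DirectionalDerivatives.

Lemma is_derive_exprn (R : realType) n (x : R) :
  is_derive x 1 (fun x : R => x ^+ n) (n%:R * x ^+ n.-1).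
Proof.
by apply: DeriveDef; [exact: exprn_derivable|rewrite exp_derive [LHS]mulr1].
Qed.

Section FlatExp.
Context {R : realType}.

(** [flatexp 0] is the classical flat function exp(-1/t). The powers of 1/t are carried along
    because the derivative of [flatexp n] is a combination of [flatexp n.+1] and [flatexp n.+2], so
    the family is closed under differentiation. *)
Definition flatexp (n : nat) (t : R) : R := if 0 < t then t^-1 ^+ n * expR (- t^-1) else 0.

Lemma flatexp_ge0 n t : 0 <= flatexp n t.
Proof.
rewrite /flatexp; case: ifPn => // t0.
by rewrite mulr_ge0 ?expR_ge0// exprn_ge0// invr_ge0 ltW.
Qed.

Lemma flatexp_gt0 n t : (0 < flatexp n t) = (0 < t).
Proof.
rewrite /flatexp; case: ifPn => t0; last by rewrite ltxx.
by rewrite mulr_gt0 ?expR_gt0// exprn_gt0// invr_gt0.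
Qed.

Lemma flatexp0_le1 t : flatexp 0 t <= 1.
Proof.
rewrite /flatexp; case: ifPn => // t0.
by rewrite expr0 mul1r expR_le1 oppr_le0 invr_ge0 ltW.
Qed.

(** With s = 1/t this is the lower bound of exp(s) by its Taylor term s^(n+2)/(n+2)!. It gives the
    derivative at 0, and for n = 2 the constant 24 = 4! used to normalise the competitor. *)
Lemma flatexp_le_sqr n t : flatexp n t <= (n.+2)`!%:R * t ^+ 2.
Proof.
rewrite /flatexp; case: ifPn => t0; last by rewrite mulr_ge0// exprn_even_ge0.
have s0 : 0 < t^-1 by rewrite invr_gt0.
have := expR_ge1Dxn n.+1 (ltW s0).
move=> h; rewrite -[in leRHS](invrK t); move: (t^-1) s0 h => s s0 h.
rewrite expRN exprVn ler_pdivrMr ?expR_gt0// mulrAC ler_pdivlMr ?exprn_gt0//.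
have f0 : 0 < (n.+2)`!%:R :> R by rewrite ltr0n fact_gt0.
have : s ^+ n.+2 / (n.+2)`!%:R <= expR s by apply: le_trans h; rewrite lerDr.
by rewrite ler_pdivrMr// -exprD addn2 mulrC.
Qed.

Lemma is_derive_flatexp n (t : R) :
  is_derive t 1 (flatexp n) (- n%:R * flatexp n.+1 t + flatexp n.+2 t).
Proof.
have [t0|t0|->] := ltgtP t 0.
- rewrite /flatexp ltNge (ltW t0)/= mulr0 addr0.
  apply: (near_eq_is_derive (f := cst 0)).
  near=> s; rewrite /flatexp ltNge ltW//; near: s; exact: (cvgr_lt t).
- rewrite /flatexp t0.
  apply: (near_eq_is_derive (f := (fun t : R => t^-1 ^+ n * expR (- t^-1) : R))).
    near=> s; rewrite /flatexp ifT//; near: s; exact: (cvgr_gt t).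
  have tn0 : t != 0 by rewrite gt_eqF.
  have dV : is_derive t 1 (fun t : R => t^-1) (- t ^- 2 *: 1).
    by have := is_deriveV (f := id) tn0 (is_derive_id _ _).
  have h1 := is_derive_comp1 (f := fun t : R => t^-1) (is_derive_exprn n t^-1) dV.
  have h2 := is_derive_comp1 (f := fun t : R => - t^-1) (is_derive_expR (- t^-1)) (is_deriveN dV).
  apply: is_derive_eq (is_deriveM h1 h2) _.
  rewrite !scaler1 /GRing.scale/= mulrN.
  by case: n {h1} => [|n]; rewrite -!exprVn !exprS; ring.
(* At 0 the quadratic bound makes the difference quotient of order |h|. *)
- rewrite /flatexp ltxx mulr0 addr0 -/(flatexp n).
  suff h : (fun h : R => h^-1 *: ((flatexp n \o shift 0) (h *: 1) - flatexp n 0)) @ 0^' --> (0 : R).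
    by apply: DeriveDef; [apply/cvg_ex; exists 0|apply/cvg_lim].
  apply/cvgr0Pnorm_le => e e0.
  near=> h => /=.
  have hn0 : h != 0 by near: h; exact: nbhs_dnbhs_neq.
  rewrite addr0 [_%:A]mulr1 {2}/flatexp ltxx subr0 normrM normfV.
  rewrite ler_pdivrMl ?normr_gt0// ger0_norm ?flatexp_ge0//.
  apply: le_trans (flatexp_le_sqr n h) _.
  rewrite -[h ^+ 2]ger0_norm ?sqr_ge0// normrX expr2 mulrCA ler_wpM2l ?normr_ge0//.
  have f0 : 0 < (n.+2)`!%:R :> R by rewrite ltr0n fact_gt0.
  rewrite -ler_pdivlMl//; near: h; apply: dnbhs0_le.
  by rewrite mulr_gt0// invr_gt0.
Unshelve. all: by end_near. Qed.

End FlatExp.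

Section SmoothFunctions.
Context {R : realType} {m : nat}.
Implicit Types (f g : 'rV[R]_m -> R) (z : 'rV[R]_m).

Lemma continuous_add f g : continuous f -> continuous g -> continuous (fun z => f z + g z).
Proof. by move=> cf cg z; exact: (continuousD (cf z) (cg z)). Qed.

Lemma continuous_mul f g : continuous f -> continuous g -> continuous (fun z => f z * g z).
Proof. by move=> cf cg z; exact: (continuousM (cf z) (cg z)). Qed.

Lemma continuous_cst (c : R) : continuous (fun _ : 'rV[R]_m => c).
Proof. exact: cst_continuous. Qed.

(** A graded form of [smooth]: the order [k] supports the inductions by which sums, products and
    translates are shown to be smooth. *)
Fixpoint Ck (k : nat) f : Prop :=
  continuous f /\
  if k is k'.+1 then forall i : 'I_m, (forall z, derivable f z (delta_mx 0 i)) /\ Ck k' (partial i f) else True.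

Lemma Ck_continuous k f : Ck k f -> continuous f.
Proof. by case: k => [|k] []. Qed.

Lemma CkW k f : Ck k.+1 f -> Ck k f.
Proof.
elim: k f => [f []//|k IHk f [cf h]]; split => // i.
by have [d /IHk] := h i.
Qed.

Lemma Ck_smooth f : (forall k, Ck k f) -> smooth f.
Proof.
move=> h s.
have {}h : forall k, Ck k (foldr (@partial R m) f s).
  elim: s => // i s IH k; have [_ /(_ i)[_]] := IH k.+1; exact.
split; first exact: Ck_continuous (h 0%N).
by move=> i z; have [_ /(_ i)[]] := h 1%N.
Qed.

Lemma smooth_Ck f : smooth f -> forall k, Ck k f.
Proof.
move=> sf k; elim: k f sf => [|k IHk] f sf; have [cf df] := sf [::]; split => // i.
split; first exact: df.
by apply: IHk => s; have := sf (rcons s i); rewrite foldr_rcons.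
Qed.

Lemma partialE f i z df : is_derive z (delta_mx 0 i) f df -> partial i f z = df.
Proof. by move=> h; rewrite /partial derive_val. Qed.

Lemma Ck_derive k f (df : 'I_m -> 'rV[R]_m -> R) : continuous f ->
  (forall i z, is_derive z (delta_mx 0 i) f (df i z)) ->
  (forall i, Ck k (df i)) -> Ck k.+1 f.
Proof.
move=> cf h1 h2; split => // i; split => [z|]; first by have [] := h1 i z.
by rewrite (_ : partial i f = df i)//; apply/funext => z; apply: partialE.
Qed.

Lemma Ck_is_derive k f i z : Ck k.+1 f -> is_derive z (delta_mx 0 i) f (partial i f z).
Proof. by move=> [_ /(_ i)[h _]]; apply: DeriveDef. Qed.

Lemma Ck_cst k (c : R) : Ck k (fun _ : 'rV[R]_m => c).
Proof.
have cc (c' : R) : continuous (fun _ : 'rV[R]_m => c') by exact: cst_continuous.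
elim: k c => [|k IHk] c; first by split.
apply: (@Ck_derive _ _ (fun _ _ => 0)) => // i z; exact: is_derive_cst.
Qed.

Lemma Ck_add k f g : Ck k f -> Ck k g -> Ck k (fun z => f z + g z).
Proof.
elim: k f g => [|k IHk] f g Cf Cg.
  by split => //; exact: (continuous_add (Ck_continuous Cf) (Ck_continuous Cg)).
apply: (@Ck_derive _ _ (fun i z => partial i f z + partial i g z)).
- by exact: (continuous_add (Ck_continuous Cf) (Ck_continuous Cg)).
- by move=> i z; exact: (is_deriveD (Ck_is_derive i z Cf) (Ck_is_derive i z Cg)).
- by move=> i; apply: IHk; [have [_ /(_ i)[]] := Cf|have [_ /(_ i)[]] := Cg].
Qed.

Lemma Ck_mul k f g : Ck k f -> Ck k g -> Ck k (fun z => f z * g z).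
Proof.
elim: k f g => [|k IHk] f g Cf Cg.
  by split => //; exact: (continuous_mul (Ck_continuous Cf) (Ck_continuous Cg)).
apply: (@Ck_derive _ _ (fun i z => f z * partial i g z + g z * partial i f z)).
- by exact: (continuous_mul (Ck_continuous Cf) (Ck_continuous Cg)).
- by move=> i z; exact: (is_deriveM (Ck_is_derive i z Cf) (Ck_is_derive i z Cg)).
- move=> i; apply: Ck_add; apply: IHk.
  + exact: CkW.
  + by have [_ /(_ i)[]] := Cg.
  + exact: CkW.
  + by have [_ /(_ i)[]] := Cf.
Qed.

Lemma Ck_exp k f n : Ck k f -> Ck k (fun z => f z ^+ n).
Proof.
move=> Cf; elim: n => [|n IH]; first exact: (Ck_cst k 1).
rewrite (_ : (fun _ => _) = fun z => f z * f z ^+ n); first exact: Ck_mul.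
by apply/funext => z; rewrite exprS.
Qed.

Lemma Ck_prod k (I : Type) (s : seq I) (F : I -> 'rV[R]_m -> R) :
  (forall i, Ck k (F i)) -> Ck k (fun z => \prod_(i <- s) F i z).
Proof.
move=> CF; elim: s => [|i s IH].
  rewrite (_ : (fun _ => _) = fun=> 1); first exact: Ck_cst.
  by apply/funext => z; rewrite big_nil.
rewrite (_ : (fun _ => _) = fun z => F i z * \prod_(j <- s) F j z); first exact: Ck_mul.
by apply/funext => z; rewrite big_cons.
Qed.

Lemma derive_translate f (a z v : 'rV[R]_m) df :
  is_derive (z - a) v f df -> is_derive z v (fun s => f (s - a)) df.
Proof.
by move=> /is_derive_line h; apply/is_derive_line; apply: is_derive_ext h => h; rewrite addrA.
Qed.

Lemma continuous_translate f (a : 'rV[R]_m) : continuous f -> continuous (fun s : 'rV[R]_m => f (s - a)).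
Proof.
move=> cf z; apply: (@continuous_comp _ _ _ (fun s : 'rV[R]_m => s - a) f); last exact: cf.
by apply: continuousB; [exact: cvg_id|exact: cst_continuous].
Qed.

Lemma Ck_translate k f (a : 'rV[R]_m) : Ck k f -> Ck k (fun s => f (s - a)).
Proof.
elim: k f => [|k IHk] f Cf; first by split => //; apply/continuous_translate/(Ck_continuous Cf).
apply: (@Ck_derive _ _ (fun i z => partial i f (z - a))).
- exact/continuous_translate/(Ck_continuous Cf).
- by move=> i z; exact: (derive_translate (Ck_is_derive i (z - a) Cf)).
- by move=> i; apply: IHk; have [_ /(_ i)[]] := Cf.
Qed.

Lemma continuous_affine_coord (a c : R) i : continuous (fun z : 'rV[R]_m => a + c * z 0 i).
Proof.
apply: continuous_add; first exact: continuous_cst.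
by apply: continuous_mul; [exact: continuous_cst|exact: coord_continuous].
Qed.

Lemma is_derive_coord i (z v : 'rV[R]_m) : is_derive z v (fun z : 'rV[R]_m => z 0 i) (v 0 i).
Proof.
apply/is_derive_line.
have -> : (fun h : R => (h *: v + z) 0 i) = (fun h => z 0 i + v 0 i * h).
  by apply/funext => h; rewrite !mxE mulrC addrC.
apply: is_derive_eq (is_derive_affine _ _ (is_derive_id _ _)) _.
by rewrite mulr1.
Qed.

Lemma continuous_flatexp n : continuous (@flatexp R n).
Proof.
move=> t; apply/differentiable_continuous/derivable1_diffP.
by have [] := is_derive_flatexp n t.
Qed.

Lemma Ck_flatexp k n (a c : R) i : Ck k (fun z : 'rV[R]_m => flatexp n (a + c * z 0 i)).
Proof.
elim: k n => [|k IHk] n.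
  split => // z; apply: (@continuous_comp _ _ _ (fun z : 'rV[R]_m => a + c * z 0 i)).
    exact: continuous_affine_coord.
  exact: continuous_flatexp.
apply: (@Ck_derive _ _ (fun j z => (- n%:R * flatexp n.+1 (a + c * z 0 i) + flatexp n.+2 (a + c * z 0 i)) * (c * (j == i)%:R))).
- move=> z; apply: (@continuous_comp _ _ _ (fun z : 'rV[R]_m => a + c * z 0 i)).
    exact: continuous_affine_coord.
  exact: continuous_flatexp.
- move=> j z; apply: is_derive_comp1; first exact: is_derive_flatexp.
  apply: is_derive_eq (is_derive_affine _ _ (is_derive_coord _ _ _)) _.
  by rewrite mxE eqxx/= [i == j]eq_sym.
- move=> j; apply: Ck_mul; last exact: Ck_cst.
  by apply: Ck_add => //; apply: Ck_mul => //; exact: Ck_cst.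
Qed.

(** Smooth, between 0 and 1, and positive exactly on the open box. The coefficients [1] and [-1]
    match the affine argument in [Ck_flatexp]. *)
Definition box_bump (a b : 'rV[R]_m) z : R :=
  \prod_(i < m) (flatexp 0 (- a 0 i + 1 * z 0 i) * flatexp 0 (b 0 i + (-1) * z 0 i)).

Lemma Ck_box_bump k a b : Ck k (box_bump a b).
Proof. by apply: Ck_prod => i; apply: Ck_mul; exact: Ck_flatexp. Qed.

Lemma box_bump_ge0 a b z : 0 <= box_bump a b z.
Proof. by apply: prodr_ge0 => i _; rewrite mulr_ge0 ?flatexp_ge0. Qed.

Lemma box_bump_le1 a b z : box_bump a b z <= 1.
Proof.
have : \prod_(i < m) (flatexp 0 (- a 0 i + 1 * z 0 i) * flatexp 0 (b 0 i + (-1) * z 0 i)) <=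
       \prod_(i < m) (1 : R).
  apply: ler_prod => i _; rewrite mulr_ge0 ?flatexp_ge0//=.
  by rewrite mulr_ile1 ?flatexp_ge0 ?flatexp0_le1.
by rewrite big1_eq.
Qed.

Lemma box_bump_gt0 a b z : (0 < box_bump a b z) <-> obox a b z.
Proof.
split=> [h i|h]; last first.
  apply: prodr_gt0 => i _; have /andP[h1 h2] := h i.
  by rewrite mulr_gt0// flatexp_gt0 ?mul1r ?mulN1r ?subr_gt0// addrC subr_gt0.
have : box_bump a b z != 0 by rewrite gt_eqF.
move=> /prodf_neq0 => /(_ i isT).
rewrite mulf_eq0 negb_or => /andP[h1 h2].
have : 0 < flatexp 0 (- a 0 i + 1 * z 0 i) by rewrite lt_def h1 flatexp_ge0.
have : 0 < flatexp 0 (b 0 i + (-1) * z 0 i) by rewrite lt_def h2 flatexp_ge0.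
by rewrite !flatexp_gt0 mul1r mulN1r subr_gt0 addrC subr_gt0 => -> ->.
Qed.

Lemma box_bump_eq0 a b z : ~ obox a b z -> box_bump a b z = 0.
Proof.
move=> h; apply: contra_notP h => /eqP h; apply/box_bump_gt0.
by rewrite lt_def h box_bump_ge0.
Qed.

Lemma compact_support_sub (Omega K : set 'rV[R]_m) f : compact K -> K `<=` Omega ->
  (forall z, ~ K z -> f z = 0) -> compact_support_in Omega f.
Proof.
move=> cK KO fK.
have sK : closure [set z | f z != 0] `<=` K.
  rewrite [X in _ `<=` X](closure_id K).1; last by apply: compact_closed cK; exact: norm_hausdorff.
  by apply: closureS => z /= /eqP fz; apply: contrapT => /fK.
split; last exact: subset_trans KO.
by apply: subclosed_compact cK sK; exact: closed_closure.
Qed.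

Definition cbox (a b : 'rV[R]_m) : set 'rV[R]_m := [set z | forall i, a 0 i <= z 0 i <= b 0 i].

Lemma obox_cbox a b : obox a b `<=` cbox a b.
Proof. by move=> z h i; have /andP[/ltW -> /ltW ->] := h i. Qed.

Lemma compact_cbox a b : compact (cbox a b).
Proof.
rewrite (_ : cbox a b = [set z | forall i, `[a 0 i, b 0 i]%classic (z 0 i)]).
  by apply: (@rV_compact R^o _ (fun i => `[a 0 i, b 0 i]%classic)) => i; exact: segment_compact.
by apply/seteqP; split => z /= h i; have := h i; rewrite /= in_itv.
Qed.

End SmoothFunctions.

(** * Uniqueness of weak gradients *)

Section AlmostEverywhere.
Context {R : realType} {m : nat}.
Implicit Types (z : 'rV[R]_m) (U : set 'rV[R]_m).
Local Notation mu := (lebesgue_rV R m).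

Lemma rational_ball z (e : R) : 0 < e -> exists (q : 'rV[rat]_m) (n : nat),
  ball (map_mx ratr q : 'rV[R]_m) n.+1%:R^-1 z /\
  ball (map_mx ratr q : 'rV[R]_m) n.+1%:R^-1 `<=` ball z e.
Proof.
move=> e0.
have [n ne] : exists n : nat, n.+1%:R^-1 < e / 2.
  by have /ltr_add_invr[n] : 0 < e / 2 by [rewrite divr_gt0]; rewrite add0r; exists n.
have n0 : 0 < n.+1%:R^-1 :> R by rewrite invr_gt0.
have /choice[q hq] : forall i, exists q : rat, `|z 0 i - ratr q| < n.+1%:R^-1.
  move=> i; have : (z 0 i - n.+1%:R^-1 < z 0 i + n.+1%:R^-1) by rewrite ltrBlDr -addrA ltrDl addr_gt0.
  by move=> /rat_in_itvoo[q]; rewrite in_itv/= -ltr_distl distrC; exists q.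
have zq : `|z - map_mx ratr (\row_i q i)| < n.+1%:R^-1.
  by rewrite norm_rV_lt//; apply/forallP => i; rewrite !mxE.
exists (\row_i q i), n; rewrite -ball_normE /=; split => [|y /= qy]; first by rewrite distrC.
rewrite -[z - y](subrKA (map_mx ratr (\row_i q i))).
apply: le_lt_trans (ler_normD _ _) _; rewrite [ltRHS]splitr.
by apply: lt_trans (ltrD zq qy) _; rewrite ltrD.
Qed.

(** Countably many rational balls suffice to cover [U] by balls on which the exceptional set is
    negligible, and a countable union of negligible sets is negligible. *)
Lemma ae_local U (P : set 'rV[R]_m) :
  (forall z, U z -> exists2 e : R, 0 < e & {ae mu, forall s, ball z e s -> P s}) ->
  {ae mu, forall s, U s -> P s}.
Proof.
move=> h.
pose B (p : 'rV[rat]_m * nat) := ball (map_mx ratr p.1 : 'rV[R]_m) (p.2.+1%:R^-1 : R).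
(* An enumeration of the exceptional sets in rational balls, with default [set0] at codes that name
   no ball or a ball where the exceptional set is not negligible. *)
pose F k := if @unpickle ('rV[rat]_m * nat)%type k is Some p then
   if `[< mu.-negligible (B p `\` P) >] then B p `\` P else set0 else set0.
apply: (@negligibleS _ _ _ mu (\bigcup_k F k)); last first.
  apply: negligible_bigcup => k; rewrite /F; case: unpickle => [p|]; last exact: negligible_set0.
  by case: ifPn => [/asboolP|_]//; exact: negligible_set0.
move=> z /= /not_implyP[Uz nPz].
have [e e0 ae_e] := h z Uz.
have [q [n [qz qe]]] := rational_ball z e0.
exists (pickle (q, n)) => //; rewrite /F pickleK ifT; first by split.
apply/asboolP; apply: negligibleS ae_e => s [/qe zs nPs] /=.
by move=> /(_ zs).
Qed.

End AlmostEverywhere.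

Section Density.
Context {R : realType} {m : nat}.
Local Notation mu := (lebesgue_rV R m).
Variables (f : 'rV[R]_m -> \bar R) (mf : measurable_fun setT f) (f0 : forall z, (0 <= f z)%E).

(** Measurability and nonnegativity are arguments of the definition so that the measure structure
    can be attached to the term [density mf f0]. *)
Definition density of measurable_fun setT f & (forall z, (0 <= f z)%E) : set 'rV[R]_m -> \bar R :=
  fun A => (\int[mu]_(z in A) f z)%E.

Let density0 : density mf f0 set0 = 0%E. Proof. exact: integral_set0. Qed.

Let density_ge0 A : (0 <= density mf f0 A)%E. Proof. exact: integral_ge0. Qed.

Let density_sigma : semi_sigma_additive (density mf f0).
Proof. exact: semi_sigma_additive_nng_induced. Qed.

HB.instance Definition _ := isMeasure.Build _ _ _ (density mf f0) density0 density_ge0 density_sigma.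

End Density.

Section Supports.
Context {R : realType} {m : nat}.
Implicit Types (K D : set 'rV[R]_m) (f g : 'rV[R]_m -> R).
Local Notation mu := (lebesgue_rV R m).

Lemma restrict_support K D f : K `<=` D -> (forall z, ~ K z -> f z = 0) ->
  (EFin \o f) \_ D = (EFin \o f) \_ K.
Proof.
move=> KD fK; apply/funext => z; rewrite /patch.
have [zK|zK] := boolP (z \in K).
  by rewrite (mem_set (KD _ (set_mem zK))).
by case: ifP => //= _; rewrite fK// => /mem_set; exact/negP.
Qed.

Lemma integral_support K D f : K `<=` D -> (forall z, ~ K z -> f z = 0) ->
  (\int[mu]_(z in D) (f z)%:E = \int[mu]_(z in K) (f z)%:E)%E.
Proof.
by move=> KD fK; rewrite integral_mkcond [RHS]integral_mkcond (restrict_support KD fK).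
Qed.

Lemma Rintegral_support K D f : K `<=` D -> (forall z, ~ K z -> f z = 0) ->
  \int[mu]_(z in D) f z = \int[mu]_(z in K) f z.
Proof. by move=> KD fK; rewrite /Rintegral (integral_support KD fK). Qed.

Lemma integrable_support K D f : measurable K -> measurable D -> K `<=` D ->
  (forall z, ~ K z -> f z = 0) ->
  mu.-integrable D (EFin \o f) <-> mu.-integrable K (EFin \o f).
Proof.
move=> mK mD KD fK.
by rewrite (integrable_mkcond _ mD) (integrable_mkcond _ mK) (restrict_support KD fK).
Qed.

Lemma continuous_bounded_on K f : compact K -> {within K, continuous f} ->
  exists2 M : R, 0 <= M & forall z, K z -> `|f z| <= M.
Proof.
move=> cK cf; have [M [_ hM]] := compact_bounded (continuous_compact cf cK).
exists (`|M| + 1) => [|z Kz]; first by rewrite addr_ge0.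
by apply: (hM (`|M| + 1)); [rewrite ltr_pwDr// ler_norm|exists z].
Qed.

Lemma integrable_mul_bounded D f g : measurable D -> mu.-integrable D (EFin \o f) ->
  measurable_fun D g -> (exists M : R, forall z, D z -> `|g z| <= M) ->
  mu.-integrable D (EFin \o (fun z => f z * g z)).
Proof.
move=> mD fi mg [M gM].
have := @integrableMl _ _ _ mu D mD _ g fi mg.
apply; exists M; split; first exact: num_real.
by move=> x Mx z /gM /le_trans; apply; exact: ltW.
Qed.

Lemma compact_support_fun Omega (f : 'rV[R]_m -> R) : compact_support_in Omega f -> exists K,
  [/\ compact K, K `<=` Omega & forall z, ~ K z -> f z = 0].
Proof.
move=> [cK KO]; exists (closure [set z | f z != 0]); split => // z nz.
by apply: contra_notP nz => /eqP fz; exact: subset_closure.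
Qed.

Lemma integrable_test (Omega : set 'rV[R]_m) f g : measurable Omega ->
  locally_integrable_on Omega (EFin \o f) ->
  continuous g -> compact_support_in Omega g ->
  mu.-integrable Omega (EFin \o (fun z => f z * g z)).
Proof.
move=> mO lf cg /compact_support_fun[K [cK KO gK]].
have mK := compact_measurable_rV cK.
rewrite (integrable_support mK mO KO); last by move=> z /gK ->; rewrite mulr0.
apply: integrable_mul_bounded => //; first exact: lf.
  by apply: measurable_funTS; exact: continuous_measurable_rV.
have [M _ hM] := continuous_bounded_on cK (continuous_subspaceT cg).
by exists M.
Qed.

End Supports.

Lemma dominated_Rintegral d (T : measurableType d) (R : realType) (nu : {measure set T -> \bar R})
    (D : set T) (F : nat -> T -> R) (f g : T -> R) : measurable D ->
  (forall n, measurable_fun D (F n)) -> nu.-integrable D (EFin \o g) ->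
  (forall n z, D z -> `|F n z| <= g z) -> (forall z, D z -> F n z @[n --> \oo] --> f z) ->
  \int[nu]_(z in D) F n z @[n --> \oo] --> \int[nu]_(z in D) f z.
Proof.
move=> mD mF gi Fg Ff.
have mf : measurable_fun D f by apply: measurable_fun_cvg Ff.
have [] := @dominated_convergence _ _ _ nu D mD (fun n z => (F n z)%:E) (EFin \o f) (EFin \o g).
- by move=> n; apply/measurable_EFinP; exact: mF.
- exact/measurable_EFinP.
- by apply: aeW => z Dz; apply: cvg_EFin; [exact: nearW|exact: Ff].
- exact: gi.
- by apply: aeW => z n Dz; rewrite lee_fin; exact: Fg.
move=> fi _ h.
apply: fine_cvg; rewrite fineK//; exact: integrable_fin_num.
Qed.

Section FundamentalLemma.
Context {R : realType} {m : nat}.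
Implicit Types (z a b : 'rV[R]_m) (Omega : set 'rV[R]_m) (f : 'rV[R]_m -> R).
Local Notation mu := (lebesgue_rV R m).

Lemma obox_setI a b c d : obox a b `&` obox c d =
  obox (\row_i Num.max (a 0 i) (c 0 i)) (\row_i Num.min (b 0 i) (d 0 i)).
Proof.
apply/seteqP; split => z /=.
  by move=> [h1 h2] i; rewrite !mxE gt_max lt_min; have /andP[-> ->] := h1 i; have /andP[-> ->] := h2 i.
move=> h; split => i; have := h i; rewrite !mxE gt_max lt_min => /andP[/andP[? ?]] /andP[? ?]; exact/andP.
Qed.

(* The test functions [1 - (1 - B)^n], with [B] a bump positive exactly in the
   open box, increase to the indicator of that box. *)
Lemma integral_obox_eq0 Omega f a b : open Omega -> cbox a b `<=` Omega ->
  locally_integrable_on Omega (EFin \o f) ->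
  (forall eta, test_function Omega eta -> (\int[mu]_(z in Omega) (f z * eta z)%:E = 0)%E) ->
  (\int[mu]_(z in obox a b) (f z)%:E = 0)%E.
Proof.
move=> oO abO lf h.
have mC : measurable (cbox a b) := compact_measurable_rV (compact_cbox (a := a) (b := b)).
have mB := measurable_obox a b.
pose eta n z := 1 - (1 - box_bump a b z) ^+ n.
have eta0 n z : ~ cbox a b z -> eta n z = 0.
  move=> nz; rewrite /eta box_bump_eq0; first by rewrite subr0 expr1n subrr.
  by move=> /obox_cbox.
have test n : test_function Omega (eta n).
  split.
    apply: Ck_smooth => k; rewrite /eta.
    have -> : (fun z => 1 - (1 - box_bump a b z) ^+ n) =
       (fun z => 1 + (-1) * (1 + (-1) * box_bump a b z) ^+ n).
      by apply/funext => z; rewrite !mulN1r.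
    apply: Ck_add; first exact: Ck_cst.
    apply: Ck_mul; first exact: Ck_cst.
    apply: Ck_exp; apply: Ck_add; first exact: Ck_cst.
    by apply: Ck_mul; [exact: Ck_cst|exact: Ck_box_bump].
  exact: compact_support_sub (compact_cbox (a := a) (b := b)) abO (eta0 n).
have int0 n : (\int[mu]_(z in cbox a b) (f z * eta n z)%:E = 0)%E.
  rewrite -(integral_support abO); first exact: h.
  by move=> z /eta0 ->; rewrite mulr0.
have fC : mu.-integrable (cbox a b) (EFin \o f) by apply: lf => //; exact: compact_cbox.
have mfC : measurable_fun (cbox a b) f by apply/measurable_EFinP; exact: measurable_int fC.
have meta n : measurable_fun (cbox a b) (eta n).
  apply: measurable_funTS; apply: continuous_measurable_rV.
  by have [s _] := test n; have [] := s [::].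
have eta01 n z : 0 <= eta n z <= 1.
  have /andP[b0 b1] : 0 <= 1 - box_bump a b z <= 1.
    by rewrite subr_ge0 box_bump_le1/= lerBlDr lerDl box_bump_ge0.
  by rewrite subr_ge0 exprn_ile1//= lerBlDr lerDl exprn_ge0.
have lim1 : (\int[mu]_(z in cbox a b) (f z * eta n z)) @[n --> \oo] -->
    \int[mu]_(z in cbox a b) (f z * \1_(obox a b) z).
  apply: (dominated_Rintegral mC (g := fun z => `|f z|)) => [n||n z _|z Cz].
  - exact: measurable_funM.
  - exact: integrable_norm.
  - rewrite normrM ler_piMr ?normr_ge0//; have /andP[? ?] := eta01 n z.
    by rewrite ger0_norm.
  - apply: cvgM; [exact: cvg_cst|]; rewrite indicE; have [zB|zB] := boolP (z \in obox a b); last first.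
      rewrite (_ : eta^~ z = fun=> 0); first exact: cvg_cst.
      apply/funext => n; rewrite /eta box_bump_eq0; first by rewrite subr0 expr1n subrr.
      by move=> /mem_set; exact/negP.
    rewrite -[X in _ --> X]subr0; apply: cvgB; first exact: cvg_cst.
    apply: cvg_expr; rewrite ger0_norm ?subr_ge0 ?box_bump_le1//.
    by rewrite ltrBlDr ltrDl; apply/box_bump_gt0/set_mem.
have : \int[mu]_(z in cbox a b) (f z * \1_(obox a b) z) = 0.
  apply/esym/(cvg_unique _ _ lim1) => //.
  rewrite (_ : (fun n => _) = fun=> 0); first exact: cvg_cst.
  by apply/funext => n; rewrite /Rintegral int0.
have fB : mu.-integrable (obox a b) (EFin \o f) by apply: integrableS fC => //; exact: obox_cbox.
rewrite (_ : \int[mu]_(z in _) _ = \int[mu]_(z in obox a b) f z).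
  by rewrite /Rintegral => int; rewrite -[LHS]fineK ?int//; exact: integrable_fin_num.
rewrite (Rintegral_support (K := obox a b)); last 2 first.
- exact: obox_cbox.
- by move=> z nz; rewrite indicE memNset ?mulr0.
by apply: eq_Rintegral => z zB; rewrite indicE zB mulr1.
Qed.

(** The fundamental lemma of the calculus of variations. On a small box, the positive and negative
    parts of [f] are densities of two finite measures that agree on boxes by [integral_obox_eq0],
    hence on all measurable sets; so [f] has integral 0 over every measurable subset of the box. *)
Lemma ae_eq0_of_test Omega f : open Omega -> locally_integrable_on Omega (EFin \o f) ->
  (forall eta, test_function Omega eta -> (\int[mu]_(z in Omega) (f z * eta z)%:E = 0)%E) ->
  {ae mu, forall z, Omega z -> f z = 0}.
Proof.
move=> oO lf h; apply: ae_local => z0 Oz0.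
have /nbhs_ballP[e /= e0 eO] := open_nbhs_nbhs (conj oO Oz0).
pose d := e / 2; have d0 : 0 < d by rewrite divr_gt0.
exists d => //; rewrite ball_obox//.
set p := z0 - _; set q := z0 + _.
have pqO : cbox p q `<=` Omega.
  move=> z hz; apply: eO; rewrite -ball_normE/=.
  apply: (@le_lt_trans _ _ d); last by rewrite /d ltr_pdivrMr// ltr_pMr// ltr1n.
  rewrite norm_rV_le ?ltW//; apply/forallP => i; have := hz i; rewrite !mxE.
  by rewrite distrC ler_distl.
have mQ := measurable_obox p q.
have fQ : mu.-integrable (obox p q) (EFin \o f).
  apply: integrableS (lf _ (compact_cbox (a := p) (b := q)) pqO) => //.
  - by apply: compact_measurable_rV; exact: compact_cbox.
  - exact: obox_cbox.
pose F := (EFin \o f) \_ (obox p q).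
have FT : mu.-integrable setT F by apply/(integrable_mkcond _ mQ).
have mF := measurable_int _ FT.
pose m1 := density (measurable_funepos mF) (funepos_ge0 F).
pose m2 := density (measurable_funeneg mF) (funeneg_ge0 F).
have m1fin A : measurable A -> m1 A \is a fin_num.
  move=> mA; apply: integrable_fin_num => //; apply: integrable_funepos => //.
  exact: integrableS FT.
have m2fin A : measurable A -> m2 A \is a fin_num.
  move=> mA; apply: integrable_fin_num => //; apply: integrable_funeneg => //.
  exact: integrableS FT.
have m12 : forall A, measurable A -> m1 A = m2 A.
  apply: obox_measure_unique => a b; last by rewrite -ge0_fin_numE ?m1fin//; exact: measurable_obox.
  have mB := measurable_obox a b.
  have : (\int[mu]_(z in obox a b) F z = 0)%E.
    rewrite /F -integral_mkcondr obox_setI.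
    apply: (integral_obox_eq0 (Omega := Omega)) => //.
    apply: subset_trans pqO => z hz i; have := hz i; rewrite !mxE ge_max le_min.
    by move=> /andP[/andP[_ ->] /andP[_ ->]].
  rewrite integralE -/(m1 (obox a b)) -/(m2 (obox a b)) => /eqP.
  by rewrite sube_eq ?m1fin ?fin_num_adde_defr// add0e => /eqP.
have ae0 : ae_eq mu (obox p q) (EFin \o f) (cst 0%E).
  apply: integral_ae_eq => // E EQ mE; rewrite integral0.
  transitivity (\int[mu]_(z in E) F z)%E.
    by rewrite /F -integral_mkcondr setIidl.
  rewrite integralE.
  have -> : (\int[mu]_(z in E) F^\+ z = \int[mu]_(z in E) F^\- z)%E := m12 E mE.
  by rewrite subee//; exact: m2fin.
by apply: filterS ae0 => z /= h' /h' [].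
Qed.

(** The difference of the two integration by parts identities is orthogonal to all test functions.
    As [grad] is obtained by choice, this is what allows a computed weak gradient to replace it
    almost everywhere. *)
Lemma weak_gradient_unique Omega v (g g' : 'rV[R]_m -> 'rV[R]_m) : open Omega ->
  weak_gradient Omega v g -> weak_gradient Omega v g' ->
  {ae mu, forall z, Omega z -> g z = g' z}.
Proof.
move=> oO [_ lg hg] [_ lg' hg'].
have mO := open_measurable_rV oO.
have ae_i i : {ae mu, forall z, Omega z -> g z 0 i - g' z 0 i = 0}.
  apply: ae_eq0_of_test => // [K cK KO|eta teta].
    have -> : (EFin \o (fun z => g z 0 i - g' z 0 i)) = (fun z => (g z 0 i)%:E - (g' z 0 i)%:E)%E.
      by apply/funext => z /=; rewrite EFinB.
    apply: integrableB; [exact: compact_measurable_rV|exact: lg|exact: lg'].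
  have [[s _] ceta] := (teta.1 [::], teta.2).
  have h1 := integrable_test mO (lg i) s ceta.
  have h2 := integrable_test mO (lg' i) s ceta.
  rewrite (eq_integral (fun z => (g z 0 i * eta z)%:E - (g' z 0 i * eta z)%:E)%E); last first.
    by move=> z _; rewrite mulrBl EFinB.
  rewrite integralB// -[X in (X - _)%E]oppeK -hg// hg'// oppeK subee//.
  exact: integrable_fin_num.
have : {ae mu, forall z, forall i : 'I_m, Omega z -> g z 0 i - g' z 0 i = 0}.
  exact: filter_forall ae_i.
apply: filterS => z h Oz; apply/rowP => i; apply/eqP; rewrite -subr_eq0.
by rewrite h.
Qed.

End FundamentalLemma.

(** * Mean value theorem along lines and Lipschitz bounds *)

Section LineDerivatives.
Context {R : realType} {V : normedModType R}.
Implicit Types (f : V -> R) (x v : V).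

Lemma is_derive_along f x v (h : R) df :
  is_derive (h *: v + x) v f df -> is_derive h 1 (fun t : R => f (t *: v + x)) df.
Proof.
move=> /is_derive_line hf; apply/is_derive_line.
by apply: is_derive_ext hf => t; rewrite [_%:A]mulr1 scalerDl addrA.
Qed.

Lemma is_derive_along_opp f x v (h : R) df :
  is_derive (x - h *: v) v f df -> is_derive h 1 (fun t : R => f (x - t *: v)) (- df).
Proof.
move=> hf; apply: (is_derive_ext (f := fun t : R => f ((- t) *: v + x))).
  by move=> t; rewrite scaleNr addrC.
rewrite -mulrN1; apply: (is_derive_comp1 (g := fun t : R => f (t *: v + x)) (f := fun t : R => - t)).
by apply: is_derive_along; rewrite scaleNr addrC.
Qed.

Lemma line_mvt f x v (df : R -> R) :
  (forall t : R, 0 <= t <= 1 -> is_derive (t *: v + x) v f (df t)) ->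
  exists2 c : R, 0 <= c <= 1 & f (v + x) - f x = df c.
Proof.
move=> h.
have h' (t : R) : 0 <= t <= 1 -> is_derive t 1 (fun t : R => f (t *: v + x)) (df t).
  by move=> /h; exact: is_derive_along.
have [||c] := @MVT_segment R (fun t : R => f (t *: v + x)) df 0 1 ler01.
- by move=> t; rewrite in_itv/= => /andP[t0 t1]; apply: h'; rewrite !ltW.
- apply: derivable_within_continuous => t; rewrite in_itv/= => ht.
  by have [] := h' t ht.
by rewrite in_itv/= => hc; rewrite subr0 mulr1 scale0r add0r scale1r => e; exists c.
Qed.

End LineDerivatives.

Section BoundedPartials.
Context {R : realType} {m : nat}.
Implicit Types (f : 'rV[R]_m -> R) (z : 'rV[R]_m).

(** The staircase [p j], with the first [j] coordinates of [z'] and the others of [z], moves along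
    one axis at a time; each leg is controlled by the mean value theorem in that direction. *)
Lemma lipschitz_of_bounded_partials f (df : 'I_m -> 'rV[R]_m -> R) (M : R) :
  (forall i z, is_derive z (delta_mx 0 i) f (df i z)) ->
  (forall i z, `|df i z| <= M) ->
  forall z z', `|f z' - f z| <= m%:R * M * `|z' - z|.
Proof.
move=> hf hM z z'.
pose p (j : nat) : 'rV[R]_m := \row_i if (i < j)%N then z' 0 i else z 0 i.
have pm : p m = z' by apply/rowP => i; rewrite mxE ltn_ord.
have p0 : p 0%N = z by apply/rowP => i; rewrite mxE.
have -> : f z' - f z = \sum_(0 <= j < m) (f (p j.+1) - f (p j)).
  by rewrite telescope_sumr// pm p0.
rewrite big_mkord; apply: le_trans (ler_norm_sum _ _ _) _.
rewrite -mulrA -[leLHS]mul1r mul1r.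
apply: (@le_trans _ _ (\sum_(j < m) M * `|z' - z|)); last first.
  by rewrite sumr_const card_ord mulr_natl.
apply: ler_sum => j _.
have -> : p j.+1 = (z' 0 j - z 0 j) *: delta_mx 0 j + p j.
  apply/rowP => i; rewrite !mxE eqxx/= ltnS leq_eqVlt.
  have [->|ij] := eqVneq i j; first by rewrite eqxx ltnn mulr1 subrK.
  by rewrite -val_eqE in ij; rewrite (negbTE ij)/= mulr0 add0r.
set c := z' 0 j - z 0 j.
have [|t _ ->] := @line_mvt _ _ f (p j) (c *: delta_mx 0 j) (fun t => c * df j (t *: (c *: delta_mx 0 j) + p j)).
  move=> t _; apply/is_derive_line.
  set x := _ + p j.
  apply: (is_derive_ext (f := fun h : R => f ((c * h) *: delta_mx 0 j + x))).
    by move=> h; rewrite scalerA mulrC.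
  have hd : is_derive (c * 0) 1 (fun h : R => f (h *: delta_mx 0 j + x)) (df j x).
    by rewrite mulr0; apply/(is_derive_line f x).
  have hc : is_derive (0 : R) 1 (fun h : R => c * h) c.
    by apply: is_derive_eq (is_deriveZ c (is_derive_id _ _)) _; exact: mulr1.
  by rewrite mulrC; exact: (is_derive_comp1 hd hc).
rewrite normrM mulrC ler_pM ?normr_ge0//.
by rewrite /c; have := coord_le_norm (z' - z) j; rewrite !mxE.
Qed.

Lemma lipschitz_continuous_rV f (L : R) : (forall z z', `|f z' - f z| <= L * `|z' - z|) -> continuous f.
Proof.
move=> h z U /nbhs_ballP[e /= e0 eU].
have L0 : 0 < `|L| + 1 by rewrite ltr_wpDl.
apply/nbhs_ballP; exists (e / (`|L| + 1)); first exact: divr_gt0.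
move=> y; rewrite -ball_normE/= => zy; apply: eU; rewrite -ball_normE/= distrC.
apply: le_lt_trans (h z y) _; apply: (@le_lt_trans _ _ ((`|L| + 1) * `|y - z|)).
  by rewrite ler_wpM2r// ler_wpDr// ler_norm.
by rewrite mulrC -ltr_pdivlMr// distrC.
Qed.

Lemma test_function_bounded Omega f : test_function Omega f -> exists2 M : R, 0 <= M & forall z, `|f z| <= M.
Proof.
move=> [sf /compact_support_fun[K [cK _ fK]]].
have [M M0 hM] := continuous_bounded_on cK (continuous_subspaceT (sf [::]).1).
exists M => // z; have [/hM//|/fK ->] := pselect (K z); by rewrite normr0.
Qed.

Lemma test_function_derive Omega f i z : test_function Omega f ->
  is_derive z (delta_mx 0 i) f (partial i f z).
Proof. by move=> [sf _]; have [_ h] := sf [::]; apply: DeriveDef => //; exact: h. Qed.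

Lemma partial_support i f (K : set 'rV[R]_m) : compact K -> (forall z, ~ K z -> f z = 0) ->
  forall z, ~ K z -> partial i f z = 0.
Proof.
move=> cK fK z nKz; apply: partialE.
apply: (near_eq_is_derive (f := cst 0)).
have : nbhs z (~` K).
  apply: open_nbhs_nbhs; split => //; apply: closed_openC.
  by apply: compact_closed cK; exact: norm_hausdorff.
by apply: filterS => y nKy; rewrite fK.
Qed.

Lemma test_function_partial Omega f i : test_function Omega f -> test_function Omega (partial i f).
Proof.
move=> [sf /compact_support_fun[K [cK KO fK]]]; split.
  by move=> s; have := sf (rcons s i); rewrite foldr_rcons.
exact: compact_support_sub cK KO (partial_support i cK fK).
Qed.

Lemma test_function_translate (Omega : set 'rV[R]_m) f a : test_function Omega f ->
  test_function [set z | Omega (z - a)] (fun s => f (s - a)).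
Proof.
move=> [sf /compact_support_fun[K [cK KO fK]]]; split.
  by apply: Ck_smooth => k; apply: Ck_translate; exact: smooth_Ck.
apply: (@compact_support_sub _ _ _ [set z | K (z - a)]).
- rewrite (_ : [set z | K (z - a)] = (fun z => z + a) @` K).
    apply: continuous_compact => //; apply: continuous_subspaceT => z.
    by apply: continuousD; [exact: cvg_id|exact: cst_continuous].
  apply/seteqP; split => [z Kz|_ [z Kz <-]] /=; last by rewrite addrK.
  by exists (z - a) => //; rewrite subrK.
- by move=> z /KO.
- by move=> z /= /fK.
Qed.

Lemma partial_translate Omega f i (a z : 'rV[R]_m) : test_function Omega f ->
  partial i (fun s => f (s - a)) z = partial i f (z - a).
Proof. by move=> tf; apply/partialE/derive_translate/test_function_derive/tf. Qed.

End BoundedPartials.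

(** * Convolution and mollification *)

Section Convolution.
Context {R : realType} {m : nat}.
Implicit Types (f k : 'rV[R]_m -> R) (z v : 'rV[R]_m).
Local Notation mu := (lebesgue_rV R m).

(** The kernel is taken at [s - z], so that it is a translated test function of the integration
    variable, ready for the definition of weak gradients. This is the reason for the minus sign in
    [is_derive_conv]; for the even kernel [moll] it is the usual convolution. *)
Definition convol f k z : R := \int[mu]_s (f s * k (s - z)).

Lemma conv_integrable f k z : mu.-integrable setT (EFin \o f) -> continuous k ->
  (exists M : R, forall z, `|k z| <= M) -> mu.-integrable setT (EFin \o (fun s => f s * k (s - z))).
Proof.
move=> fi ck [M kM]; apply: integrable_mul_bounded => //; last by exists M => s _; exact: kM.
by apply: continuous_measurable_rV; exact: continuous_translate.
Qed.

(** Differentiation under the integral sign in the parameter [h] of the line through [z], dominated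
    by [M * |f|]. *)
Lemma is_derive_conv f k (kv : 'rV[R]_m -> R) v z :
  mu.-integrable setT (EFin \o f) ->
  (forall s, is_derive s v k (kv s)) -> continuous k -> continuous kv ->
  (exists M : R, forall z, `|k z| <= M) -> (exists M : R, forall z, `|kv z| <= M) ->
  is_derive z v (convol f k) (- convol f kv z).
Proof.
move=> fi hk ck ckv bk [M hM].
apply/is_derive_line.
pose G (h : R) s : R := f s * k (s - (h *: v + z)).
have dG (h : R) (s : 'rV[R]_m) : is_derive h 1 (G^~ s) (f s * - kv (s - (h *: v + z))).
  apply: (is_derive_ext (f := fun h : R => f s * k ((s - z) - h *: v))).
    by move=> t; rewrite /G opprD addrA addrAC.
  apply: is_deriveZ; apply: is_derive_along_opp.
  by rewrite -addrA -opprD [z + _]addrC.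
have M0 : 0 <= M by apply: le_trans (hM 0).
have i01 : `](-1 : R), 1[%classic 0 by rewrite /= in_itv/= ltr01 oppr_lt0 ltr01.
have Gi (x : R) : `](-1 : R), 1[%classic x -> mu.-integrable setT (EFin \o G x).
  by move=> _; exact: conv_integrable.
have Gd (x : R) y : `](-1 : R), 1[%classic x -> setT y -> derivable (G^~ y) x 1.
  by move=> _ _; have [] := dG x y.
have M0f y : 0 <= M * `|f y| by rewrite mulr_ge0.
have iMf : mu.-integrable setT (EFin \o (fun y => M * `|f y|)).
  rewrite (_ : EFin \o _ = (fun y => M%:E * `|f y|%:E)%E); last by apply/funext.
  by apply: integrableZl => //; exact: integrable_norm.
have Gb (x : R) y : `](-1 : R), 1[%classic x -> setT y -> `|partial1of2 G x y| <= M * `|f y|.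
  move=> _ _; rewrite partial1of2E derive_val normrM mulrC normrN ler_wpM2r//.
have := @cvg_differentiation_under_integral R _ _ mu G setT measurableT 0 (-1) 1 i01 Gi Gd _ M0f iMf Gb.
pose l := \int[mu]_y partial1of2 G 0 y; rewrite -/l => hl.
have -> : - convol f kv z = l.
  rewrite /l /convol -[LHS]mulN1r -RintegralZl//; last exact: conv_integrable (ex_intro _ M hM).
  apply: eq_Rintegral => s _; rewrite partial1of2E derive_val scale0r add0r.
  by rewrite mulN1r mulrN.
pose F (h : R) := convol f k (h *: v + z).
have {}hl : h^-1 *: ((F \o shift 0) (h *: (1 : R)) - F 0) @[h --> 0^'] --> l.
  by apply: cvg_trans hl; apply: near_eq_cvg; apply: nearW => h /=; rewrite [h *: 1]mulr1.
by apply: DeriveDef; [apply/cvg_ex; exists l|exact: (cvg_lim (@norm_hausdorff _ _) hl)].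
Qed.

Lemma conv_support f k (M r : R) : (forall s, M < `|s| -> f s = 0) ->
  (forall s, r < `|s| -> k s = 0) -> forall z, M + r < `|z| -> convol f k z = 0.
Proof.
move=> fM kr z Mz; rewrite /convol (_ : (fun _ => _) = cst 0).
  by rewrite Rintegral_cst// mul0r.
apply/funext => s /=; have [sM|/fM ->] := leP `|s| M; last by rewrite mul0r.
rewrite kr ?mulr0//.
have := ler_normB s (s - z); rewrite subKr; lra.
Qed.

(** Each partial derivative is at most a supremum of [partial i k] times the L^1 norm of [f], which
    makes the convolution Lipschitz. The sum of the suprema [Md i] is a bound common to all
    directions. *)
Lemma continuous_conv f k : mu.-integrable setT (EFin \o f) -> test_function setT k ->
  continuous (convol f k).
Proof.
move=> fi tk.
have [Mk _ hMk] := test_function_bounded tk.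
have /choice[Md hMd] : forall i : 'I_m, exists M : R, forall z, `|partial i k z| <= M.
  by move=> i; have [M _ hM] := test_function_bounded (test_function_partial i tk); exists M.
pose I := \int[mu]_s `|f s|.
apply: (@lipschitz_continuous_rV _ _ _ (m%:R * (\sum_i `|Md i| * I))).
apply: (@lipschitz_of_bounded_partials _ _ _ (fun i z => - convol f (partial i k) z)).
  move=> i z; apply: is_derive_conv => //.
  - by move=> s; apply: test_function_derive tk.
  - exact: (tk.1 [::]).1.
  - exact: (tk.1 [:: i]).1.
  - by exists Mk.
  - by exists (Md i).
move=> i z; rewrite normrN.
have hi : mu.-integrable setT (EFin \o (fun s => f s * partial i k (s - z))).
  by apply: conv_integrable => //; [exact: (tk.1 [:: i]).1|exists (Md i)].
have fn : mu.-integrable setT (EFin \o (fun s => `|f s|)) by exact: integrable_norm.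
apply: le_trans (le_normr_Rintegral measurableT hi) _.
apply: (@le_trans _ _ (\int[mu]_s (`|Md i| * `|f s|))).
  apply: le_Rintegral => //.
  - exact: integrable_norm.
  - by rewrite (_ : EFin \o _ = (fun y => `|Md i|%:E * `|f y|%:E)%E)//; apply: integrableZl.
  - move=> s _; rewrite normrM mulrC ler_wpM2r//; apply: le_trans (hMd i _) _; exact: ler_norm.
rewrite RintegralZl// (bigD1 i)//= lerDl sumr_ge0// => j _.
by rewrite mulr_ge0// Rintegral_ge0.
Qed.

Lemma Ck_conv n f k : mu.-integrable setT (EFin \o f) -> test_function setT k -> Ck n (convol f k).
Proof.
move=> fi; elim: n k => [|n IHn] k tk; first by split => //; exact: continuous_conv.
have [Mk _ hMk] := test_function_bounded tk.
apply: (@Ck_derive _ _ _ _ (fun i z => - convol f (partial i k) z)).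
- exact: continuous_conv.
- move=> i z; apply: is_derive_conv => //.
  + by move=> s; apply: test_function_derive tk.
  + exact: (tk.1 [::]).1.
  + exact: (tk.1 [:: i]).1.
  + by exists Mk.
  + by have [M _ hM] := test_function_bounded (test_function_partial i tk); exists M.
- move=> i; rewrite (_ : (fun z => _) = fun z => (-1) * convol f (partial i k) z); last first.
    by apply/funext => z; rewrite mulN1r.
  by apply: Ck_mul; [exact: Ck_cst|apply/IHn/test_function_partial].
Qed.

Lemma closed_norm_ball_compact (M : R) : compact [set z : 'rV[R]_m | `|z| <= M].
Proof.
apply: bounded_closed_compact.
  by exists M; split; [exact: num_real|move=> x Mx z /= /le_trans; apply; exact: ltW].
exact: (closed_comp (fun z _ => @norm_continuous _ _ z) (@closed_le _ M)).
Qed.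

Lemma test_function_conv f k (M r : R) : mu.-integrable setT (EFin \o f) -> test_function setT k ->
  (forall s, M < `|s| -> f s = 0) -> (forall s, r < `|s| -> k s = 0) ->
  test_function setT (convol f k).
Proof.
move=> fi tk fM kr; split; first by apply: Ck_smooth => n; exact: Ck_conv.
apply: (@compact_support_sub _ _ _ [set z | `|z| <= M + r]) => //.
  exact: closed_norm_ball_compact.
by move=> z /= /negP; rewrite -ltNge; exact: conv_support.
Qed.

End Convolution.

Section AeIntegral.
Context d (T : measurableType d) {R : realType} (nu : {measure set T -> \bar R}).
Implicit Types (D : set T) (f g : T -> R).

Lemma ae_Rintegral_ge0 D f : measurable D -> nu.-integrable D (EFin \o f) ->
  {ae nu, forall z, D z -> 0 <= f z} -> 0 <= \int[nu]_(z in D) f z.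
Proof.
move=> mD fi [N [mN N0 hN]].
rewrite /Rintegral (negligible_integral mN mD fi N0); apply: fine_ge0; apply: integral_ge0 => z [Dz Nz].
rewrite lee_fin leNgt; apply/negP => fz; apply: Nz; apply: hN => /= /(_ Dz).
by rewrite leNgt fz.
Qed.

Lemma ae_le_Rintegral D f g : measurable D -> nu.-integrable D (EFin \o f) ->
  nu.-integrable D (EFin \o g) ->
  {ae nu, forall z, D z -> f z <= g z} -> \int[nu]_(z in D) f z <= \int[nu]_(z in D) g z.
Proof.
move=> mD fi gi h; rewrite -subr_ge0 -RintegralB//; apply: ae_Rintegral_ge0 => //.
  rewrite (_ : EFin \o _ = (fun z => (g z)%:E - (f z)%:E)%E); last by apply/funext.
  exact: integrableB.
by apply: filterS h => z h Dz; rewrite subr_ge0 h.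
Qed.

End AeIntegral.

(** * Mollifiers *)

Section Mollifier.
Context {R : realType} {m : nat}.
Implicit Types (f k a b : 'rV[R]_m -> R) (z v : 'rV[R]_m) (r : R).
Local Notation mu := (lebesgue_rV R m).

Let bump r : 'rV[R]_m -> R := box_bump (const_mx (- r)) (const_mx r).

Lemma obox_norm r z : 0 < r -> obox (const_mx (- r)) (const_mx r) z <-> `|z| < r.
Proof.
move=> r0; rewrite norm_rV_lt//; split => [h|/forallP h i].
  by apply/forallP => i; have := h i; rewrite !mxE ltr_norml.
by have := h i; rewrite !mxE ltr_norml.
Qed.

Let bump0 r z : 0 < r -> r <= `|z| -> bump r z = 0.
Proof. by move=> r0 rz; apply: box_bump_eq0; rewrite obox_norm// ltNge rz. Qed.

Let test_bump r : 0 < r -> test_function setT (bump r).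
Proof.
move=> r0; split; first by apply: Ck_smooth => k; exact: Ck_box_bump.
apply: (@compact_support_sub _ _ _ [set z | `|z| <= r]) => //; first exact: closed_norm_ball_compact.
by move=> z /= /negP; rewrite -ltNge => /ltW; exact: bump0.
Qed.

Definition bump_mass r : R := \int[mu]_z bump r z.

Let bump_integrable r : 0 < r -> mu.-integrable setT (EFin \o bump r).
Proof.
move=> r0; have cK := @closed_norm_ball_compact R m r.
apply/(integrable_support (K := [set z | `|z| <= r])) => //.
- exact: compact_measurable_rV.
- by move=> z /= /negP; rewrite -ltNge => /ltW; exact: bump0.
have [M M0 hM] := test_function_bounded (test_bump r0).
apply: (@compact_integrable _ _ _ _ M) => //.
apply: measurable_funTS; apply: continuous_measurable_rV; exact: (Ck_continuous (Ck_box_bump 0 _ _)).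
Qed.

(** A nonnegative bump of integral 0 would vanish almost everywhere, but it is positive on a box of
    positive volume. *)
Lemma bump_mass_gt0 r : 0 < r -> 0 < bump_mass r.
Proof.
move=> r0; rewrite lt_def; apply/andP; split; last first.
  by apply: Rintegral_ge0 => z _; exact: box_bump_ge0.
apply/negP => /eqP h.
have : (\int[mu]_z `|(bump r z)%:E| = 0)%E.
  rewrite (eq_integral (EFin \o bump r)); last first.
    by move=> z _ /=; rewrite ger0_norm ?box_bump_ge0.
  by rewrite -[LHS]fineK ?[X in X%:E]h//; exact: integrable_fin_num (bump_integrable r0).
have mb : measurable_fun setT (EFin \o bump r) by exact: measurable_int (bump_integrable r0).
move/(ae_eq_integral_abs mu measurableT mb) => [N [mN N0 hN]].
have BN : obox (const_mx (- r)) (const_mx r) `<=` N.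
  move=> z Bz; apply: hN => /= /(_ Logic.I) [].
  by apply/eqP; rewrite gt_eqF//; apply/box_bump_gt0.
have mB := measurable_obox (const_mx (- r) : 'rV[R]_m) (const_mx r).
have : (mu (obox (const_mx (- r)%R : 'rV[R]_m) (const_mx r)) <= 0)%E.
  by rewrite -N0; apply: le_measure; rewrite ?inE.
rewrite leNgt => /negP; apply.
rewrite lebesgue_rV_obox; last by move=> i; rewrite !mxE ge0_cp// ltW.
by rewrite lte_fin; apply: prodr_gt0 => i _; rewrite !mxE opprK addr_gt0.
Qed.

Definition moll r z : R := (bump_mass r)^-1 * bump r z.

Lemma moll_ge0 r z : 0 < r -> 0 <= moll r z.
Proof. by move=> r0; rewrite mulr_ge0 ?invr_ge0 ?box_bump_ge0// ltW// bump_mass_gt0. Qed.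

Lemma moll_eq0 r z : 0 < r -> r <= `|z| -> moll r z = 0.
Proof. by move=> r0 rz; rewrite /moll bump0// mulr0. Qed.

Lemma Ck_moll (n : nat) r : Ck n (moll r).
Proof. by apply: Ck_mul; [exact: Ck_cst|exact: Ck_box_bump]. Qed.

Lemma continuous_moll r : continuous (moll r).
Proof. exact: Ck_continuous (Ck_moll 0 r). Qed.

Lemma test_moll r : 0 < r -> test_function setT (moll r).
Proof.
move=> r0; split; first by apply: Ck_smooth => k; exact: Ck_moll.
apply: (@compact_support_sub _ _ _ [set z | `|z| <= r]) => //; first exact: closed_norm_ball_compact.
by move=> z /= /negP; rewrite -ltNge => /ltW; exact: moll_eq0.
Qed.

Lemma moll_bounded r : 0 < r -> exists M : R, forall z, `|moll r z| <= M.
Proof. by move=> /test_moll/test_function_bounded[M _]; exists M. Qed.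

Lemma moll_even r z : moll r (- z) = moll r z.
Proof.
rewrite /moll /bump /box_bump; congr (_ * _); apply: eq_bigr => i _.
by rewrite !mxE !mulN1r !mul1r !opprK mulrC.
Qed.

Lemma moll_integrable r z : 0 < r -> mu.-integrable setT (EFin \o (fun s => moll r (s - z))).
Proof.
move=> r0; apply: (@integrable_shift _ _ (- z) (EFin \o moll r)).
rewrite (_ : EFin \o _ = (fun s => (bump_mass r)^-1%:E * (bump r s)%:E)%E); last by apply/funext.
by apply: integrableZl => //; exact: bump_integrable.
Qed.

Lemma integral_moll r z : 0 < r -> \int[mu]_s moll r (s - z) = 1.
Proof.
move=> r0; have h := moll_integrable 0 r0.
have h' : mu.-integrable setT (EFin \o moll r).
  by apply: eq_integrable h => // s _ /=; rewrite subr0.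
rewrite /Rintegral (@integral_shift _ _ (- z) (EFin \o moll r))// -/(Rintegral mu setT (moll r)).
rewrite RintegralZl//; last exact: bump_integrable.
by rewrite mulVf// gt_eqF// bump_mass_gt0.
Qed.

Lemma differentiable_flatexp_coord (c d : R) n i z :
  differentiable (fun z : 'rV[R]_m => flatexp n (c + d * z 0 i)) z.
Proof.
apply: (@differentiable_comp _ _ _ _ (fun z : 'rV[R]_m => c + d * z 0 i) (flatexp n)); last first.
  by apply/derivable1_diffP; have [] := is_derive_flatexp n (c + d * z 0 i).
apply: differentiableD; first exact: differentiable_cst.
by apply: differentiableM; [exact: differentiable_cst|exact: differentiable_coord].
Qed.

Lemma differentiable_moll r z : differentiable (moll r) z.
Proof.
apply: differentiableM; first exact: differentiable_cst.
rewrite /bump /box_bump; elim: (index_enum _) => [|i s IH].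
  rewrite (_ : (fun _ => _) = cst 1); first exact: differentiable_cst.
  by apply/funext => y; rewrite big_nil.
rewrite (_ : (fun _ => _) = (fun z : 'rV[R]_m => flatexp 0 (- (const_mx (- r) : 'rV[R]_m) 0 i + 1 * z 0 i)) *
    (fun z : 'rV[R]_m => flatexp 0 ((const_mx r : 'rV[R]_m) 0 i + (-1) * z 0 i)) *
    (fun z : 'rV[R]_m => \prod_(j <- s) (flatexp 0 (- (const_mx (- r) : 'rV[R]_m) 0 j + 1 * z 0 j) *
      flatexp 0 ((const_mx r : 'rV[R]_m) 0 j + (-1) * z 0 j)))); last first.
  by apply/funext => y; rewrite big_cons.
apply: differentiableM => //; apply: differentiableM; exact: differentiable_flatexp_coord.
Qed.

(** Segments run in arbitrary directions, so derivatives off the axes are wanted; they come from the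
    total differential, which the product form of the bump provides. *)
Lemma is_derive_moll r v z : is_derive z v (moll r) (\sum_i v 0 i * partial i (moll r) z).
Proof.
have dz := differentiable_moll r z.
apply: DeriveDef; first exact: diff_derivable.
rewrite deriveE// [in LHS](row_sum_delta v) linear_sum; apply: eq_bigr => i _.
by rewrite linearZ/= /partial deriveE.
Qed.

(** Convolution with [moll r] averages with a probability weight vanishing off the open [r]-ball
    around [z], so that a bound valid almost everywhere in that ball becomes a bound at the point
    [z]. *)
Lemma conv_moll_le f r z (c : R) : 0 < r -> mu.-integrable setT (EFin \o f) ->
  {ae mu, forall s, `|s - z| < r -> f s <= c} -> convol f (moll r) z <= c.
Proof.
move=> r0 fi h; rewrite -[leRHS]mulr1 -(integral_moll z r0) -RintegralZl//; last exact: moll_integrable.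
apply: ae_le_Rintegral => //.
- by apply: conv_integrable => //; [exact: continuous_moll|exact: moll_bounded].
- rewrite (_ : EFin \o _ = (fun s => c%:E * (moll r (s - z))%:E)%E); last by apply/funext.
  by apply: integrableZl => //; exact: moll_integrable.
- apply: filterS h => s h _; have [/h sz|rs] := ltP `|s - z| r; last by rewrite moll_eq0// !mulr0.
  by rewrite ler_wpM2r// moll_ge0.
Qed.

Lemma conv_moll_ge f r z (c : R) : 0 < r -> mu.-integrable setT (EFin \o f) ->
  {ae mu, forall s, `|s - z| < r -> c <= f s} -> c <= convol f (moll r) z.
Proof.
move=> r0 fi h; rewrite -[leLHS]mulr1 -(integral_moll z r0) -RintegralZl//; last exact: moll_integrable.
apply: ae_le_Rintegral => //.
- rewrite (_ : EFin \o _ = (fun s => c%:E * (moll r (s - z))%:E)%E); last by apply/funext.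
  by apply: integrableZl => //; exact: moll_integrable.
- by apply: conv_integrable => //; [exact: continuous_moll|exact: moll_bounded].
- apply: filterS h => s h _; have [/h sz|rs] := ltP `|s - z| r; last by rewrite moll_eq0// !mulr0.
  by rewrite ler_wpM2r// moll_ge0.
Qed.

Lemma conv_moll_near f r z (c e : R) : 0 < r -> mu.-integrable setT (EFin \o f) ->
  {ae mu, forall s, `|s - z| < r -> `|f s - c| <= e} -> `|convol f (moll r) z - c| <= e.
Proof.
move=> r0 fi h; rewrite ler_distl; apply/andP; split.
  apply: conv_moll_ge => //; apply: filterS h => s h /h; rewrite ler_distl => /andP[]; by [].
by apply: conv_moll_le => //; apply: filterS h => s h /h; rewrite ler_distl => /andP[].
Qed.

Lemma measurable_subr_pair : measurable_fun setT (fun p : 'rV[R]_m * 'rV[R]_m => p.2 - p.1).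
Proof.
apply: measurable_fun_rV => i.
rewrite (_ : _ \o _ = (fun p : 'rV[R]_m * 'rV[R]_m => (p.2 0 i - p.1 0 i : measurableTypeR R))); last first.
  by apply/funext => p; rewrite /= /rV_coord !mxE.
apply: measurable_funB.
  by apply: (measurableT_comp (measurable_coord i)); exact: measurable_snd.
by apply: (measurableT_comp (measurable_coord i)); exact: measurable_fst.
Qed.

(** Mollification is self-adjoint: Fubini, the kernel being even. A bound [M] of the kernel
    dominates the double integrand by M |a(x)| |b(y)|, whence its integrability. *)
Lemma conv_swap a b r : 0 < r ->
  mu.-integrable setT (EFin \o a) -> mu.-integrable setT (EFin \o b) ->
  \int[mu]_z (a z * convol b (moll r) z) = \int[mu]_s (convol a (moll r) s * b s).
Proof.
move=> r0 ai bi.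
have [M hM] := moll_bounded r0.
pose H (p : 'rV[R]_m * 'rV[R]_m) : \bar R := (a p.1 * (b p.2 * moll r (p.2 - p.1)))%:E.
have ma : measurable_fun setT a by apply/measurable_EFinP; exact: measurable_int ai.
have mb : measurable_fun setT b by apply/measurable_EFinP; exact: measurable_int bi.
have mH : measurable_fun setT H.
  apply/measurable_EFinP; apply: measurable_funM; first by apply: measurableT_comp => //; exact: measurable_fst.
  apply: measurable_funM; first by apply: measurableT_comp => //; exact: measurable_snd.
  by apply: measurableT_comp; [apply: continuous_measurable_rV; exact: continuous_moll|exact: measurable_subr_pair].
have iH : (mu \x mu)%E.-integrable setT H.
  apply/integrable12ltyP => //.
  have /integrableP[_ afin] := ai; have /integrableP[_ bfin] := bi.
  apply: (@le_lt_trans _ _ (\int[mu]_x (`|(a x)%:E| * (M%:E * \int[mu]_y `|(b y)%:E|)))%E).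
    apply: ge0_le_integral => //.
    - by move=> x _; apply: integral_ge0.
    - apply: (measurable_fun_fubini_tonelli_F (fun p => `|H p|%E)) => //.
      exact: measurableT_comp.
    - apply: emeasurable_funM; last exact: measurable_cst.
      by do 2 apply: measurableT_comp => //.
    move=> x _.
    rewrite -ge0_integralZl//; [|by do 2 apply: measurableT_comp => //|]; last first.
      by rewrite lee_fin; apply: le_trans (hM 0).
    rewrite -ge0_integralZl//; [|by apply: measurable_funeM; do 2 apply: measurableT_comp => //|]; last first.
      by move=> y _; rewrite mule_ge0// lee_fin; apply: le_trans (hM 0).
    apply: ge0_le_integral => //.
    - by do 2 apply: measurableT_comp => //; exact: (measurableT_comp mH (pair1_measurable x)).
    - by apply: measurable_funeM; apply: measurable_funeM; do 2 apply: measurableT_comp => //.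
    move=> y _; rewrite /H /= lee_fin normrM ler_wpM2l// normrM mulrC ler_wpM2r//; exact: hM.
  rewrite ge0_integralZr//.
  - apply: lte_mul_pinfty; [exact: integral_ge0|by rewrite ge0_fin_numE ?integral_ge0|].
    apply: lte_mul_pinfty => //; rewrite lee_fin; exact: le_trans (hM 0).
  - by do 2 apply: measurableT_comp => //.
  - by rewrite mule_ge0 ?integral_ge0// lee_fin; apply: le_trans (hM 0).
have hF := Fubini iH.
rewrite /Rintegral; congr fine.
transitivity (\int[mu]_x \int[mu]_y H (x, y))%E.
  apply: eq_integral => x _; rewrite /H/=.
  have hi := @conv_integrable R m b (moll r) x bi (@continuous_moll r) (moll_bounded r0).
  have -> : (a x * convol b (moll r) x)%:E = ((a x)%:E * \int[mu]_s (b s * moll r (s - x))%:E)%E.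
    by rewrite EFinM; congr (_ * _)%E; exact: (fineK (integrable_fin_num measurableT hi)).
  exact/esym/(integralZl measurableT hi (a x)).
rewrite hF; apply: eq_integral => y _; rewrite /H/=.
have hi := @conv_integrable R m a (moll r) y ai (@continuous_moll r) (moll_bounded r0).
rewrite (eq_integral (fun x => ((b y)%:E * (a x * moll r (x - y))%:E)%E)); last first.
  by move=> x _; rewrite -EFinM; congr EFin; rewrite -moll_even opprB mulrCA.
have -> : (convol a (moll r) y * b y)%:E = ((b y)%:E * \int[mu]_s (a s * moll r (s - y))%:E)%E.
  by rewrite mulrC EFinM; congr (_ * _)%E; exact: (fineK (integrable_fin_num measurableT hi)).
exact: (integralZl measurableT hi (b y)).
Qed.

(** Mollifying |f| dominates the modulus of the mollified [f], and self-adjointness moves the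
    mollifier to the constant 1, where it gives at most 1. The indicator of a ball containing the
    support of the convolution stands for this constant, [conv_swap] asking for integrable
    factors. *)
Lemma conv_contraction f r (M : R) : 0 < r -> mu.-integrable setT (EFin \o f) ->
  (forall s, M < `|s| -> f s = 0) ->
  \int[mu]_z `|convol f (moll r) z| <= \int[mu]_z `|f z|.
Proof.
move=> r0 fi fM.
pose K := [set z : 'rV[R]_m | `|z| <= M + r].
have cK : compact K := @closed_norm_ball_compact R m (M + r).
have mK := compact_measurable_rV cK.
have nfi : mu.-integrable setT (EFin \o (fun z => `|f z|)) by exact: integrable_norm.
have iK : mu.-integrable setT (EFin \o \1_K) .
  apply/(integrable_support (K := K)) => //.
    by move=> z nz; rewrite indicE memNset.
  apply: (@compact_integrable _ _ _ _ 1) => // z _.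
  by rewrite indicE; case: (_ \in _); rewrite ?normr1 ?normr0.
have ci (g : 'rV[R]_m -> R) : mu.-integrable setT (EFin \o g) -> (forall s, M < `|s| -> g s = 0) ->
    mu.-integrable setT (EFin \o convol g (moll r)).
  move=> gi gM; have tc := @test_function_conv _ _ g (moll r) M r gi (test_moll r0) gM
    (fun s rs => moll_eq0 r0 (ltW rs)).
  have [B _ hB] := test_function_bounded tc.
  apply/(integrable_support (K := K)) => //.
    move=> z /= /negP; rewrite -ltNge; apply: conv_support => // s rs; exact: (moll_eq0 r0 (ltW rs)).
  apply: (@compact_integrable _ _ _ _ B) => //.
  apply: measurable_funTS; apply: continuous_measurable_rV; exact: (tc.1 [::]).1.
have nM s : M < `|s| -> `|f s| = 0 by move=> /fM ->; rewrite normr0.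
have hci z := @conv_integrable R m f (moll r) z fi (@continuous_moll r) (moll_bounded r0).
apply: (@le_trans _ _ (\int[mu]_z (\1_K z * convol (fun z => `|f z|) (moll r) z))).
  apply: le_Rintegral => //.
  - by apply: integrable_norm => //; exact: ci.
  - rewrite (_ : EFin \o _ = EFin \o convol (fun z => `|f z|) (moll r)); first exact: ci.
    apply/funext => z /=; rewrite indicE; have [zK|zK] := boolP (z \in K); first by rewrite mul1r.
    rewrite mul0r; congr EFin; apply/esym.
    apply: (@conv_support _ _ _ _ M r) => // [s rs|]; first exact: (moll_eq0 r0 (ltW rs)).
    by rewrite ltNge; apply/negP => /mem_set; exact/negP.
  - move=> z _; rewrite indicE; have [zK|zK] := boolP (z \in K).
      rewrite mul1r; apply: le_trans (le_normr_Rintegral measurableT (hci z)) _.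
      rewrite le_eqVlt; apply/orP; left; apply/eqP; apply: eq_Rintegral => s _.
      by rewrite normrM [`|moll _ _|]ger0_norm ?moll_ge0.
    rewrite mul0r; rewrite (@conv_support _ _ f (moll r) M r) ?normr0// => [s rs|]; first exact: (moll_eq0 r0 (ltW rs)).
    by rewrite ltNge; apply/negP => /mem_set; exact/negP.
rewrite conv_swap//; apply: le_Rintegral => //.
  rewrite (_ : EFin \o _ = EFin \o (fun s => `|f s| * convol \1_K (moll r) s)); last first.
    by apply/funext => s /=; rewrite mulrC.
  apply: integrable_mul_bounded => //.
    by apply: continuous_measurable_rV; apply: continuous_conv => //; exact: test_moll.
  exists 1 => z _; rewrite -[X in `|X|]subr0; apply: conv_moll_near => //.
  by apply: aeW => s _; rewrite subr0 indicE; case: (_ \in _); rewrite ?normr1 ?normr0.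
move=> z _; rewrite ler_piMl//; apply: conv_moll_le => //.
by apply: aeW => s _; rewrite indicE; case: (_ \in _).
Qed.

End Mollifier.

(** * The Euclidean norm *)

Section EuclideanNorm.
Context {R : realType} {m : nat}.
Implicit Types (x y z : 'rV[R]_m) (a b c : R).

Lemma dotC x y : dot x y = dot y x.
Proof. by apply: eq_bigr => i _; rewrite mulrC. Qed.

Lemma dotDl x y z : dot (x + y) z = dot x z + dot y z.
Proof. by rewrite -big_split/=; apply: eq_bigr => i _; rewrite !mxE mulrDl. Qed.

Lemma dotZl a x y : dot (a *: x) y = a * dot x y.
Proof. by rewrite mulr_sumr; apply: eq_bigr => i _; rewrite !mxE mulrA. Qed.

Lemma dotDr x y z : dot x (y + z) = dot x y + dot x z.
Proof. by rewrite dotC dotDl !(dotC x). Qed.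

Lemma dotZr a x y : dot x (a *: y) = a * dot x y.
Proof. by rewrite dotC dotZl dotC. Qed.

Lemma dotNr x y : dot x (- y) = - dot x y.
Proof. by rewrite -scaleN1r dotZr mulN1r. Qed.

Lemma dotNl x y : dot (- x) y = - dot x y.
Proof. by rewrite dotC dotNr dotC. Qed.

Lemma dot_ge0 x : 0 <= dot x x.
Proof. by apply: sumr_ge0 => i _; rewrite -expr2 sqr_ge0. Qed.

Lemma dot_eq0 x : (dot x x == 0) = (x == 0).
Proof.
apply/idP/eqP => [|->]; last by rewrite /dot big1// => i _; rewrite mxE mul0r.
rewrite psumr_eq0; last by move=> i _; rewrite -expr2 sqr_ge0.
move=> /allP h; apply/rowP => i; have /= := h i (mem_index_enum _).
by rewrite -expr2 sqrf_eq0 mxE => /eqP.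
Qed.

Lemma enorm_ge0 x : 0 <= enorm x. Proof. exact: sqrtr_ge0. Qed.

Lemma sqr_enorm x : enorm x ^+ 2 = dot x x.
Proof. by rewrite sqr_sqrtr// dot_ge0. Qed.

Lemma enorm_eq0 x : (enorm x == 0) = (x == 0).
Proof. by rewrite -dot_eq0 -sqr_enorm sqrf_eq0. Qed.

Lemma enorm_gt0 x : (0 < enorm x) = (x != 0).
Proof. by rewrite lt_def enorm_ge0 andbT enorm_eq0. Qed.

Lemma enorm0 : enorm (0 : 'rV[R]_m) = 0.
Proof. by apply/eqP; rewrite enorm_eq0. Qed.

Lemma enormZ a x : enorm (a *: x) = `|a| * enorm x.
Proof. by rewrite /enorm dotZl dotZr mulrA -expr2 sqrtrM ?sqr_ge0// sqrtr_sqr. Qed.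

Lemma enormN x : enorm (- x) = enorm x.
Proof. by rewrite -scaleN1r enormZ normrN1 mul1r. Qed.

Lemma enormBC x y : enorm (x - y) = enorm (y - x).
Proof. by rewrite -enormN opprB. Qed.

(** The defect in the Cauchy-Schwarz inequality is |y|^2 times the squared distance of [x] to its
    projection on the line of [y]. *)
Lemma dot_lagrange x y : dot x x * dot y y - dot x y ^+ 2 =
  dot y y * dot (x - (dot x y / dot y y) *: y) (x - (dot x y / dot y y) *: y).
Proof.
have [->|y0] := eqVneq y 0.
  have d0 z : dot z (0 : 'rV[R]_m) = 0 by rewrite /dot big1// => i _; rewrite mxE mulr0.
  by rewrite !d0 expr0n mulr0 mul0r subr0.
have yy : dot y y != 0 by rewrite dot_eq0.
rewrite !(dotDl, dotDr, dotNl, dotNr, dotZl, dotZr) (dotC y x); field.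
by [].
Qed.

Lemma cauchy_schwarz x y : dot x y <= enorm x * enorm y.
Proof.
apply: le_trans (ler_norm _) _.
rewrite -(@ler_pXn2r _ 2)// ?nnegrE ?mulr_ge0 ?enorm_ge0//.
rewrite exprMn !sqr_enorm real_normK ?num_real// -subr_ge0 dot_lagrange.
by rewrite mulr_ge0 ?dot_ge0.
Qed.

Lemma cauchy_schwarz_abs x y : `|dot x y| <= enorm x * enorm y.
Proof.
rewrite ler_norml cauchy_schwarz andbT lerNl -dotNl.
by apply: le_trans (cauchy_schwarz _ _) _; rewrite enormN.
Qed.

Lemma enormD x y : enorm (x + y) <= enorm x + enorm y.
Proof.
rewrite -(@ler_pXn2r _ 2)// ?nnegrE ?addr_ge0 ?enorm_ge0//.
rewrite sqrrD !sqr_enorm !(dotDl, dotDr) (dotC y x).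
have := cauchy_schwarz x y; lra.
Qed.

(* Equality in the triangle inequality forces the two vectors to be parallel. *)
Lemma enormD_eq x y : enorm (x + y) = enorm x + enorm y -> enorm y *: x = enorm x *: y.
Proof.
move=> h; apply/eqP; rewrite -subr_eq0 -dot_eq0.
have /eqP : enorm (x + y) ^+ 2 = (enorm x + enorm y) ^+ 2 by rewrite h.
rewrite sqrrD !sqr_enorm !(dotDl, dotDr) (dotC y x) => /eqP e.
have xy : dot x y = enorm x * enorm y by lra.
rewrite !(dotNl, dotNr, dotZl, dotZr) (dotC y x) xy -!sqr_enorm; apply/eqP; ring.
Qed.

Lemma coord_le_enorm x i : `|x 0 i| <= enorm x.
Proof.
rewrite -sqrtr_sqr; apply: ler_wsqrtr; rewrite /dot (bigD1 i)//= -expr2 lerDl.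
by apply: sumr_ge0 => j _; rewrite -expr2 sqr_ge0.
Qed.

Lemma norm_le_enorm x : `|x| <= enorm x.
Proof. by rewrite norm_rV_le ?enorm_ge0//; apply/forallP => i; exact: coord_le_enorm. Qed.

Lemma enorm_le_norm x : enorm x <= Num.sqrt m%:R * `|x|.
Proof.
rewrite -[`|x|]normr_id -sqrtr_sqr -sqrtrM; last exact: ler0n.
apply: ler_wsqrtr; rewrite /dot.
apply: (@le_trans _ _ (\sum_(i < m) `|x| ^+ 2)); last by rewrite sumr_const card_ord mulr_natl.
apply: ler_sum => i _; rewrite -expr2 -[x 0 i ^+ 2]real_normK ?num_real//.
by rewrite ler_pXn2r ?nnegrE ?normr_ge0// coord_le_norm.
Qed.

Lemma dist_enorm x y : `|enorm x - enorm y| <= enorm (x - y).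
Proof.
rewrite ler_distl lerBlDr; apply/andP; split.
  by rewrite -[y in X in X <= _](subrK x) addrC enormBC; apply: le_trans (enormD _ _) _; rewrite addrC.
by rewrite -[x in X in X <= _](subrK y) addrC; apply: le_trans (enormD _ _) _; rewrite addrC.
Qed.

Lemma continuous_enorm : continuous (@enorm R m).
Proof.
apply: (@lipschitz_continuous_rV _ _ _ (Num.sqrt m%:R)) => x y.
by apply: le_trans (dist_enorm _ _) _; exact: enorm_le_norm.
Qed.

End EuclideanNorm.

Section RintegralSum.
Context d (T : measurableType d) {R : realType} (nu : {measure set T -> \bar R}).

Lemma integrable_sum_fun (D : set T) (I : Type) (s : seq I) (F : I -> T -> R) : measurable D ->
  (forall i, nu.-integrable D (EFin \o F i)) ->
  nu.-integrable D (EFin \o (fun z => \sum_(i <- s) F i z)).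
Proof.
move=> mD Fi; elim: s => [|i s IH].
  rewrite (_ : EFin \o _ = cst 0%E); first exact: integrable0.
  by apply/funext => z /=; rewrite big_nil.
rewrite (_ : EFin \o _ = (fun z => (F i z)%:E + (\sum_(i <- s) F i z)%R%:E)%E).
  exact: (integrableD mD (Fi i) IH).
by apply/funext => z /=; rewrite big_cons EFinD.
Qed.

Lemma Rintegral_sum (D : set T) (I : Type) (s : seq I) (F : I -> T -> R) : measurable D ->
  (forall i, nu.-integrable D (EFin \o F i)) ->
  \int[nu]_(z in D) (\sum_(i <- s) F i z) = \sum_(i <- s) \int[nu]_(z in D) F i z.
Proof.
move=> mD Fi; elim: s => [|i s IH].
  rewrite big_nil (_ : (fun _ => _) = cst 0); first by rewrite Rintegral_cst// mul0r.
  by apply/funext => z; rewrite big_nil.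
rewrite big_cons -IH -RintegralD//; last exact: integrable_sum_fun.
by congr Rintegral; apply/funext => z; rewrite big_cons.
Qed.

End RintegralSum.

(** * Lipschitz bound along segments *)

Section Thickening.
Context {R : realType} {m : nat}.
Implicit Types (x z : 'rV[R]_m) (S Omega : set 'rV[R]_m).

(** A closed neighbourhood for the sup norm, given by a witness in [S] instead of a distance: it is
    a sum set, hence compact with [S], and radii add up by the triangle inequality. *)
Definition thick S (r : R) : set 'rV[R]_m := [set z | exists2 s, S s & `|z - s| <= r].

Lemma compact_thick S r : compact S -> compact (thick S r).
Proof.
move=> cS.
rewrite (_ : thick S r = (fun p : 'rV[R]_m * 'rV[R]_m => p.1 + p.2) @` (S `*` [set z : 'rV[R]_m | `|z| <= r])).
  apply: continuous_compact.
    by apply: continuous_subspaceT => p; exact: add_continuous.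
  by apply: compact_setX => //; exact: closed_norm_ball_compact.
apply/seteqP; split => [z [s Ss zs]|_ [[s b] /= [Ss br] <-]].
  by exists (s, z - s) => //=; rewrite addrC subrK.
by exists s => //; rewrite addrC addKr.
Qed.

(** Each point of [S] has a margin valid for all nearby points; the near-covering form of
    compactness, along the filter [0^'+] of radii, makes it uniform. *)
Lemma compact_margin S Omega : compact S -> open Omega -> S `<=` Omega ->
  exists2 r : R, 0 < r & thick S r `<=` Omega.
Proof.
move=> /compact_near_coveringP cS oO SO.
have := cS R (0 : R)^'+ (fun e s => forall z, `|z - s| <= e -> Omega z) _.
case=> [x /SO Ox|e /= e0 he].
  have /nbhs_ballP[e /= e0 eO] := open_nbhs_nbhs (conj oO Ox).
  have e20 : 0 < e / 2 by rewrite divr_gt0.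
  near=> x' r.
  have xx' : `|x - x'| < e / 2.
    by near: x'; have := nbhsx_ballx x (e / 2) e20; rewrite -ball_normE.
  have re : r <= e / 2 by near: r; exact: nbhs_right_le.
  move=> z zx'; apply: eO; rewrite -ball_normE/= -[x - z](subrKA x').
  apply: le_lt_trans (ler_normD _ _) _; rewrite [ltRHS]splitr; apply: ltr_leD => //.
  by rewrite distrC; exact: le_trans zx' re.
exists (e / 2); first by rewrite divr_gt0.
move=> z [s Ss zs]; apply: (he (e / 2)) Ss _ zs => /=.
- by rewrite sub0r normrN ger0_norm ?divr_ge0 ?ltW// ltr_pdivrMr// ltr_pMr// ltr1n.
- by rewrite divr_gt0.
Unshelve. all: by end_near. Qed.

Lemma continuous_line x w : continuous (fun t : R => x + t *: w).
Proof.
move=> t; apply: cvgD; first exact: cvg_cst.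
by apply: cvgZr_tmp; exact: cvg_id.
Qed.

Lemma compact_segment x w : compact [set z | exists2 t : R, 0 <= t <= 1 & z = x + t *: w].
Proof.
rewrite (_ : [set _ | _] = (fun t : R => x + t *: w) @` `[0, 1]).
  apply: continuous_compact; last exact: segment_compact.
  exact: continuous_subspaceT (@continuous_line x w).
apply/seteqP; split => [z [t t01 ->]|_ [t t01 <-]].
  by exists t => //=; rewrite in_itv.
by exists t => //; move: t01; rewrite /= in_itv.
Qed.

End Thickening.

(** * Mollification of weakly differentiable functions *)

Section LocalMollification.
Context {R : realType} {m : nat}.
Implicit Types (x z w : 'rV[R]_m) (K Omega : set 'rV[R]_m) (f v : 'rV[R]_m -> R).
Local Notation mu := (lebesgue_rV R m).

Lemma integrable_patch K f : measurable K -> mu.-integrable K (EFin \o f) ->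
  mu.-integrable setT (EFin \o (f \_ K)).
Proof. by move=> mK; rewrite (integrable_mkcond _ mK) restrict_EFin. Qed.

(** Convolutions run over the whole space while weak derivatives are tested in [Omega]. Cutting [f]
    off outside [K] reconciles the two, and has no effect at points whose [r]-ball stays in [K]. *)
Lemma convol_patch K Omega f k z r : K `<=` Omega -> (forall s, `|s - z| <= r -> K s) ->
  (forall s, r < `|s| -> k s = 0) ->
  convol (f \_ K) k z = \int[mu]_(s in Omega) (f s * k (s - z)).
Proof.
move=> KO zK kr.
have k0 s : ~ K s -> k (s - z) = 0.
  by move=> nK; apply: kr; rewrite ltNge; apply/negP => /zK.
rewrite (Rintegral_support KO); last by move=> s /k0 ->; rewrite mulr0.
rewrite /convol (@Rintegral_support _ _ K setT)//; last by move=> s /k0 ->; rewrite mulr0.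
by apply: eq_Rintegral => s sK; rewrite patchE sK.
Qed.

Variables (Omega : set 'rV[R]_m) (v : 'rV[R]_m -> R) (g : 'rV[R]_m -> 'rV[R]_m).
Hypotheses (oO : open Omega) (wg : weak_gradient Omega v g).
Variables (K : set 'rV[R]_m) (cK : compact K) (KO : K `<=` Omega).

Let mO := open_measurable_rV oO.
Let mK := compact_measurable_rV cK.

Lemma weak_patch_integrable : mu.-integrable setT (EFin \o (v \_ K)).
Proof. by apply: integrable_patch => //; have [lv _ _] := wg; exact: lv. Qed.

Lemma weak_patch_grad_integrable i : mu.-integrable setT (EFin \o ((fun s => g s 0 i) \_ K)).
Proof. by apply: integrable_patch => //; have [_ lg _] := wg; exact: lg. Qed.

Lemma weak_dot_integrable w : mu.-integrable K (EFin \o (fun s => dot w (g s))).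
Proof.
apply: integrable_sum_fun => // i.
rewrite (_ : EFin \o _ = (fun s => (w 0 i)%:E * (g s 0 i)%:E)%E); last by apply/funext.
by apply: integrableZl => //; have [_ lg _] := wg; exact: lg.
Qed.

(** The translate of [moll r] centred at [z] is a test function in [Omega]; the identity is the
    definition of the weak gradient tested with it. *)
Lemma convol_weak_partial r z i : 0 < r -> (forall s, `|s - z| <= r -> K s) ->
  - convol (v \_ K) (partial i (moll r)) z = convol ((fun s => g s 0 i) \_ K) (moll r) z.
Proof.
move=> r0 zK.
have tm := test_moll (m := m) r0.
have mr (s : 'rV[R]_m) : r < `|s| -> moll r s = 0 by move=> rs; exact: (moll_eq0 r0 (ltW rs)).
have dmr (s : 'rV[R]_m) : r < `|s| -> partial i (moll r) s = 0.
  move=> rs; apply: (@partial_support _ _ i (moll r) [set s | `|s| <= r]).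
  - exact: closed_norm_ball_compact.
  - by move=> y /= /negP; rewrite -ltNge; exact: mr.
  - by move=> /=; apply/negP; rewrite -ltNge.
rewrite (convol_patch _ KO zK dmr) (convol_patch _ KO zK mr).
have tz : test_function Omega (fun s => moll r (s - z)).
  have [sz cz] := test_function_translate z tm; split => //.
  apply: (compact_support_sub cK KO) => s nK; apply: mr.
  by rewrite ltNge; apply/negP => /zK.
have [_ lg h] := wg; have := h _ i tz.
under eq_integral do rewrite (partial_translate _ _ _ tm).
rewrite /Rintegral => ->; rewrite fineN opprK//.
Qed.

Lemma is_derive_convol_weak r w z : 0 < r -> (forall s, `|s - z| <= r -> K s) ->
  is_derive z w (convol (v \_ K) (moll r)) (convol ((fun s => dot w (g s)) \_ K) (moll r) z).
Proof.
move=> r0 zK.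
have tm := test_moll (m := m) r0.
have cp i : continuous (partial i (moll r) : 'rV[R]_m -> R) by exact: (tm.1 [:: i]).1.
have /choice[Md hMd] : forall i : 'I_m, exists M : R, forall z, `|partial i (moll r) z| <= M.
  by move=> i; have [M _ hM] := test_function_bounded (test_function_partial i tm); exists M.
have := @is_derive_conv _ _ (v \_ K) (moll r) (fun s => \sum_i w 0 i * partial i (moll r) s) w z
  weak_patch_integrable (is_derive_moll r w) (@continuous_moll _ _ r).
have cs : continuous (fun s => \sum_i w 0 i * partial i (moll r) s).
  elim: (index_enum _) => [|i s IH].
    by rewrite (_ : (fun _ => _) = fun=> 0); [exact: continuous_cst|apply/funext => y; rewrite big_nil].
  rewrite (_ : (fun _ => _) = fun y => w 0 i * partial i (moll r) y + \sum_(j <- s) w 0 j * partial j (moll r) y).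
    by apply: continuous_add => //; apply: continuous_mul => //; exact: continuous_cst.
  by apply/funext => y; rewrite big_cons.
move=> /(_ cs (moll_bounded r0)) h; apply: is_derive_eq (h _) _.
  exists (\sum_i `|w 0 i| * Md i) => s; apply: le_trans (ler_norm_sum _ _ _) _.
  by apply: ler_sum => i _; rewrite normrM ler_wpM2l.
have vi (i : 'I_m) : mu.-integrable setT (EFin \o (fun s => (v \_ K) s * (partial i (moll r) (s - z)))).
  exact: (@conv_integrable _ _ (v \_ K) (partial i (moll r)) z weak_patch_integrable (cp i) (ex_intro _ (Md i) (hMd i))).
transitivity (\sum_i w 0 i * - convol (v \_ K) (partial i (moll r)) z).
  rewrite /convol.
  have e s : (v \_ K) s * (\sum_i w 0 i * partial i (moll r) (s - z)) =
      \sum_i w 0 i * ((v \_ K) s * partial i (moll r) (s - z)).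
    by rewrite mulr_sumr; apply: eq_bigr => i _; rewrite mulrCA.
  have wi (i : 'I_m) : mu.-integrable setT (EFin \o (fun s => w 0 i * ((v \_ K) s * (partial i (moll r) (s - z))))).
    exact: (integrableZl measurableT (w 0 i) (vi i)).
  rewrite (eq_Rintegral _ (fun s _ => e s)) Rintegral_sum// -sumrN.
  by apply: eq_bigr => i _; rewrite RintegralZl// mulrN.
under eq_bigr do rewrite convol_weak_partial//.
rewrite /convol.
have gi (i : 'I_m) : mu.-integrable setT (EFin \o (fun s => ((fun s => g s 0 i) \_ K) s * (moll r (s - z)))).
  exact: (@conv_integrable _ _ ((fun s => g s 0 i) \_ K) (moll r) z (weak_patch_grad_integrable i) (@continuous_moll _ _ r) (moll_bounded r0)).
have wi (i : 'I_m) : mu.-integrable setT (EFin \o (fun s => w 0 i * (((fun s => g s 0 i) \_ K) s * (moll r (s - z))))).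
  exact: (integrableZl measurableT (w 0 i) (gi i)).
have e s : ((fun s => dot w (g s)) \_ K) s * moll r (s - z) =
    \sum_i w 0 i * (((fun s => g s 0 i) \_ K) s * moll r (s - z)).
  under eq_bigr do rewrite patchE.
  rewrite patchE; case: ifP => _; last by rewrite mul0r big1// => i _; rewrite ?mul0r mulr0.
  by rewrite /dot mulr_suml; apply: eq_bigr => i _; rewrite mulrA.
rewrite (eq_Rintegral _ (fun s _ => e s)) Rintegral_sum//.
by apply: eq_bigr => i _; rewrite RintegralZl.
Qed.

Lemma convol_weak_dot_le r w z : 0 < r -> (forall s, `|s - z| <= r -> K s) ->
  {ae mu, forall s, Omega s -> enorm (g s) <= 1} ->
  convol ((fun s => dot w (g s)) \_ K) (moll r) z <= enorm w.
Proof.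
move=> r0 zK g1; apply: conv_moll_le => //.
  by apply: integrable_patch => //; exact: weak_dot_integrable.
apply: filterS g1 => s gs sz.
have Ks : K s by apply: zK; exact: ltW.
rewrite patchE mem_set//; apply: le_trans (cauchy_schwarz _ _) _.
by rewrite ler_piMr ?enorm_ge0// gs//; exact: KO.
Qed.

End LocalMollification.

Section Lipschitz.
Context {R : realType} {m : nat}.
Implicit Types (x z w : 'rV[R]_m) (K Omega : set 'rV[R]_m) (f v : 'rV[R]_m -> R).
Local Notation mu := (lebesgue_rV R m).

Lemma within_continuous_dist Omega v x : open Omega -> {within Omega, continuous v} -> Omega x ->
  forall e : R, 0 < e -> exists2 d : R, 0 < d & forall s, `|s - x| < d -> Omega s /\ `|v s - v x| <= e.
Proof.
move=> oO; rewrite continuous_open_subspace// => cv Ox e e0.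
have /cvgrPdist_le/(_ e e0) h := cv x (mem_set Ox).
have /nbhs_ballP[d1 /= d10 h1] := h.
have /nbhs_ballP[d2 /= d20 h2] := open_nbhs_nbhs (conj oO Ox).
exists (Num.min d1 d2); first by rewrite lt_min d10.
move=> s; rewrite lt_min => /andP[sd1 sd2]; split.
  by apply: h2; rewrite -ball_normE/= distrC.
by rewrite distrC; apply: h1; rewrite -ball_normE/= distrC.
Qed.

(** The null set where the bound on [g] fails may contain the whole segment. After mollification
    with a radius [d] within the margin of the segment, the derivative along [w] is an average of
    [dot w (g s)], at most [enorm w] at every point, and the mean value theorem applies. Continuity
    of [v] at the two end points absorbs the error [e]. *)
Lemma lipschitz_of_weak_gradient Omega v g x y : open Omega -> weak_gradient Omega v g ->
  {within Omega, continuous v} -> {ae mu, forall s, Omega s -> enorm (g s) <= 1} ->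
  (forall t : R, 0 <= t <= 1 -> Omega (x + t *: (y - x))) ->
  v y - v x <= enorm (y - x).
Proof.
move=> oO wg cv g1 xyO; set w := y - x.
have Ox : Omega x by have := xyO 0; rewrite scale0r addr0; apply; rewrite lexx ler01.
have Oy : Omega y by have := xyO 1; rewrite scale1r addrC subrK; apply; rewrite ler01 lexx.
pose S := [set z | exists2 t : R, 0 <= t <= 1 & z = x + t *: w].
have cS : compact S by exact: compact_segment.
have SO : S `<=` Omega by move=> _ [t t01 ->]; exact: xyO.
have [r r0 rO] := compact_margin cS oO SO.
have cK := @compact_thick _ _ S r cS.
have vK : mu.-integrable setT (EFin \o (v \_ (thick S r))) by exact: weak_patch_integrable wg _ cK rO.
apply/ler_addgt0Pl => e e0; have e20 : 0 < e / 2 by rewrite divr_gt0.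
have [d1 d10 h1] := within_continuous_dist oO cv Ox e20.
have [d2 d20 h2] := within_continuous_dist oO cv Oy e20.
pose d := Num.min r (Num.min d1 d2).
have d0 : 0 < d by rewrite !lt_min r0 d10.
have dr : d <= r by rewrite ge_min lexx.
have SK z : S z -> forall s, `|s - z| <= d -> thick S r s.
  by move=> Sz s sz; exists z => //; exact: le_trans dr.
have Sx : S x by exists 0; rewrite ?scale0r ?addr0// lexx ler01.
have Sy : S y by exists 1; rewrite ?scale1r ?ler01 ?lexx// addrC subrK.
have near z d' : S z -> d <= d' -> (forall s, `|s - z| < d' -> Omega s /\ `|v s - v z| <= e / 2) ->
    `|convol (v \_ (thick S r)) (moll d) z - v z| <= e / 2.
  move=> Sz dd' h; apply: conv_moll_near => //; apply: aeW => s sz.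
  by rewrite patchE mem_set; [apply: (h s _).2; exact: lt_le_trans dd'|apply: (SK z Sz); exact: ltW].
have nx := near x d1 Sx _ h1; have ny := near y d2 Sy _ h2.
have {}nx := nx (_ : d <= d1); have {}ny := ny (_ : d <= d2).
have {}nx : `|convol (v \_ (thick S r)) (moll d) x - v x| <= e / 2.
  by apply: nx; rewrite /d !ge_min lexx orbT.
have {}ny : `|convol (v \_ (thick S r)) (moll d) y - v y| <= e / 2.
  by apply: ny; rewrite /d !ge_min lexx !orbT.
have [t t01|c c01] := @line_mvt _ _ (convol (v \_ (thick S r)) (moll d)) x w
   (fun t => convol ((fun s => dot w (g s)) \_ (thick S r)) (moll d) (t *: w + x)).
  apply: (is_derive_convol_weak wg) => //.
  by apply: SK; exists t => //; rewrite addrC.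
rewrite subrK => e1.
have h : convol (v \_ (thick S r)) (moll d) y - convol (v \_ (thick S r)) (moll d) x <= enorm w.
  rewrite e1; apply: (convol_weak_dot_le wg) => //.
  by apply: SK; exists c => //; rewrite addrC.
move: nx ny h; move: (convol _ _ y) (convol _ _ x) (v x) (v y) (enorm w) => A B a b n.
rewrite !ler_distl => /andP[a1 a2] /andP[a3 a4] h; clear - a1 a2 a3 a4 h e0; lra.
Qed.

End Lipschitz.

(** * The chain rule for weak gradients *)

Section IntegralOfDerivative.
Context {R : realType} {m : nat}.
Local Notation mu := (lebesgue_rV R m).

Lemma thickD (S : set 'rV[R]_m) (a b : R) z z' : thick S a z -> `|z' - z| <= b -> thick S (a + b) z'.
Proof.
move=> [s Ss zs] zz; exists s => //; rewrite -(subrKA z) addrC.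
by apply: le_trans (ler_normD _ _) _; rewrite lerD.
Qed.

Lemma bounded_support_integrable (K : set 'rV[R]_m) (F : 'rV[R]_m -> R) (M : R) : compact K ->
  measurable_fun setT F -> (forall z, `|F z| <= M) -> (forall z, ~ K z -> F z = 0) ->
  mu.-integrable setT (EFin \o F).
Proof.
move=> cK mF FM FK; have mK := compact_measurable_rV cK.
apply/(integrable_support (K := K)) => //.
by apply: (@compact_integrable _ _ _ _ M) => //; exact: measurable_funTS.
Qed.

Lemma norm_delta_mx (i : 'I_m) : `|delta_mx 0 i : 'rV[R]_m| <= 1.
Proof.
rewrite norm_rV_le//; apply/forallP => j; rewrite mxE eqxx/=.
by case: eqP => _; rewrite ?normr1 ?normr0.
Qed.

(* The integral of a difference quotient vanishes by translation invariance. *)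
Lemma integral_partial_eq0 (K : set 'rV[R]_m) (F dF : 'rV[R]_m -> R) (i : 'I_m) (M : R) :
  compact K -> continuous F -> (forall z, ~ K z -> F z = 0) ->
  (forall z, is_derive z (delta_mx 0 i) F (dF z)) -> (forall z, `|dF z| <= M) ->
  \int[mu]_z dF z = 0.
Proof.
move=> cK cF FK hF hM.
pose e : 'rV[R]_m := delta_mx 0 i.
pose t (n : nat) : R := n.+1%:R^-1.
have t0 n : 0 < t n by rewrite invr_gt0.
have t1 n : t n <= 1 by rewrite invf_le1 ?ler1n.
pose q n z : R := (t n)^-1 * (F (z + t n *: e) - F z).
have M0 : 0 <= M by apply: le_trans (hM 0).
have [B B0 hB] := continuous_bounded_on cK (continuous_subspaceT cF).
have FB z : `|F z| <= B by have [/hB//|/FK ->] := pselect (K z); rewrite normr0.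
have mF : measurable_fun setT F by exact: continuous_measurable_rV.
have Fi : mu.-integrable setT (EFin \o F) by exact: bounded_support_integrable cK mF FB FK.
have Fsi n : mu.-integrable setT (EFin \o (fun z => F (z + t n *: e))) by exact: (@integrable_shift _ _ _ (EFin \o F)).
have K'c := @compact_thick _ _ K 1 cK; have mK' := compact_measurable_rV K'c.
(* As [t n <= 1], the quotients vanish off the unit neighbourhood of [K], whose indicator times [M]
   dominates them. *)
have qB n z : `|q n z| <= M * (\1_(thick K 1) z).
  rewrite indicE; have [zK|zK] := boolP (z \in thick K 1); last first.
    rewrite /q !FK ?subr0 ?mulr0 ?normr0 ?mulr0// => Kz; move/negP : zK; apply; apply/mem_set.
      by exists z => //; rewrite subrr normr0.
    by exists (z + t n *: e) => //; rewrite opprD addNKr normrN normrZ gtr0_norm//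
      mulr_ile1 ?norm_delta_mx// ltW.
  rewrite mulr1 /q normrM normfV (gtr0_norm (t0 n)) ler_pdivrMl//.
  have [|c _] := @line_mvt _ _ F z (t n *: e) (fun s => t n * dF (s *: (t n *: e) + z)).
    move=> s _; apply/is_derive_line; set x := _ + z.
    apply: (is_derive_ext (f := fun h : R => F ((t n * h) *: e + x))).
      by move=> h; rewrite scalerA mulrC.
    have hd : is_derive (t n * 0) 1 (fun h : R => F (h *: e + x)) (dF x).
      by rewrite mulr0; apply/(is_derive_line F x).
    have hc : is_derive (0 : R) 1 (fun h : R => t n * h) (t n).
      by apply: is_derive_eq (is_deriveZ (t n) (is_derive_id _ _)) _; exact: mulr1.
    by rewrite mulrC; exact: (is_derive_comp1 hd hc).
  by rewrite [t n *: e + z]addrC => ->; rewrite normrM (gtr0_norm (t0 n)) ler_wpM2l// ltW.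
have lim1 : \int[mu]_z q n z @[n --> \oo] --> \int[mu]_z dF z.
  apply: (dominated_Rintegral measurableT (g := fun z => M * (\1_(thick K 1) z))) => [n|||z _].
  - rewrite /q; apply: measurable_funM; first exact: measurable_cst.
    apply: measurable_funB => //; apply: measurableT_comp => //; exact: measurable_shift.
  - apply: (@bounded_support_integrable _ _ M K'c).
    + by apply: measurable_funM => //; exact: measurable_indic.
    + by move=> z; rewrite indicE ger0_norm; case: (_ \in _); rewrite ?mulr1 ?mulr0.
    + by move=> z nz; rewrite indicE memNset// mulr0.
  - by move=> n z _; exact: qB.
  - have [+ hl] := hF z; rewrite /derivable => /cvg_ex[l hl'].
    have el : l = dF z by rewrite -hl; apply/esym/cvg_lim.
    rewrite -el.
    have tc : t n @[n --> \oo] --> (0 : R) by exact: cvg_harmonic.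
    have ht : (forall n, t n != 0) /\ t n @[n --> \oo] --> (0 : R).
      by split => // n; rewrite gt_eqF.
    move/cvgr_dnbhsP : hl' => /(_ t ht) hq; apply: cvg_trans hq.
    by apply: near_eq_cvg; apply: nearW => n /=; rewrite /q [z + _]addrC.
apply: (cvg_unique _ lim1) => //.
rewrite (_ : (fun n => _) = fun=> 0); first exact: cvg_cst.
apply/funext => n; rewrite /q RintegralZl//; last first.
  rewrite (_ : EFin \o _ = (fun z => (F (z + t n *: e))%:E - (F z)%:E)%E); last by apply/funext.
  by apply: integrableB => //; exact: Fsi.
rewrite RintegralB// /Rintegral (@integral_shift _ _ _ (EFin \o F))// subrr mulr0.
by [].
Qed.

End IntegralOfDerivative.

Lemma near_continuous_at (T : topologicalType) (U : topologicalType) (F G : T -> U) (z : T) :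
  (\forall y \near z, F y = G y) -> {for z, continuous G} -> {for z, continuous F}.
Proof.
move=> FG cG; rewrite /prop_for /continuous_at (nbhs_singleton FG).
apply: cvg_trans cG; apply: near_eq_cvg.
by apply: filterS FG => y ->.
Qed.

Lemma continuous_sub (R : realType) m (f g : 'rV[R]_m -> R) :
  continuous f -> continuous g -> continuous (fun z => f z - g z).
Proof. by move=> cf cg z; exact: (continuousB (cf z) (cg z)). Qed.

Section ChainRule.
Context {R : realType} {m : nat}.
Local Notation mu := (lebesgue_rV R m).
Variables (Omega : set 'rV[R]_m) (u : 'rV[R]_m -> R) (g : 'rV[R]_m -> 'rV[R]_m).
Hypotheses (oO : open Omega) (wg : weak_gradient Omega u g) (cu : {within Omega, continuous u}).
Hypothesis (g1 : {ae mu, forall s, Omega s -> enorm (g s) <= 1}).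
Variables (S : set 'rV[R]_m) (r : R) (cS : compact S) (r0 : 0 < r)
  (rO : thick S (r + r + r) `<=` Omega).
Variables (h : 'rV[R]_m -> R) (dh : 'I_m -> 'rV[R]_m -> R).
Hypotheses (ch : continuous h) (cdh : forall i, continuous (dh i))
  (hh : forall i z, is_derive z (delta_mx 0 i) h (dh i z)).
Variables (P P' : R -> R).
Hypotheses (dP : forall s : R, is_derive s 1 P (P' s)) (cP' : continuous P')
  (P0 : forall s : R, s <= 0 -> P s = 0) (P'0 : forall s : R, s <= 0 -> P' s = 0).
Variable (c : R).
Hypotheses (c0 : 0 < c)
  (fneg : forall z, thick S (r + r) z -> ~ thick S r z -> u z - h z <= - c).

(** Three nested neighbourhoods. On the shell between [N1] and [N] the function [u - h] is at most
    [- c], so composing with [P] and cutting off outside [N] creates no jump; the layer between [N]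
    and [K] leaves room for mollifying with radius at most [r] at the points of [N]. *)
Let N1 := thick S r.
Let N := thick S (r + r).
Let K := thick S (r + r + r).
Let cK : compact K := @compact_thick _ _ S (r + r + r) cS.
Let cN : compact N := @compact_thick _ _ S (r + r) cS.
Let mN := compact_measurable_rV cN.
Let mK := compact_measurable_rV cK.
Let NK : N `<=` K.
Proof.
move=> z [s Ss zs]; exists s => //; apply: le_trans zs _; by rewrite lerDl ltW.
Qed.
Let NO : N `<=` Omega. Proof. exact: subset_trans NK rO. Qed.
Let N1N z s : N1 z -> `|s - z| <= r -> N s. Proof. exact: thickD. Qed.
Let NrK z s : N z -> `|s - z| <= r -> K s. Proof. exact: thickD. Qed.
Let N1subN : N1 `<=` N. Proof. by move=> z N1z; apply: (N1N N1z); rewrite subrr normr0 ltW. Qed.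

Let near_cut (q : 'rV[R]_m -> R) z : N1 z -> \forall y \near z, (q \_ N) y = q y.
Proof.
move=> N1z; apply/nbhs_ballP; exists r => // y; rewrite -ball_normE/= => zy.
by rewrite patchE mem_set//; apply: (N1N N1z); rewrite distrC ltW.
Qed.

Let near_out (q : 'rV[R]_m -> R) z : (forall y, N y -> ~ N1 y -> q y = 0) -> ~ N1 z ->
  \forall y \near z, (q \_ N) y = 0.
Proof.
move=> q0 nz.
have cN1 : closed N1 by apply: compact_closed; [exact: norm_hausdorff|exact: compact_thick].
have : nbhs z (~` N1) by apply: open_nbhs_nbhs; split => //; exact: closed_openC.
apply: filterS => y nN1; rewrite patchE; case: ifPn => [/set_mem Ny|//]; exact: q0.
Qed.

Let cut_continuous (q : 'rV[R]_m -> R) : (forall y, N y -> ~ N1 y -> q y = 0) ->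
  (forall z, N1 z -> {for z, continuous q}) -> continuous (q \_ N).
Proof.
move=> q0 cq z; have [N1z|nz] := pselect (N1 z).
  by apply: near_continuous_at (cq z N1z); exact: near_cut.
apply: (@near_continuous_at _ _ _ (fun=> 0)); first exact: near_out.
exact: cst_continuous.
Qed.

Let q := Num.sqrt (m%:R : R).

(** The segment from [z] to [s] stays in [K] and is run in both directions. The factor
    [Num.sqrt m%:R] turns a sup norm displacement into a Euclidean length. *)
Lemma weak_lipschitz_thick z s d : thick S (r + r) z -> d <= r -> `|s - z| <= d -> `|u s - u z| <= Num.sqrt (m%:R : R) * d.
Proof.
move=> Nz dr sz; rewrite -/q.
have seg t : 0 <= t <= 1 -> K (z + t *: (s - z)).
  move=> /andP[t0 t1]; apply: (NrK Nz); rewrite addrC addKr normrZ ger0_norm//.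
  by apply: le_trans (le_trans sz dr); rewrite ler_piMl.
have h1 := lipschitz_of_weak_gradient oO wg cu g1 (fun t t01 => rO (seg t t01)).
have h2 : u z - u s <= enorm (z - s).
  apply: (lipschitz_of_weak_gradient oO wg cu g1) => t /andP[t0 t1]; apply: rO.
  rewrite (_ : _ + _ = z + (1 - t) *: (s - z)); first by apply: seg; rewrite subr_ge0 t1/= lerBlDr lerDl.
  by rewrite scalerBl scale1r addrA [z + (s - z)]addrC subrK -scalerN opprB.
have e1 : enorm (s - z) <= q * d.
  by apply: le_trans (enorm_le_norm _) _; rewrite ler_wpM2l// sqrtr_ge0.
rewrite enormBC in h2.
by rewrite ler_norml lerNl opprB (le_trans h2 e1) (le_trans h1 e1).
Qed.

(** Chosen so that the mollification error [q * d n] is at most [c]: the approximations of [u - h]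
    then remain nonpositive on the shell and can be cut off in the same way. The [+ 1] keeps the
    denominator positive. *)
Let r1 := Num.min r (c / (q + 1)).
Let q0 : 0 <= q. Proof. exact: sqrtr_ge0. Qed.
Let r10 : 0 < r1. Proof. by rewrite lt_min r0 divr_gt0// ltr_wpDl. Qed.
Let d (n : nat) := r1 / n.+1%:R.
Let d0 n : 0 < d n. Proof. by rewrite divr_gt0. Qed.
Let dr n : d n <= r.
Proof.
apply: (@le_trans _ _ r1); last by rewrite ge_min lexx.
by rewrite ler_pdivrMr// ler_peMr ?ler1n// ltW.
Qed.
Let qd n : q * d n <= c.
Proof.
apply: (@le_trans _ _ (q * (c / (q + 1)))).
  rewrite ler_wpM2l//; apply: (@le_trans _ _ r1); last by rewrite ge_min lexx orbT.
  by rewrite ler_pdivrMr// ler_peMr ?ler1n// ltW.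
rewrite mulrCA ler_piMr//; first exact: ltW.
by rewrite ler_pdivrMr ?ltr_wpDl// mul1r lerDl.
Qed.
Let d_cvg : d n @[n --> \oo] --> (0 : R).
Proof.
rewrite -[X in _ --> X](mulr0 r1); apply: cvgM; first exact: cvg_cst.
exact: cvg_harmonic.
Qed.

Let uK_int := weak_patch_integrable wg cK rO.
Let un n := convol (u \_ K) (moll (d n)).
Let un_near n z : N z -> `|un n z - u z| <= q * d n.
Proof.
move=> Nz; apply: conv_moll_near => //; apply: aeW => s sz.
rewrite patchE mem_set; last by apply: (NrK Nz); exact: le_trans (ltW sz) (dr n).
by apply: weak_lipschitz_thick => //; exact: ltW.
Qed.
Let un_cvg z : N z -> un n z @[n --> \oo] --> u z.
Proof.
move=> Nz; apply/subr_cvg0; apply: norm_cvg0.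
apply: (@squeeze_cvgr _ _ _ _ (fun=> 0) (fun n => q * d n)).
- by apply: nearW => n; rewrite normr_ge0/= un_near.
- exact: cvg_cst.
- by rewrite -[X in _ --> X](mulr0 q); apply: cvgM => //; exact: cvg_cst.
Qed.

Let f z := u z - h z.
Let fn n z := un n z - h z.
Let fn_near n z : N z -> `|fn n z - f z| <= c.
Proof.
move=> Nz; rewrite /fn /f opprB addrA subrK; apply: le_trans (qd n); exact: un_near.
Qed.
Let fn_neg n z : N z -> ~ N1 z -> fn n z <= 0.
Proof.
move=> Nz nz; have := fn_near n Nz; rewrite ler_distl => /andP[_ /le_trans]; apply.
by rewrite -lerBrDr sub0r; exact: fneg.
Qed.
Let f_neg z : N z -> ~ N1 z -> f z <= 0.
Proof. by move=> Nz nz; apply: le_trans (fneg Nz nz) _; rewrite oppr_le0 ltW. Qed.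

Let cP : continuous P.
Proof.
by move=> s; apply/differentiable_continuous/derivable1_diffP; have [] := dP s.
Qed.

Let u_cont z : Omega z -> {for z, continuous u}.
Proof. by move=> Oz; move: cu; rewrite continuous_open_subspace// => /(_ z (mem_set Oz)). Qed.

Let f_cont z : N z -> {for z, continuous f}.
Proof. by move=> Nz; apply: continuousB; [exact/u_cont/NO|exact: ch]. Qed.

Let tm n := test_moll (m := m) (d0 n).

Let un_cont n : continuous (un n).
Proof. exact: continuous_conv. Qed.

Let fn_cont n : continuous (fn n).
Proof. by move=> z; apply: continuousB; [exact: un_cont|exact: ch]. Qed.

Let comp_cont (Q : R -> R) (w : 'rV[R]_m -> R) z : continuous Q -> {for z, continuous w} ->
  {for z, continuous (fun z => Q (w z))}.
Proof. by move=> cQ cw; apply: (@continuous_comp _ _ _ w Q) => //; exact: cQ. Qed.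

Definition chain_fun : 'rV[R]_m -> R := (fun z => P (u z - h z)) \_ (thick S (r + r)).
Definition chain_coef : 'rV[R]_m -> R := (fun z => P' (u z - h z)) \_ (thick S (r + r)).
Let An n := (fun z => P (fn n z)) \_ N.
Let Bn n := (fun z => P' (fn n z)) \_ N.

Lemma continuous_chain_fun : continuous chain_fun.
Proof.
apply: cut_continuous => [y Ny ny|z N1z]; first by rewrite P0//; exact: f_neg.
by apply: comp_cont => //; apply: f_cont; exact: N1subN.
Qed.

Lemma continuous_chain_coef : continuous chain_coef.
Proof.
apply: cut_continuous => [y Ny ny|z N1z]; first by rewrite P'0//; exact: f_neg.
by apply: comp_cont => //; apply: f_cont; exact: N1subN.
Qed.

Let An_cont n : continuous (An n).
Proof.
apply: cut_continuous => [y Ny ny|z N1z]; first by rewrite P0//; exact: fn_neg.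
by apply: comp_cont => //; exact: fn_cont.
Qed.

Let Bn_cont n : continuous (Bn n).
Proof.
apply: cut_continuous => [y Ny ny|z N1z]; first by rewrite P'0//; exact: fn_neg.
by apply: comp_cont => //; exact: fn_cont.
Qed.

Let gK i : 'rV[R]_m -> R := (fun s => g s 0 i) \_ K.
Let gK_int i : mu.-integrable setT (EFin \o gK i) := weak_patch_grad_integrable wg cK rO i.
Let gn i n := convol (gK i) (moll (d n)).

(** Near a point of [N1] the cut-off is invisible and the ordinary chain rule applies; near any
    other point the function is identically 0, and so is the claimed derivative. *)
Let An_derive n i z : is_derive z (delta_mx 0 i) (An n) (Bn n z * (gn i n z - dh i z)).
Proof.
have [N1z|nz] := pselect (N1 z); last first.
  have nP y : N y -> ~ N1 y -> P (fn n y) = 0 by move=> Ny ny; rewrite P0//; exact: fn_neg.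
  have nP' y : N y -> ~ N1 y -> P' (fn n y) = 0 by move=> Ny ny; rewrite P'0//; exact: fn_neg.
  have -> : Bn n z = 0 by exact: nbhs_singleton (near_out nP' nz).
  rewrite mul0r; apply: (near_eq_is_derive (f := cst 0)).
  by apply: filterS (near_out nP nz) => y e; exact/esym.
have Nz := N1subN N1z.
have -> : Bn n z = P' (fn n z) by rewrite /Bn patchE mem_set.
apply: (near_eq_is_derive (f := fun z => P (fn n z))).
  by apply: filterS (near_cut (fun z => P (fn n z)) N1z) => y e; exact/esym.
apply: is_derive_comp1; apply: is_deriveB.
apply: is_derive_eq.
  apply: (is_derive_convol_weak wg) => //.
  by move=> s sz; apply: (NrK Nz); exact: le_trans sz (dr n).
rewrite /gn /gK; congr convol; apply/funext => s; rewrite !patchE; case: ifP => // _.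
rewrite /dot (bigD1 i)//= mxE !eqxx mul1r big1 ?addr0// => j ji.
by rewrite mxE eqxx/= (negbTE ji) mul0r.
Qed.

Let bounded_of_cont (w : 'rV[R]_m -> R) : (forall z, N z -> {for z, continuous w}) ->
  exists2 M : R, 0 <= M & forall z, N z -> `|w z| <= M.
Proof.
move=> cw; apply: continuous_bounded_on => //.
by apply: continuous_in_subspaceT => z /set_mem; exact: cw.
Qed.

Let comp_bounded (Q : R -> R) : continuous Q ->
  exists2 M : R, 0 <= M & (forall n z, `|((fun z => Q (fn n z)) \_ N) z| <= M) /\
    (forall z, `|((fun z => Q (f z)) \_ N) z| <= M).
Proof.
move=> cQ; have [M M0 hM] := bounded_of_cont f_cont.
have cI : compact `[- (M + c), M + c]%classic := segment_compact (a := - (M + c)) (b := M + c).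
have [B [_ hB]] := compact_bounded (continuous_compact (continuous_subspaceT cQ) cI).
have QB (s : R) : `|s| <= M + c -> `|Q s| <= `|B| + 1.
  move=> sM; apply: (hB (`|B| + 1)); first by rewrite ltr_pwDr// ler_norm.
  by exists s => //=; rewrite in_itv/= -ler_norml.
have B0 : 0 <= `|B| + 1 by rewrite addr_ge0.
exists (`|B| + 1) => //; split => [n z|z]; rewrite patchE; case: ifPn => [/set_mem Nz|_];
  rewrite ?normr0//; apply: QB.
  rewrite -[fn n z](subrK (f z)).
  by apply: le_trans (ler_normD _ _) _; rewrite addrC lerD// ?hM// fn_near.
by apply: le_trans (hM _ Nz) _; rewrite lerDl ltW.
Qed.

Let comp_cvg (Q : R -> R) z : continuous Q ->
  ((fun z => Q (fn n z)) \_ N) z @[n --> \oo] --> ((fun z => Q (f z)) \_ N) z.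
Proof.
move=> cQ; rewrite [X in _ --> X]patchE; case: ifPn => [/set_mem Nz|zN]; last first.
  rewrite (_ : (fun n => _) = fun=> 0); first exact: cvg_cst.
  by apply/funext => n; rewrite patchE (negbTE zN).
rewrite (_ : (fun n => _) = (fun n => Q (fn n z))); last first.
  by apply/funext => n; rewrite patchE mem_set.
apply: continuous_cvg; first exact: cQ.
by apply: cvgB; [exact: un_cvg|exact: cvg_cst].
Qed.

Let a := chain_fun.
Let b := chain_coef.

Let patch_eq0 (w : 'rV[R]_m -> R) z : ~ N z -> (w \_ N) z = 0.
Proof. by move=> nz; rewrite patchE memNset. Qed.

Let cont_int (w psi : 'rV[R]_m -> R) : continuous w -> continuous psi -> (forall z, ~ N z -> w z = 0) ->
  mu.-integrable setT (EFin \o (fun z => w z * psi z)).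
Proof.
move=> cw cpsi w0.
have [M M0 hM] := continuous_bounded_on cN (continuous_subspaceT (continuous_mul cw cpsi)).
apply: (bounded_support_integrable (M := M) cN).
- exact: continuous_measurable_rV (continuous_mul cw cpsi).
- move=> z; have [/hM//|/w0 ->] := pselect (N z); by rewrite mul0r normr0.
- by move=> z /w0 ->; rewrite mul0r.
Qed.

Let gn_cont i n : continuous (gn i n).
Proof. exact: continuous_conv. Qed.

Let gn_le i n z : N z -> `|gn i n z| <= 1.
Proof.
move=> Nz; rewrite -[gn i n z]subr0; apply: conv_moll_near => //.
apply: filterS g1 => s gs sz.
have Ks : K s by apply: (NrK Nz); exact: le_trans (ltW sz) (dr n).
rewrite subr0 /gK patchE mem_set//; apply: le_trans (coord_le_enorm _ _) _.
by apply: gs; exact: rO.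
Qed.

(** The product [An n * psi] is supported in [N], and the integral of its partial derivative
    vanishes. *)
Let approx_parts i n psi : test_function Omega psi ->
  \int[mu]_z (An n z * partial i psi z) = - \int[mu]_z ((Bn n z * psi z) * (gn i n z - dh i z)).
Proof.
move=> tpsi; have cpsi : continuous psi := (tpsi.1 [::]).1.
have cdpsi : continuous (partial i psi) := (tpsi.1 [:: i]).1.
have cG : continuous (fun z => gn i n z - dh i z).
  exact: continuous_sub.
have cF : continuous (fun z => An n z * psi z) by exact: continuous_mul.
pose dF z := An n z * partial i psi z + psi z * (Bn n z * (gn i n z - dh i z)).
have cdF : continuous dF.
  apply: continuous_add; first exact: continuous_mul.
  by apply: continuous_mul => //; exact: continuous_mul.
have dF0 z : ~ N z -> dF z = 0.
  by move=> nz; rewrite /dF /An /Bn !patch_eq0// !mul0r mulr0 addr0.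
have [M M0 hM] := continuous_bounded_on cN (continuous_subspaceT cdF).
have e0 : \int[mu]_z dF z = 0.
  apply: (@integral_partial_eq0 _ _ N (fun z => An n z * psi z) dF i M) => //.
  - by move=> z nz; rewrite /An patch_eq0// mul0r.
  - by move=> z; exact: (is_deriveM (An_derive n i z) (test_function_derive i z tpsi)).
  - move=> z; have [/hM//|/dF0 ->] := pselect (N z); by rewrite normr0.
have i1 : mu.-integrable setT (EFin \o (fun z => An n z * partial i psi z)).
  by apply: cont_int => // z nz; rewrite /An patch_eq0.
have i2 : mu.-integrable setT (EFin \o (fun z => (Bn n z * psi z) * (gn i n z - dh i z))).
  by apply: cont_int => //; [exact: continuous_mul|move=> z nz; rewrite /Bn patch_eq0// mul0r].
apply/eqP; rewrite -addr_eq0 -RintegralD//; apply/eqP; rewrite -[RHS]e0.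
by apply: eq_Rintegral => z _; rewrite /dF; congr (_ + _); rewrite mulrA [psi z * _]mulrC.
Qed.

(** The coefficients [An] and [Bn] converge pointwise and boundedly, but of the mollified gradients
    only the bound by 1 on [N] is at hand. Hence the product with [Bn] is split into a product with
    [Bn - b], where this bound suffices, and one with the fixed continuous factor [b], where the
    mollifier changes sides. *)
Let limit_parts i psi : test_function Omega psi ->
  \int[mu]_z (a z * partial i psi z) =
  - (\int[mu]_z ((b z * psi z) * gK i z) - \int[mu]_z ((b z * psi z) * dh i z)).
Proof.
move=> tpsi; have cpsi : continuous psi := (tpsi.1 [::]).1.
have cdpsi : continuous (partial i psi) := (tpsi.1 [:: i]).1.
have [MA MA0 [hMA _]] := comp_bounded cP.
have [MB MB0 [hMB bMB]] := comp_bounded cP'.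
have cb := continuous_chain_coef.
have Bpsi0 n z : ~ N z -> Bn n z * psi z = 0 by move=> nz; rewrite /Bn patch_eq0// mul0r.
have bpsi0 z : ~ N z -> b z * psi z = 0 by move=> nz; rewrite /b /chain_coef patch_eq0// mul0r.
have cBpsi n : continuous (fun z => Bn n z * psi z) by exact: continuous_mul.
have cbpsi : continuous (fun z => b z * psi z) by exact: continuous_mul.
have intN (w : 'rV[R]_m -> R) : continuous w -> mu.-integrable setT (EFin \o (\1_N \* (fun z => `|w z|))).
  move=> cw; apply/(integrable_support (K := N)) => //.
    by move=> z nz /=; rewrite indicE memNset// mul0r.
  have [M M0 hM] := continuous_bounded_on cN (continuous_subspaceT cw).
  apply: (@compact_integrable _ _ _ _ M) => //.
    apply: measurable_funTS; apply: measurable_funM; first exact: measurable_indic.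
    by apply: measurableT_comp => //; exact: continuous_measurable_rV.
  by move=> z Nz; rewrite /= indicE mem_set// mul1r normr_id hM.
have lim1 : \int[mu]_z (An n z * partial i psi z) @[n --> \oo] --> \int[mu]_z (a z * partial i psi z).
  apply: (dominated_Rintegral measurableT (g := fun z => MA * (\1_N z * `|partial i psi z|))) => [n|||z _].
  - by apply: continuous_measurable_rV; exact: continuous_mul.
  - exact: (integrableZl measurableT MA (intN _ cdpsi)).
  - move=> n z _; rewrite indicE; have [zN|/negP zN] := boolP (z \in N).
      by rewrite mul1r normrM ler_wpM2r// hMA.
    by rewrite /An patch_eq0 ?mul0r ?normr0 ?mulr0//; move=> /mem_set.
  - by apply: cvgM; [exact: comp_cvg|exact: cvg_cst].
have lim2 : \int[mu]_z ((Bn n z * psi z) * dh i z) @[n --> \oo] --> \int[mu]_z ((b z * psi z) * dh i z).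
  apply: (dominated_Rintegral measurableT (g := fun z => MB * (\1_N z * `|psi z * dh i z|))) => [n|||z _].
  - by apply: continuous_measurable_rV; exact: continuous_mul.
  - by apply: (integrableZl measurableT MB (intN _ _)); exact: continuous_mul.
  - move=> n z _; rewrite indicE; have [zN|/negP zN] := boolP (z \in N).
      by rewrite mul1r -mulrA normrM ler_wpM2r// hMB.
    by rewrite Bpsi0 ?mul0r ?normr0 ?mulr0//; move=> /mem_set.
  - by apply: cvgM; [apply: cvgM; [exact: comp_cvg|exact: cvg_cst]|exact: cvg_cst].
(* Dominated convergence: the first factor tends to 0 and the second is bounded by 1 on [N]. *)
have lim3 : \int[mu]_z ((Bn n z * psi z - b z * psi z) * gn i n z) @[n --> \oo] --> (0 : R).
  rewrite -[X in _ --> X](_ : \int[mu]_z (0 : R) = 0); last by rewrite Rintegral_cst// mul0r.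
  apply: (dominated_Rintegral measurableT (g := fun z => (MB + MB) * (\1_N z * `|psi z|))) => [n|||z _].
  - apply: continuous_measurable_rV; apply: continuous_mul => //.
    exact: continuous_sub.
  - exact: (integrableZl measurableT (MB + MB) (intN _ cpsi)).
  - move=> n z _; rewrite indicE; have [zN|/negP zN] := boolP (z \in N); last first.
      by rewrite Bpsi0 ?bpsi0 ?subrr ?mul0r ?normr0 ?mulr0// => /mem_set.
    rewrite mul1r normrM -[leRHS]mulr1; apply: ler_pM => //; last exact/gn_le/set_mem.
    rewrite -mulrBl normrM ler_wpM2r//.
    by apply: le_trans (ler_normB _ _) _; rewrite lerD// hMB.
  - have [Nz|nz] := pselect (N z); last first.
      rewrite (_ : (fun n => _) = fun=> 0); first exact: cvg_cst.
      by apply/funext => n; rewrite Bpsi0// bpsi0// subrr mul0r.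
    apply: norm_cvg0.
    apply: (@squeeze_cvgr _ _ _ _ (fun=> 0) (fun n => `|Bn n z * psi z - b z * psi z|)).
    + by apply: nearW => n; rewrite normr_ge0/= normrM ler_piMr// gn_le.
    + exact: cvg_cst.
    + rewrite -[X in _ --> X](@normr0 _ R); apply: cvg_norm.
      rewrite -[X in _ --> X](subrr (b z * psi z)); apply: cvgB; last exact: cvg_cst.
      by apply: cvgM; [exact: comp_cvg|exact: cvg_cst].
have bpsi_int : mu.-integrable setT (EFin \o (fun z => b z * psi z)).
  by apply: cont_int => // z nz; rewrite /b /chain_coef patch_eq0.
have [Mp Mp0 hMp] := continuous_bounded_on cN (continuous_subspaceT cbpsi).
have bpsiM z : `|b z * psi z| <= Mp.
  by have [/hMp//|/bpsi0 ->] := pselect (N z); rewrite normr0.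
(* By [conv_swap] the mollifier falls on the continuous function [b * psi], which converges
   pointwise and within the bound [Mp], against the fixed integrable [gK i]. *)
have lim4 : \int[mu]_z ((b z * psi z) * gn i n z) @[n --> \oo] --> \int[mu]_z ((b z * psi z) * gK i z).
  rewrite (_ : (fun n => _) = (fun n => \int[mu]_s (convol (fun z => b z * psi z) (moll (d n)) s * gK i s))); last first.
    by apply/funext => n; rewrite conv_swap.
  apply: (dominated_Rintegral measurableT (g := fun z => Mp * `|gK i z|)) => [n|||z _].
  - apply: measurable_funM; first by apply: continuous_measurable_rV; exact: continuous_conv.
    by apply/measurable_EFinP; exact: measurable_int (gK_int i).
  - have nK : mu.-integrable setT (EFin \o (fun z => `|gK i z|)) by exact: integrable_norm (gK_int i).
    exact: (integrableZl measurableT Mp nK).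
  - move=> n z _; rewrite normrM ler_wpM2r//.
    rewrite -[X in `|X|]subr0; apply: conv_moll_near => //.
    by apply: aeW => s _; rewrite subr0.
  - apply: cvgM; last exact: cvg_cst.
    apply/cvgrPdist_le => e e0.
    have hc : {within setT, continuous (fun z => b z * psi z)} by apply: continuous_subspaceT.
    have [dl dl0 hdl] := within_continuous_dist openT hc (I : setT z) e0.
    have : \forall n \near \oo, d n < dl by move/cvgrPdist_lt : d_cvg => /(_ _ dl0); apply: filterS => n; rewrite sub0r normrN ger0_norm// ltW.
    apply: filterS => n dn; rewrite distrC; apply: conv_moll_near => //.
    by apply: aeW => s sz; apply: (hdl s _).2; exact: lt_trans dn.
have gn_int n (w : 'rV[R]_m -> R) : continuous w -> (forall z, ~ N z -> w z = 0) ->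
   mu.-integrable setT (EFin \o (fun z => w z * gn i n z)) by move=> cw w0; apply: cont_int.
have dh_int (w : 'rV[R]_m -> R) : continuous w -> (forall z, ~ N z -> w z = 0) ->
   mu.-integrable setT (EFin \o (fun z => w z * dh i z)) by move=> cw w0; apply: cont_int.
apply: (cvg_unique _ lim1) => //.
rewrite (_ : (fun n => _) = (fun n => - ((\int[mu]_z ((Bn n z * psi z - b z * psi z) * gn i n z) +
   \int[mu]_z ((b z * psi z) * gn i n z)) - \int[mu]_z ((Bn n z * psi z) * dh i z)))); last first.
  apply/funext => n; rewrite approx_parts//; congr (- _).
  rewrite -RintegralD//; last 2 first.
  - apply: gn_int => [|z nz]; last by rewrite Bpsi0// bpsi0// subrr.
    exact: continuous_sub.
  - exact: gn_int.
  rewrite -RintegralB//; last 2 first.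
  - rewrite (_ : EFin \o _ = EFin \o (fun z => (Bn n z * psi z) * gn i n z)); first by apply: gn_int => // z /Bpsi0.
    by apply/funext => z /=; rewrite -mulrDl subrK.
  - by apply: dh_int => // z /Bpsi0.
  by apply: eq_Rintegral => z _; rewrite -mulrDl subrK mulrBr.
apply: cvgN; apply: cvgB => //; rewrite -[X in _ --> X]add0r; exact: cvgD.
Qed.

(** All integrands vanish off [N], so the identity of [limit_parts] on the whole space can be read
    on [Omega]; [gK] agrees with [g] wherever the coefficient is nonzero. *)
Lemma weak_gradient_chain : weak_gradient Omega chain_fun
  (fun z => chain_coef z *: (g z - \row_i dh i z)).
Proof.
have [lu lg _] := wg; have mO := open_measurable_rV oO.
have G_int (B : set 'rV[R]_m) i : measurable B -> mu.-integrable B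
    (EFin \o (fun z => chain_coef z * (gK i z - dh i z))).
  move=> mB; apply: integrableS (_ : mu.-integrable setT _) => //.
  have [M M0 hM] := continuous_bounded_on cN (continuous_subspaceT continuous_chain_coef).
  have hM' : exists M : R, forall z, setT z -> `|chain_coef z| <= M.
    exists M => z _; have [/hM//|nz] := pselect (N z); by rewrite /chain_coef patch_eq0// normr0.
  rewrite (_ : EFin \o _ = (fun z => (gK i z * chain_coef z)%:E - (chain_coef z * dh i z)%:E)%E); last first.
    by apply/funext => z /=; rewrite mulrBr EFinB mulrC.
  apply: integrableB => //.
    apply: integrable_mul_bounded => //.
    by apply: continuous_measurable_rV; exact: continuous_chain_coef.
  apply: cont_int => //; first exact: continuous_chain_coef.
  by move=> z nz; rewrite /chain_coef patch_eq0.
have Ge z i : (chain_coef z *: (g z - \row_i0 dh i0 z)) 0 i = chain_coef z * (gK i z - dh i z).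
  rewrite !mxE; have [Nz|nz] := pselect (N z); last by rewrite /chain_coef patch_eq0// !mul0r.
  by rewrite /gK patchE mem_set//; exact: NK.
split.
- move=> B cB BO; have mB := compact_measurable_rV cB.
  have [M M0 hM] := continuous_bounded_on cB (continuous_subspaceT continuous_chain_fun).
  apply: (@compact_integrable _ _ _ _ M) => //.
  by apply: measurable_funTS; apply: continuous_measurable_rV; exact: continuous_chain_fun.
- move=> i B cB BO; have mB := compact_measurable_rV cB.
  by under eq_fun do rewrite Ge; exact: G_int.
move=> psi i tpsi; have cpsi : continuous psi := (tpsi.1 [::]).1.
have cdpsi : continuous (partial i psi) := (tpsi.1 [:: i]).1.
have [Mp _ hMp] := test_function_bounded tpsi.
have toT (w : 'rV[R]_m -> R) : mu.-integrable setT (EFin \o w) -> (forall z, ~ N z -> w z = 0) ->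
    (\int[mu]_(z in Omega) (w z)%:E = (\int[mu]_z w z)%:E)%E.
  move=> wi w0; rewrite (integral_support NO w0) /Rintegral.
  rewrite (@integral_support _ _ N setT)// fineK// -(@integral_support _ _ N setT)//.
  exact: integrable_fin_num.
rewrite toT; last 2 first.
- by apply: cont_int => //; [exact: continuous_chain_fun|move=> z nz; rewrite /chain_fun patch_eq0].
- by move=> z nz; rewrite /chain_fun patch_eq0// mul0r.
under [in RHS]eq_integral do rewrite Ge.
have Gpsi : mu.-integrable setT (EFin \o (fun z => chain_coef z * (gK i z - dh i z) * psi z)).
  apply: integrable_mul_bounded => //; first exact: G_int.
    exact: continuous_measurable_rV.
  by exists Mp => z _; exact: hMp.
rewrite toT//; last by move=> z nz; rewrite /chain_coef patch_eq0// !mul0r.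
rewrite -EFinN limit_parts//; congr (- _)%:E.
have i1 : mu.-integrable setT (EFin \o (fun z => (b z * psi z) * gK i z)).
  rewrite (_ : EFin \o _ = EFin \o (fun z => gK i z * (b z * psi z))); last first.
    by apply/funext => z /=; rewrite mulrC.
  have cbp := continuous_mul continuous_chain_coef cpsi.
  apply: integrable_mul_bounded => //; first exact: continuous_measurable_rV.
  have [M M0 hM] := continuous_bounded_on cN (continuous_subspaceT cbp).
  exists M => z _; have [/hM//|nz] := pselect (N z).
  by rewrite /b /chain_coef patch_eq0// mul0r normr0.
have i2 : mu.-integrable setT (EFin \o (fun z => (b z * psi z) * dh i z)).
  apply: cont_int => //; first exact: continuous_mul continuous_chain_coef cpsi.
  by move=> z nz; rewrite /b /chain_coef patch_eq0// mul0r.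
rewrite -RintegralB//; apply: eq_Rintegral => z _.
by rewrite /b -mulrBr mulrAC.
Qed.

End ChainRule.

(** * The competitor *)

Section SmoothedCone.
Context {R : realType} {m : nat}.
Implicit Types (y z : 'rV[R]_m).
Variables (d : R) (d0 : 0 < d).

(* A smooth substitute for [enorm (z - y)]. *)
Definition cone y z : R := Num.sqrt (d ^+ 2 + dot (z - y) (z - y)).
Definition cone_grad y z : 'rV[R]_m := (cone y z)^-1 *: (z - y).

Let pos y z : 0 < d ^+ 2 + dot (z - y) (z - y).
Proof. by rewrite ltr_wpDr ?dot_ge0// exprn_gt0. Qed.

Lemma cone_gt0 y z : 0 < cone y z.
Proof. by rewrite sqrtr_gt0. Qed.

Lemma enorm_le_cone y z : enorm (z - y) <= cone y z.
Proof. by apply: ler_wsqrtr; rewrite lerDr sqr_ge0. Qed.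

Lemma cone_center y : cone y y = d.
Proof.
rewrite /cone subrr; have -> : dot (0 : 'rV[R]_m) 0 = 0 by apply/eqP; rewrite dot_eq0.
by rewrite addr0 sqrtr_sqr gtr0_norm.
Qed.

Lemma is_derive_cone y i z : is_derive z (delta_mx 0 i) (cone y) (cone_grad y z 0 i).
Proof.
have hq : is_derive z (delta_mx 0 i) (fun z => d ^+ 2 + dot (z - y) (z - y)) (2 * (z - y) 0 i).
  apply/is_derive_line; set b := (z - y) 0 i.
  apply: (is_derive_ext (f := fun h : R => (d ^+ 2 + dot (z - y) (z - y)) + (2 * b) * h + h ^+ 2)).
    move=> h; rewrite -!addrA; congr (_ + _).
    rewrite /b addrA; move: (z - y) => {b}w.
    rewrite dotDl !dotDr !(dotZl, dotZr) (dotC w (delta_mx _ _)).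
    have e1 (x : 'rV[R]_m) : dot (delta_mx 0 i) x = x 0 i.
      rewrite /dot (bigD1 i)//= mxE !eqxx mul1r big1 ?addr0// => j ji.
      by rewrite mxE eqxx/= (negbTE ji) mul0r.
    by rewrite !e1 mxE !eqxx mulr1; ring.
  have h1 := is_derive_exprn 2 (0 : R).
  have h2 := is_derive_affine (d ^+ 2 + dot (z - y) (z - y)) (2 * b) (is_derive_id (0 : R) 1).
  apply: is_derive_eq (is_deriveD h2 h1) _.
  by rewrite expr1 mulr0 addr0; exact: mulr1.
have H := is_derive_comp1 (f := fun z => d ^+ 2 + dot (z - y) (z - y)) (is_derive1_sqrt (pos y z)) hq.
have -> : cone_grad y z 0 i = (2 * cone y z)^-1 * (2 * (z - y) 0 i).
  by rewrite [LHS]mxE invfM mulrACA mulVf ?mul1r ?pnatr_eq0.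
exact: H.
Qed.

Lemma enorm_cone_grad y z : enorm (cone_grad y z) <= 1.
Proof.
rewrite enormZ gtr0_norm ?invr_gt0 ?cone_gt0// ler_pdivrMl ?cone_gt0// mulr1.
exact: enorm_le_cone.
Qed.

Lemma continuous_cone y : continuous (cone y).
Proof.
apply: (@lipschitz_continuous_rV _ _ _ (m%:R * 1)).
apply: (lipschitz_of_bounded_partials (is_derive_cone y)) => i z.
exact: le_trans (coord_le_enorm _ _) (enorm_cone_grad y z).
Qed.

Lemma lipschitz_cone y z z' : `|cone y z' - cone y z| <= m%:R * `|z' - z|.
Proof.
rewrite -[m%:R]mulr1; apply: (lipschitz_of_bounded_partials (is_derive_cone y)) => i s.
exact: le_trans (coord_le_enorm _ _) (enorm_cone_grad y s).
Qed.

Lemma continuous_cone_grad y i : continuous (fun z => cone_grad y z 0 i).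
Proof.
rewrite (_ : (fun z => _) = (fun z => (cone y z)^-1 * (- y 0 i + 1 * z 0 i))); last first.
  by apply/funext => z; rewrite !mxE mul1r addrC.
apply: continuous_mul; last exact: continuous_affine_coord.
move=> z; apply: (@continuous_comp _ _ _ (cone y) (fun s => s^-1)); first exact: continuous_cone.
by apply: inv_continuous; rewrite gt_eqF// cone_gt0.
Qed.

End SmoothedCone.

Section WeakGradientLinear.
Context {R : realType} {m : nat}.
Local Notation mu := (lebesgue_rV R m).
Implicit Types (Omega : set 'rV[R]_m).

Lemma weak_gradient0 Omega : weak_gradient Omega (fun=> 0 : R) (fun=> 0).
Proof.
have i0 K : mu.-integrable K (fun=> 0%E) by exact: integrable0.
split => [K _ _|i K _ _|eta i _]; first exact: i0.
  by under eq_fun do rewrite mxE; exact: i0.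
under eq_integral do rewrite mul0r; under [in RHS]eq_integral do rewrite mxE mul0r.
by rewrite integral0 oppe0.
Qed.

Lemma locally_integrable_lin Omega (c : R) (f f' : 'rV[R]_m -> R) :
  locally_integrable_on Omega (EFin \o f) -> locally_integrable_on Omega (EFin \o f') ->
  locally_integrable_on Omega (EFin \o (fun z => c * f z + f' z)).
Proof.
move=> lf lf' K cK KO; have mK := compact_measurable_rV cK.
rewrite (_ : EFin \o _ = (fun z => c%:E * (f z)%:E + (f' z)%:E)%E); last by apply/funext.
by apply: integrableD => //; [apply: integrableZl => //; exact: lf|exact: lf'].
Qed.

Lemma weak_gradient_lin Omega (c : R) v v' g g' : open Omega ->
  weak_gradient Omega v g -> weak_gradient Omega v' g' ->
  weak_gradient Omega (fun z => c * v z + v' z) (fun z => c *: g z + g' z).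
Proof.
move=> oO [lv lg h] [lv' lg' h']; have mO := open_measurable_rV oO.
split => [|i|eta i teta]; first exact: locally_integrable_lin.
  rewrite (_ : (fun z => _) = EFin \o (fun z => c * g z 0 i + g' z 0 i)); last first.
    by apply/funext => z; rewrite /= !mxE.
  exact: (@locally_integrable_lin Omega c (fun z => g z 0 i) (fun z => g' z 0 i) (lg i) (lg' i)).
have [ceta cdeta] := ((teta.1 [::]).1, (teta.1 [:: i]).1).
have teta' := test_function_partial i teta.
have i1 := integrable_test mO lv cdeta teta'.2.
have i2 := integrable_test mO lv' cdeta teta'.2.
have i3 := integrable_test mO (lg i) ceta teta.2.
have i4 := integrable_test mO (lg' i) ceta teta.2.
have hR := congr1 fine (h eta i teta); have hR' := congr1 fine (h' eta i teta).
rewrite (eq_integral (fun z => c%:E * (v z * partial i eta z)%:E + (v' z * partial i eta z)%:E)%E); last first.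
  by move=> z _; rewrite -EFinM -EFinD mulrDl mulrA.
rewrite [in RHS](eq_integral (fun z => c%:E * (g z 0 i * eta z)%:E + (g' z 0 i * eta z)%:E)%E); last first.
  by move=> z _; rewrite -EFinM -EFinD !mxE mulrDl mulrA.
rewrite integralD//; last exact: integrableZl.
rewrite integralD//; last exact: integrableZl.
rewrite !integralZl// h// h'// muleN oppeD// ?oppeK//.
by rewrite fin_num_adde_defl// (integrable_fin_num mO i4).
Qed.

End WeakGradientLinear.

(* Then [g + t D eta] is a convex combination of [g] and [b] for [0 <= t <= 1]. *)
Definition decreasing_variation {R : realType} {m : nat} (Omega : set 'rV[R]_m)
    (g : 'rV[R]_m -> 'rV[R]_m) (x y : 'rV[R]_m) :=
  exists (eta a : 'rV[R]_m -> R) (b : 'rV[R]_m -> 'rV[R]_m) (L : R) (K : set 'rV[R]_m),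
    [/\ [/\ compact K, K `<=` Omega, forall z, ~ K z -> eta z = 0 & forall z, ~ K z -> a z = 0],
        [/\ continuous eta, forall z z', `|eta z' - eta z| <= L * `|z' - z| &
            weak_gradient Omega eta (fun z => a z *: (g z - b z))],
        [/\ continuous a, forall i, continuous (fun z => b z 0 i),
            forall z, -1 <= a z <= 0 & forall z, enorm (b z) <= 1]
      & eta y - eta x < 0].

Section Competitor.
Context {R : realType} {m : nat}.
Local Notation mu := (lebesgue_rV R m).
Implicit Types (x y z w : 'rV[R]_m).

(** The point at parameter [t] is compared with [y + (t * a) *: w]: the error is a convex
    combination of two vectors of size at most [rho]. For [tau = 0] this says that the neighbourhood
    is star-shaped about [y]; for [tau > 0] the star centre moves back along the light segment. *)
Lemma thick_segment (y w : 'rV[R]_m) (T rho tau t : R) z : 0 <= T -> 0 <= tau -> tau * enorm w <= rho ->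
  thick [set s | exists2 t : R, 0 <= t <= T & s = y + t *: w] rho z -> 0 <= t <= 1 ->
  thick [set s | exists2 t : R, 0 <= t <= T & s = y + t *: w] rho
    ((y - tau *: w) + t *: (z - (y - tau *: w))).
Proof.
move=> T0 tau0 taur [_ [a /andP[a0 aT] ->] za] /andP[t0 t1].
exists (y + (t * a) *: w).
  by exists (t * a) => //; rewrite mulr_ge0//= (le_trans _ aT)// ler_piMl.
rewrite (_ : _ - _ = t *: (z - (y + a *: w)) - (1 - t) *: (tau *: w)); last first.
  apply/rowP => i; rewrite !mxE; ring.
apply: le_trans (ler_normB _ _) _; rewrite !normrZ (ger0_norm t0) (ger0_norm tau0).
rewrite [`|1 - t|]ger0_norm ?subr_ge0//.
have h1 : t * `|z - (y + a *: w)| <= t * rho by rewrite ler_wpM2l.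
have h2 : tau * `|w| <= rho by apply: le_trans taur; rewrite ler_wpM2l// norm_le_enorm.
have h3 : (1 - t) * (tau * `|w|) <= (1 - t) * rho by rewrite ler_wpM2l// subr_ge0.
by apply: le_trans (lerD h1 h3) _; rewrite -mulrDl addrC subrK mul1r.
Qed.

Variables (Omega : set 'rV[R]_m) (u : 'rV[R]_m -> R) (g : 'rV[R]_m -> 'rV[R]_m).
Hypotheses (oO : open Omega) (wg : weak_gradient Omega u g) (cu : {within Omega, continuous u}).
Hypothesis (g1 : {ae mu, forall s, Omega s -> enorm (g s) <= 1}).
Variables (x w : 'rV[R]_m) (T : R).
Let y := x + w.
Hypotheses (w0 : w != 0) (T0 : 0 <= T)
  (segO : forall t : R, 0 <= t <= 1 + T -> Omega (x + t *: w))
  (light : u y - u x = enorm w)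
  (maximal : forall t : R, T < t -> (forall s : R, 0 <= s <= t -> Omega (y + s *: w)) ->
     u (y + t *: w) - u y < t * enorm w).

Let S := [set s : 'rV[R]_m | exists2 t : R, 0 <= t <= T & s = y + t *: w].

Let cS : compact S.
Proof.
have [T00|Tn0] := eqVneq T 0.
  rewrite (_ : S = [set y]); first exact: compact_set1.
  apply/seteqP; split => [_ [t + ->]|_ ->].
    by rewrite T00 -eq_le => /eqP <-; rewrite scale0r addr0.
  by exists 0; rewrite ?T00 ?lexx// scale0r addr0.
rewrite (_ : S = [set z | exists2 t : R, 0 <= t <= 1 & z = y + t *: (T *: w)]); first exact: compact_segment.
have Tp : 0 < T by rewrite lt_def Tn0.
apply/seteqP; split => [_ [t /andP[t0 tT] ->]|_ [t /andP[t0 t1] ->]].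
  exists (t / T); first by rewrite divr_ge0// ler_pdivrMr// mul1r.
  by rewrite scalerA divfK.
exists (t * T); last by rewrite scalerA.
by rewrite mulr_ge0// ler_piMl.
Qed.

Let SO : S `<=` Omega.
Proof.
move=> _ [t /andP[t0 tT] ->]; rewrite /y -addrA -[w in _ + (w + _)]scale1r -scalerDl.
by apply: segO; rewrite addr_ge0//= lerD2l.
Qed.

Let yS : S y. Proof. by exists 0; rewrite ?lexx ?T0// scale0r addr0. Qed.

Let nw : 0 < enorm w. Proof. by rewrite enorm_gt0. Qed.

(* A light direction from [y] other than [w] would create a corner of a light
   broken line at [y], hence a shortcut contradicting the Lipschitz bound. *)
Let strict rho z : 0 < rho -> thick S rho `<=` Omega -> thick S rho z -> ~ S z ->
  u z - u y < enorm (z - y).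
Proof.
move=> rho0 rO Kz nSz.
have lip tau : 0 <= tau -> tau * enorm w <= rho -> u z - u (y - tau *: w) <= enorm (z - (y - tau *: w)).
  move=> tau0 taur; apply: (lipschitz_of_weak_gradient oO wg cu g1) => t t01.
  by apply: rO; exact: thick_segment.
have := lip 0 (lexx _); rewrite mul0r scale0r subr0 => /(_ (ltW rho0)).
rewrite le_eqVlt => /orP[/eqP zy|//]; exfalso.
(* [tau <= 1] keeps [y - tau *: w] on the segment from [x] to [y], and [tau * enorm w <= rho] keeps
   its segment to [z] inside the neighbourhood. *)
pose tau := Num.min 1 (rho / enorm w).
have tau0 : 0 < tau by rewrite lt_min ltr01 divr_gt0.
have tau1 : tau <= 1 by rewrite ge_min lexx.
have taur : tau * enorm w <= rho by rewrite -ler_pdivlMr// ge_min lexx orbT.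
have hx : u (y - tau *: w) - u x <= (1 - tau) * enorm w.
  have -> : (1 - tau) * enorm w = enorm ((y - tau *: w) - x).
    rewrite (_ : _ - x = (1 - tau) *: w); first by rewrite enormZ ger0_norm// subr_ge0.
    by apply/rowP => i; rewrite !mxE; ring.
  apply: (lipschitz_of_weak_gradient oO wg cu g1) => t /andP[t0 t1].
  rewrite (_ : _ + _ = x + (t * (1 - tau)) *: w); last by apply/rowP => i; rewrite !mxE; ring.
  apply: segO; rewrite mulr_ge0 ?subr_ge0//=.
  apply: (@le_trans _ _ 1); last by rewrite lerDl.
  by rewrite mulr_ile1 ?subr_ge0// lerBlDr lerDl ltW.
have hz := lip tau (ltW tau0) taur.
have e1 : z - (y - tau *: w) = (z - y) + tau *: w by apply/rowP => i; rewrite !mxE; ring.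
(* The values of [u] increase at full rate from [y - tau *: w] to [y] and from [y] to [z], so the
   Lipschitz bound on the direct segment forces equality in the triangle inequality and [z - y] is
   parallel to [w]. *)
have e2 : enorm ((z - y) + tau *: w) = enorm (z - y) + enorm (tau *: w).
  apply/eqP; rewrite eq_le enormD/= -e1; apply: le_trans hz.
  rewrite enormZ gtr0_norm// -zy.
  have : u y - u (y - tau *: w) >= tau * enorm w.
    move: hx light; move: (u y) (u x) (u (y - tau *: w)) (enorm w) => a b c n hx hl.
    by rewrite lerBrDr -lerBrDl; move: hx; rewrite mulrBl mul1r -hl; lra.
  move: (u y) (u z) (u (y - tau *: w)) (tau * enorm w) => a b c n; lra.
have := enormD_eq e2; rewrite enormZ gtr0_norm//.
set n := enorm (z - y); rewrite scalerA => e3.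
have e4 : z = y + (n / enorm w) *: w.
  have : (tau * enorm w)^-1 *: ((tau * enorm w) *: (z - y)) = (tau * enorm w)^-1 *: ((n * tau) *: w).
    by rewrite e3.
  rewrite scalerA mulVf ?scale1r; last by rewrite mulf_neq0// gt_eqF.
  move=> e5; rewrite -[LHS](subrK y) e5 addrC scalerA; congr (_ + _ *: _).
  by rewrite mulrC [tau * _]mulrC -mulf_div divff ?mulr1// gt_eqF.
have n0 : 0 <= n / enorm w by rewrite divr_ge0 ?enorm_ge0.
(* So [z] lies on the ray from [y]: up to [T] it belongs to [S], beyond [T] it contradicts
   [maximal]. *)
have [nT|Tn] := leP (n / enorm w) T.
  by apply: nSz; exists (n / enorm w) => //; rewrite n0.
have := maximal Tn; rewrite -e4 zy -/n divfK ?gt_eqF// ltxx => h; suff : false by []; apply: h.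
move=> s /andP[s0 sn]; apply: rO.
have := @thick_segment y w T rho 0 (s / (n / enorm w)) z T0 (lexx _).
rewrite mul0r scale0r subr0 => /(_ (ltW rho0) Kz).
have np : 0 < n / enorm w by apply: le_lt_trans T0 Tn.
rewrite divr_ge0//= ler_pdivrMr// mul1r sn => /(_ isT).
have e6 : z - y = (n / enorm w) *: w by rewrite [X in X - _]e4 addrC addKr.
by rewrite e6 scalerA divfK ?gt_eqF.
Qed.

Lemma competitor : decreasing_variation Omega g x y.
Proof.
have [rho rho0 rO'] := compact_margin cS oO SO.
(* The chain rule works with neighbourhoods of radii [r], [2 r] and [3 r], the last being the margin
   [rho]. *)
pose r := rho / 3; have r0 : 0 < r by rewrite divr_gt0.
have r3 : r + r + r = rho by rewrite /r; field.
have rO : thick S (r + r + r) `<=` Omega by rewrite r3.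
have cN : compact (thick S (r + r)) := @compact_thick _ _ S (r + r) cS.
have NK : thick S (r + r) `<=` thick S (r + r + r).
  by move=> z [s Ss zs]; exists s => //; apply: le_trans zs _; rewrite lerDl ltW.
have NO := subset_trans NK rO.
have N1N : thick S r `<=` thick S (r + r).
  by move=> z [s Ss zs]; exists s => //; apply: le_trans zs _; rewrite lerDl ltW.
have u_cont z : Omega z -> {for z, continuous u}.
  by move=> Oz; move: cu; rewrite continuous_open_subspace// => /(_ z (mem_set Oz)).
(* A compact set containing the shell between the neighbourhoods of radii [r] and [2 r]: open balls
   are removed, so that the strict inequality of [strict] becomes uniform by the extreme value
   theorem. *)
pose A := thick S (r + r) `&` ~` (\bigcup_(s in S) ball s r).
have cA : compact A.
  apply: (@subclosed_compact _ _ (thick S (r + r))) => //; last by move=> z [].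
  apply: closedI; first by apply: compact_closed => //; exact: norm_hausdorff.
  by apply: open_closedC; apply: bigcup_open => s _; exact: ball_open.
have AN z : thick S (r + r) z -> ~ thick S r z -> A z.
  move=> Nz nz; split => // -[s Ss]; rewrite -ball_normE/= => sz; apply: nz.
  by exists s => //; rewrite distrC ltW.
have nAS z : A z -> ~ S z.
  by move=> [_ h] Sz; apply: h; exists z => //; exact: ballxx.
have [e0 e00 he0] : exists2 e0 : R, 0 < e0 & forall z, A z -> u z - u y - enorm (z - y) <= - e0.
  have [A0|/set0P A0] := eqVneq A set0; first by exists 1 => // z; rewrite A0.
  pose F z := u z - u y - enorm (z - y).
  have cF : {within A, continuous F}.
    apply: continuous_in_subspaceT => z /set_mem [Nz _].
    have c1 : {for z, continuous (fun z => u z - u y)}.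
      exact: (continuousB (u_cont z (NO _ Nz)) (@cst_continuous _ _ (u y) z)).
    have c2 : continuous (fun z : 'rV[R]_m => enorm (z - y)).
      exact: (@continuous_translate _ _ _ y (@continuous_enorm R m)).
    exact: (continuousB c1 (c2 z)).
  have [zm /set_mem Am hm] := EVT_max_rV A0 cA cF.
  exists (- F zm); last by move=> z Az; rewrite opprK; apply: hm; exact: mem_set.
  rewrite oppr_gt0 subr_lt0; apply: (@strict (r + r)) => //; [by rewrite addr_gt0|exact: Am.1|exact: nAS].
(* The first bound gives u - h <= - e0 + 2 d <= - e0 / 2 on the shell; the second gives u(x) - h(x)
   <= 2 d - 2 |w| <= 0. At [y] the value is 2 d - d = d > 0. *)
pose d := Num.min (e0 / 4) (enorm w / 4).
have d0 : 0 < d by rewrite lt_min !divr_gt0.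
have de : d <= e0 / 4 by rewrite ge_min lexx.
have dw : d <= enorm w / 4 by rewrite ge_min lexx orbT.
pose h z := u y - 2 * d + cone d y z.
have ch : continuous h by apply: continuous_add; [exact: continuous_cst|exact: continuous_cone].
have hh i z : is_derive z (delta_mx 0 i) h (cone_grad d y z 0 i).
  by apply: is_derive_eq (is_deriveD (is_derive_cst (u y - 2 * d) z _) (is_derive_cone d0 y i z)) _; rewrite add0r.
(* As [flatexp 2 s <= 24 s^2], this gives [P' <= 1] up to [2 d]. *)
pose k := (24 * (2 * d) ^+ 2)^-1.
have k0 : 0 < k by rewrite invr_gt0 mulr_gt0// exprn_gt0// mulr_gt0.
pose P s := k * flatexp 0 s; pose P' s := k * flatexp 2 s.
have dP (s : R) : is_derive s 1 P (P' s).
  apply: is_derive_eq (is_deriveZ k (is_derive_flatexp 0 s)) _.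
  by rewrite oppr0 mul0r add0r.
have cP' : continuous P'.
  by move=> s; apply: cvgM; [exact: cvg_cst|exact: continuous_flatexp].
have fl0 n (s : R) : s <= 0 -> flatexp n s = 0 by move=> s0; rewrite /flatexp ltNge s0.
have P0 (s : R) : s <= 0 -> P s = 0 by move=> s0; rewrite /P fl0// mulr0.
have P'0 (s : R) : s <= 0 -> P' s = 0 by move=> s0; rewrite /P' fl0// mulr0.
have fneg z : thick S (r + r) z -> ~ thick S r z -> u z - h z <= - (e0 / 2).
  move=> Nz nz; have := he0 z (AN z Nz nz); have := enorm_le_cone d y z; rewrite /h.
  move: (u z) (u y) (enorm _) (cone _ _ _) => a b n c h1 h2; lra.
(* The Lipschitz bound from [y] confines the values of [u - h] to the range where [P'] is at most
   1. *)
have f2d z : thick S (r + r) z -> u z - h z <= 2 * d.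
  move=> Nz; have : u z - u y <= enorm (z - y).
    apply: (lipschitz_of_weak_gradient oO wg cu g1) => t t01; apply: rO.
    have := @thick_segment y w T (r + r + r) 0 t z T0 (lexx _).
    by rewrite mul0r scale0r subr0; apply => //; [rewrite !addr_ge0// ltW|exact: NK].
  have := enorm_le_cone d y z; rewrite /h.
  move: (u z) (u y) (enorm _) (cone _ _ _) => a b n c h1 h2; lra.
have P'1 (s : R) : s <= 2 * d -> 0 <= P' s <= 1.
  move=> sd; rewrite mulr_ge0 ?flatexp_ge0 ?(ltW k0)//=.
  have [s0|s0] := leP s 0; first by rewrite P'0.
  rewrite /P' /k; rewrite [X in X <= _]mulrC ler_pdivrMr; last by rewrite mulr_gt0// exprn_gt0// mulr_gt0.
  rewrite mul1r; apply: le_trans (flatexp_le_sqr 2 s) _.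
  by rewrite ler_wpM2l// ler_pXn2r// nnegrE ltW// mulr_gt0.
have e20 : 0 < e0 / 2 by rewrite divr_gt0.
have cdh i : continuous (fun z => cone_grad d y z 0 i) by exact: continuous_cone_grad.
have wc := weak_gradient_chain oO wg cu g1 cS r0 rO ch cdh hh dP cP' P0 P'0 e20 fneg.
have cfun := continuous_chain_fun oO cu cS r0 rO ch dP P0 e20 fneg.
have ccoef := continuous_chain_coef oO cu cS r0 rO ch cP' P'0 e20 fneg.
pose eta := chain_fun u S r h P; pose al := chain_coef u S r h P'.
have eta0 z : ~ thick S (r + r) z -> eta z = 0 by move=> nz; rewrite /eta /chain_fun patchE memNset.
have al0 z : ~ thick S (r + r) z -> al z = 0 by move=> nz; rewrite /al /chain_coef patchE memNset.
have eta01 z : ~ thick S r z -> eta z = 0.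
  move=> nz; have [Nz|] := pselect (thick S (r + r) z); last exact: eta0.
  rewrite /eta /chain_fun patchE mem_set// P0//; apply: le_trans (fneg z Nz nz) _.
  by rewrite oppr_le0 ltW.
have etaP z : thick S (r + r) z -> eta z = P (u z - h z).
  by move=> Nz; rewrite /eta /chain_fun patchE mem_set.
have P_lip (s1 s2 : R) : s1 <= s2 -> s2 <= 2 * d -> `|P s2 - P s1| <= `|s2 - s1|.
  move=> s12 s2d.
  have cP : {within `[s1, s2], continuous P}.
    by apply: continuous_subspaceT => t; apply/differentiable_continuous/derivable1_diffP; have [] := dP t.
  have [c] := @MVT_segment R P P' s1 s2 s12 (fun t _ => dP t) cP.
  rewrite in_itv/= => /andP[_ cs2] ->; rewrite normrM ler_piMl//.
  by have /andP[p0 p1] := P'1 c (le_trans cs2 s2d); rewrite ger0_norm.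
have {}P_lip (s1 s2 : R) : s1 <= 2 * d -> s2 <= 2 * d -> `|P s2 - P s1| <= `|s2 - s1|.
  move=> h1 h2; have [s12|s12] := leP s1 s2; first exact: P_lip.
  by rewrite distrC [leRHS]distrC; apply: P_lip => //; exact: ltW.
pose L1 : R := Num.sqrt m%:R + m%:R.
have loc z z' : thick S r z -> `|z' - z| <= r -> `|eta z' - eta z| <= L1 * `|z' - z|.
  move=> Nz zz; have Nz' : thick S (r + r) z' by exact: thickD Nz zz.
  rewrite !etaP//; last exact: N1N.
  apply: le_trans (P_lip _ _ (f2d z (N1N z Nz)) (f2d z' Nz')) _.
  rewrite (_ : _ - _ = (u z' - u z) - (cone d y z' - cone d y z)); last by rewrite /h; ring.
  apply: le_trans (ler_normB _ _) _; rewrite /L1 mulrDl lerD ?lipschitz_cone//.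
  exact: (weak_lipschitz_thick oO wg cu g1 rO (N1N z Nz) zz (lexx _)).
have [M M0 hM] := continuous_bounded_on cN (continuous_subspaceT cfun).
have etaM z : `|eta z| <= M.
  by have [/hM//|/eta0 ->] := pselect (thick S (r + r) z); rewrite normr0.
have L10 : 0 <= L1 by rewrite addr_ge0 ?sqrtr_ge0.
have Mr0 : 0 <= (M + M) / r by rewrite divr_ge0 ?addr_ge0// ltW.
(* Points within distance [r] are compared inside the neighbourhood of radius [2 r], unless both
   values are 0; for points further apart the bound [M] on |eta| is enough, at the price of the
   slope 2 M / r. *)
have lip z z' : `|eta z' - eta z| <= (L1 + (M + M) / r) * `|z' - z|.
  rewrite mulrDl; have [zr|rz] := leP `|z' - z| r.
    apply: (@le_trans _ _ (L1 * `|z' - z|)); last by rewrite lerDl mulr_ge0.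
    have [Nz|nz] := pselect (thick S r z); first exact: loc.
    have [Nz'|nz'] := pselect (thick S r z').
      by rewrite distrC [X in _ * X]distrC; apply: loc => //; rewrite distrC.
    by rewrite !eta01// subrr normr0 mulr_ge0.
  apply: (@le_trans _ _ ((M + M) / r * `|z' - z|)); last by rewrite lerDr mulr_ge0.
  apply: le_trans (ler_normB _ _) _; apply: le_trans (lerD (etaM _) (etaM _)) _.
  by rewrite -mulrA ler_peMr ?addr_ge0// ler_pdivlMl// mulr1 ltW.
exists (fun z => - eta z), (fun z => - al z), (cone_grad d y), (L1 + (M + M) / r), (thick S (r + r)).
split.
- by split => // z nz; rewrite ?eta0 ?al0 ?oppr0.
- split => [|z z'|].
  + by move=> z; apply: continuousN; exact: cfun.
  + by rewrite -opprD normrN; exact: lip.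
  + have := weak_gradient_lin (-1) oO wc (weak_gradient0 Omega).
    rewrite (_ : (fun z => -1 * _ + _) = (fun z => - eta z)); last by apply/funext => z; rewrite mulN1r addr0.
    rewrite (_ : (fun z => -1 *: _ + _) = (fun z => - al z *: (g z - cone_grad d y z)))//.
    apply/funext => z; rewrite addr0 scaleN1r scaleNr; congr (- (_ *: (_ - _))).
    by apply/rowP => i; rewrite mxE.
- split => [|//|z|z].
  + by move=> z; apply: continuousN; exact: ccoef.
  + rewrite lerN2 oppr_le0; have [Nz|/al0 ->] := pselect (thick S (r + r) z); last by rewrite ler01 lexx.
    by rewrite /al /chain_coef patchE mem_set// andbC; exact: P'1 (f2d z Nz).
  + exact: enorm_cone_grad.
- have Ny : thick S (r + r) y by exists y => //; rewrite subrr normr0 addr_ge0 ?ltW.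
  have -> : eta x = 0.
    have [Nx|/eta0//] := pselect (thick S (r + r) x).
    rewrite etaP// P0//; have := enorm_le_cone d y x.
    have -> : enorm (x - y) = enorm w by rewrite /y opprD addNKr enormN.
    rewrite /h; move: light dw; move: (u x) (u y) (cone _ _ _) (enorm w) => a b c n h1 h2 h3; lra.
  rewrite oppr0 subr0 etaP// oppr_lt0 /h cone_center// mulr_gt0// flatexp_gt0.
  by rewrite (_ : _ - _ = d) //; ring.
Qed.

End Competitor.

(** * Extending a light segment *)

Lemma weak_gradient_opp {R : realType} {m : nat} (Omega : set 'rV[R]_m) v g : open Omega ->
  weak_gradient Omega v g -> weak_gradient Omega (fun z => - v z) (fun z => - g z).
Proof.
move=> oO wg; have := weak_gradient_lin (-1) oO wg (weak_gradient0 Omega).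
under eq_fun do rewrite mulN1r addr0.
by under [X in weak_gradient _ _ X]eq_fun do rewrite scaleN1r addr0.
Qed.

Section LightLine.
Context {R : realType} {m : nat}.
Local Notation mu := (lebesgue_rV R m).
Implicit Types (x y z w : 'rV[R]_m) (Omega : set 'rV[R]_m).

(** [U] collects the parameters up to which the ray stays in [Omega] and is light. The alternatives
    are: sup U is finite and its point lies in [Omega], is finite and its point lies outside, or [U]
    is unbounded. *)
Lemma light_ray Omega (u : 'rV[R]_m -> R) y w :
  (forall z z', (forall t : R, 0 <= t <= 1 -> Omega (z + t *: (z' - z))) -> u z' - u z <= enorm (z' - z)) ->
  Omega y ->
  [\/ exists2 T : R, 0 <= T & (forall s : R, 0 <= s <= T -> Omega (y + s *: w)) /\
        (forall t : R, T < t -> (forall s : R, 0 <= s <= t -> Omega (y + s *: w)) ->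
          u (y + t *: w) - u y < t * enorm w),
      exists2 T : R, 0 < T & ~ Omega (y + T *: w) /\
        (forall s : R, 0 <= s < T -> Omega (y + s *: w) /\ u (y + s *: w) - u y = s * enorm w) |
      forall s : R, 0 <= s -> Omega (y + s *: w) /\ u (y + s *: w) - u y = s * enorm w].
Proof.
move=> lip Oy.
pose U := [set t : R | 0 <= t /\ forall s : R, 0 <= s <= t -> Omega (y + s *: w) /\ u (y + s *: w) - u y = s * enorm w].
have U0 : U 0.
  split => // s; rewrite -eq_le => /eqP <-.
  by rewrite scale0r addr0 subrr mul0r.
have segw (s t : R) : 0 <= s <= t -> (forall r : R, 0 <= r <= t -> Omega (y + r *: w)) ->
    u (y + t *: w) - u (y + s *: w) <= (t - s) * enorm w.
  move=> /andP[s0 st] h.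
  have e : (y + t *: w) - (y + s *: w) = (t - s) *: w by apply/rowP => i; rewrite !mxE; ring.
  rewrite -[X in X * _]ger0_norm ?subr_ge0// -enormZ -e; apply: lip => r /andP[r0 r1].
  rewrite e scalerA -addrA -scalerDl; apply: h.
  rewrite addr_ge0 ?mulr_ge0 ?subr_ge0//= -lerBrDl ler_piMl// subr_ge0//.
have down (t : R) : U t -> forall s : R, 0 <= s <= t -> U s.
  move=> [t0 h] s /andP[s0 st]; split => // r /andP[r0 rs]; apply: h.
  by rewrite r0 (le_trans rs).
have [[M hM]|nb] := pselect (has_ubound U); last first.
  apply: Or33 => s s0; have [[t Ut st]|h] := pselect (exists2 t, U t & s < t).
    by apply: Ut.2; rewrite s0 ltW.
  exfalso; apply: nb; exists s => t Ut; rewrite leNgt; apply/negP => st; apply: h.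
  by exists t.
have sU : has_sup U by split; [exists 0|exists M].
pose T := sup U.
have T0 : 0 <= T by apply: ub_le_sup => //; exists M.
have below (s : R) : 0 <= s < T -> Omega (y + s *: w) /\ u (y + s *: w) - u y = s * enorm w.
  move=> /andP[s0 sT]; have Ts : 0 < T - s by rewrite subr_gt0.
  have [t Ut st] := sup_adherent Ts sU.
  apply: Ut.2; rewrite s0 ltW//; move: st; rewrite -/T; lra.
have [OT|nO] := pselect (Omega (y + T *: w)); last first.
  apply: Or32; exists T => //; rewrite lt_neqAle T0 andbT; apply/eqP => T00.
  by apply: nO; rewrite -T00 scale0r addr0.
apply: Or31; exists T => //; split.
  move=> s /andP[s0]; rewrite le_eqVlt => /orP[/eqP ->//|sT].
  by have [] := below s; rewrite ?s0.
move=> t Tt h; rewrite lt_neqAle; have t0 : 0 <= t by apply: le_trans (ltW Tt).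
have := segw 0 t; rewrite lexx t0 scale0r addr0 subr0 => /(_ isT h) ->; rewrite andbT.
(* If the whole stretch from 0 to [t] is light then each of its points is: its two pieces cannot
   exceed their Lipschitz bounds and these add up to the total. Thus [t] would belong to [U]. *)
apply/eqP => e; suff : t <= T by rewrite leNgt Tt.
apply: ub_le_sup; first by exists M.
split => // s /andP[s0 st]; split; first by apply: h; rewrite s0.
have h1 := segw s t; rewrite s0 st in h1; have {}h1 := h1 isT h.
have h2 : u (y + s *: w) - u y <= s * enorm w.
  have := segw 0 s; rewrite lexx s0 scale0r addr0 subr0 => /(_ isT); apply => r /andP[r0 rs].
  by apply: h; rewrite r0 (le_trans rs).
move: e h1 h2; rewrite mulrBl.
move: (u _) (u y) (u (y + s *: w)) (s * _) (t * _) => a b c d f; lra.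
Qed.

Lemma path_dist_segment Omega x y : (forall t : R, 0 < t < 1 -> Omega (x + t *: (y - x))) ->
  (path_dist Omega x y <= (enorm (y - x))%:E)%E.
Proof.
move=> h; apply: ereal_inf_lbound; exists (fun t => x + t *: (y - x)), [:: 1]; split => //.
- split => //=; first by rewrite ltr01.
  move=> [|//] _ s _ /=; rewrite mulr0 mulr1 add0r scale0r addr0 scale1r.
  by apply/rowP => i; rewrite !mxE; ring.
- by rewrite scale0r addr0.
- by rewrite scale1r addrC subrK.
- by rewrite /polygonal_length big_ord1/= scale1r scale0r addr0 [x + _]addrC subrK.
Qed.

(** Boundary values are read along segments issuing from the boundary point, so the ray is run
    backwards from [y + T *: w], at the parameter [T - t * T]. *)
Lemma boundary_exit Omega phi (u : 'rV[R]_m -> R) y w (T : R) :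
  boundary_value Omega phi u -> 0 < T -> ~ Omega (y + T *: w) ->
  (forall s : R, 0 <= s < T -> Omega (y + s *: w)) ->
  bdry Omega (y + T *: w) /\ u (y + (T - t * T) *: w) @[t --> 0^'+] --> phi (y + T *: w).
Proof.
move=> bv T0 nO h.
have c : (fun t : R => y + (T - t * T) *: w) @ 0^'+ --> y + T *: w.
  have : (fun t : R => y + (T - t * T) *: w) @ (0 : R) --> y + (T - 0 * T) *: w.
    apply: cvgD; first exact: cvg_cst.
    apply: cvgZr_tmp; apply: cvgB; first exact: cvg_cst.
    by apply: cvgMr_tmp; exact: cvg_id.
  by rewrite mul0r subr0 => /cvg_at_right_filter.
have tT (t : R) : 0 < t < 1 -> 0 <= T - t * T < T.
  move=> /andP[t0 t1]; rewrite subr_ge0 ler_piMl ?ltW//= ltrBlDr ltrDl mulr_gt0//.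
have bd : bdry Omega (y + T *: w).
  split => //; apply: (@closed_cvg _ _ (0 : R)^'+ _ (fun t : R => y + (T - t * T) *: w) (closure Omega)).
  - exact: closed_closure.
  - near=> t; apply: subset_closure; apply/h/tT/andP; split; near: t; first exact: nbhs_right_gt.
    by apply: nbhs_right_lt; exact: ltr01.
  - exact: c.
have e (t : R) : (y + T *: w) + t *: ((- T) *: w) = y + (T - t * T) *: w.
  by apply/rowP => i; rewrite !mxE; ring.
split => //; under eq_fun do rewrite -e; apply: bv => // t t01.
by rewrite e; apply: h; exact: tT.
Unshelve. all: by end_near.
Qed.

Lemma boundary_light Omega phi (u : 'rV[R]_m -> R) y w (T : R) :
  boundary_value Omega phi u -> 0 < T -> ~ Omega (y + T *: w) ->
  (forall s : R, 0 <= s < T -> Omega (y + s *: w) /\ u (y + s *: w) - u y = s * enorm w) ->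
  bdry Omega (y + T *: w) /\ phi (y + T *: w) - u y = T * enorm w.
Proof.
move=> bv T0 nO h.
have [bd l1] := boundary_exit bv T0 nO (fun s sT => (h s sT).1); split => //.
have l2 : u (y + (T - t * T) *: w) @[t --> 0^'+] --> u y + T * enorm w.
  have : (fun t : R => u y + (T - t * T) * enorm w) @ 0^'+ --> u y + T * enorm w.
    have : (fun t : R => u y + (T - t * T) * enorm w) @ (0 : R) --> u y + (T - 0 * T) * enorm w.
      apply: cvgD; first exact: cvg_cst.
      apply: cvgMr_tmp; apply: cvgB; first exact: cvg_cst.
      by apply: cvgMr_tmp; exact: cvg_id.
    by rewrite mul0r subr0 => /cvg_at_right_filter.
  apply: cvg_trans; apply: near_eq_cvg; near=> t.
  have tT : 0 <= T - t * T < T.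
    have t0 : 0 < t by near: t; exact: nbhs_right_gt.
    have t1 : t < 1 by near: t; apply: nbhs_right_lt; exact: ltr01.
    by rewrite subr_ge0 ler_piMl ?ltW//= ltrBlDr ltrDl mulr_gt0.
  by have [_ ht] := h _ tT; rewrite -ht addrC subrK.
have := @cvg_unique _ (@norm_hausdorff _ _) _ _ _ _ l1 l2.
by move=> ->; rewrite addrAC subrr add0r.
Unshelve. all: by end_near.
Qed.

(** The boundary points [P] and [Q] at which the light line leaves [Omega] are joined by an open
    segment inside [Omega], whose length bounds [path_dist]. Along it the increments of [u] add up
    to phi(Q) - phi(P) = |Q - P|, against the strict inequality in [spacelike_data]. *)
Lemma bdry_light_contra Omega phi (u : 'rV[R]_m -> R) y w (T T' : R) :
  spacelike_data Omega phi -> boundary_value Omega phi u -> w != 0 -> 0 < T -> 0 < T' ->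
  (forall t : R, 0 <= t <= 1 -> Omega (y + t *: w)) -> u (y + w) - u y = enorm w ->
  ~ Omega ((y + w) + T *: w) ->
  (forall s : R, 0 <= s < T -> Omega ((y + w) + s *: w) /\ u ((y + w) + s *: w) - u (y + w) = s * enorm w) ->
  ~ Omega (y + T' *: - w) ->
  (forall s : R, 0 <= s < T' -> Omega (y + s *: - w) /\ - u (y + s *: - w) - - u y = s * enorm w) ->
  False.
Proof.
move=> [_ sl] bv w0 T0 T0' seg light nO h nO' h'.
have [bQ eQ] := boundary_light bv T0 nO h.
have bv' : boundary_value Omega (fun z => - phi z) (fun z => - u z).
  by move=> a v ba hv; apply: cvgN; exact: bv.
have h'' (s : R) : 0 <= s < T' -> Omega (y + s *: - w) /\ - u (y + s *: - w) - - u y = s * enorm (- w).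
  by rewrite enormN; exact: h'.
have [bP eP] := boundary_light bv' T0' nO' h''.
have n0 : 0 < enorm w by rewrite enorm_gt0.
set Q := (y + w) + T *: w in bQ eQ nO; set P := y + T' *: - w in bP eP nO'.
have c0 : 0 < 1 + T + T' by rewrite !addr_gt0.
have QP : Q - P = (1 + T + T') *: w by apply/rowP => i; rewrite !mxE; ring.
have PQ : P != Q by rewrite eq_sym -subr_eq0 QP scaler_eq0 negb_or w0 gt_eqF.
have := sl P Q bP bQ PQ; rewrite ltNge => /negP; apply.
apply: le_trans (path_dist_segment _) _.
  move=> t /andP[t0 t1]; rewrite QP scalerA.
  have -> : P + (t * (1 + T + T')) *: w = y + (t * (1 + T + T') - T') *: w.
    by apply/rowP => i; rewrite !mxE; ring.
  set s := _ - _; have sT : s < 1 + T.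
    by rewrite /s ltrBlDr gtr_pMl.
  have sT' : - T' < s by rewrite /s ltrDr mulr_gt0.
  have [s0|s0] := ltP s 0.
    have [] := h' (- s); first by rewrite oppr_ge0 (ltW s0)/= ltrNl.
    by rewrite scalerN scaleNr opprK.
  have [s1|s1] := leP s 1; first by apply: seg; rewrite s0.
  have [] := h (s - 1); first by rewrite subr_ge0 (ltW s1)/= ltrBlDl.
  by rewrite (_ : y + w + _ = y + s *: w)//; apply/rowP => i; rewrite !mxE; ring.
rewrite lee_fin QP enormZ gtr0_norm// distrC; apply: le_trans (ler_norm _).
move: eQ eP light; rewrite enormN !mulrDl mul1r.
move: (phi Q) (phi P) (u y) (u (y + w)) (enorm w) (T * _) (T' * _) => a b c d e f g; lra.
Qed.

Lemma bounded_line_exit Omega y w : bounded_set Omega -> w != 0 ->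
  exists s : R, 0 <= s /\ ~ Omega (y + s *: w).
Proof.
move=> [M [_ hM]] w0; have n0 : 0 < `|w| by rewrite normr_gt0.
pose s : R := (`|M| + `|y| + 2) / `|w|.
have sn : s * `|w| = `|M| + `|y| + 2 by rewrite divfK ?gt_eqF.
have s0 : 0 <= s by rewrite divr_ge0 ?ltW// !addr_ge0.
exists s; split => // /(hM (`|M| + 1) _); rewrite ltr_pwDr ?ler_norm// => /(_ isT) /= h.
have : `|s *: w| <= `|y + s *: w| + `|y|.
  by rewrite -[X in `|X| <= _](addKr y) addrC -(normrN y) ler_normD.
rewrite normrZ ger0_norm// sn; move: h; move: `|M| `|y| `|y + _| => a b c; lra.
Qed.

(** Prolonging beyond [x] is prolonging beyond [y] for the data [- u], [- g] and [- w], so one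
    construction serves both ends. *)
Lemma light_competitor Omega phi (u : 'rV[R]_m -> R) g x y :
  open Omega -> weak_gradient Omega u g -> {within Omega, continuous u} ->
  {ae mu, forall s, Omega s -> enorm (g s) <= 1} ->
  light_segment Omega u x y ->
  [/\ bounded_set Omega, spacelike_data Omega phi & boundary_value Omega phi u] \/
    (Omega = setT /\ vanishes_at_infinity u) ->
  decreasing_variation Omega g x y.
Proof.
move=> oO wg cu g1 [xy seg light] hO.
have [w we] : exists w, w = y - x by exists (y - x).
have yw : y = x + w by rewrite we addrC subrK.
rewrite -we in seg light; have w0 : w != 0 by rewrite we subr_eq0 eq_sym.
have n0 : 0 < enorm w by rewrite enorm_gt0.
have Ox : Omega x by have := seg 0; rewrite lexx ler01 scale0r addr0; apply.
have Oy : Omega y by have := seg 1; rewrite lexx ler01 scale1r -yw; apply.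
have wg' := weak_gradient_opp oO wg.
have cu' : {within Omega, continuous (fun z => - u z)} by move=> z; apply: continuousN; exact: cu.
have g1' : {ae mu, forall s, Omega s -> enorm (- g s) <= 1}.
  by apply: filterS g1 => s; rewrite enormN.
have lip := fun z z' => @lipschitz_of_weak_gradient R m Omega u g z z' oO wg cu g1.
have lip' := fun z z' => @lipschitz_of_weak_gradient R m Omega _ _ z z' oO wg' cu' g1'.
have up := @light_ray Omega u y w lip Oy.
have dn := @light_ray Omega (fun z => - u z) x (- w) lip' Ox.
have segx (T : R) : (forall s : R, 0 <= s <= T -> Omega (y + s *: w)) ->
    forall t : R, 0 <= t <= 1 + T -> Omega (x + t *: w).
  move=> h t /andP[t0 tT]; have [t1|t1] := leP t 1; first by apply: seg; rewrite t0.
  have := h (t - 1); rewrite subr_ge0 (ltW t1) lerBlDl tT => /(_ isT).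
  by rewrite (_ : y + _ = x + t *: w)//; rewrite yw; apply/rowP => i; rewrite !mxE; ring.
have segy (T : R) : (forall s : R, 0 <= s <= T -> Omega (x + s *: - w)) ->
    forall t : R, 0 <= t <= 1 + T -> Omega (y + t *: - w).
  move=> h t /andP[t0 tT]; have [t1|t1] := leP t 1.
    rewrite (_ : _ + _ = x + (1 - t) *: w); last by rewrite yw; apply/rowP => i; rewrite !mxE; ring.
    by apply: seg; rewrite subr_ge0 t1 lerBlDr lerDl.
  have := h (t - 1); rewrite subr_ge0 (ltW t1) lerBlDl tT => /(_ isT).
  by rewrite (_ : x + _ = y + t *: - w)//; rewrite yw; apply/rowP => i; rewrite !mxE; ring.
(* With [a] unchanged and [eta], [b] negated, -(a(-g - b)) = a(g - (-b)), and the exchange of the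
   two end points restores the sign of the increment. *)
have flip : decreasing_variation Omega (fun z => - g z) y x -> decreasing_variation Omega g x y.
  move=> [eta [a [b [L [K [[cK KO e0 a0] [ceta lipeta wgeta] [ca cb a1 b1] neg]]]]]].
  exists (fun z => - eta z), a, (fun z => - b z), L, K; split.
  - by split => // z /e0 ->; rewrite oppr0.
  - split; [by move=> z; apply: continuousN; exact: ceta|by move=> z z'; rewrite -opprD normrN|].
    have := weak_gradient_opp oO wgeta; congr weak_gradient; apply/funext => z.
    by rewrite -scalerN opprD !opprK.
  - split => // [i|z]; last by rewrite enormN.
    by under eq_fun do rewrite mxE; move=> z; apply: continuousN; exact: cb.
  - by rewrite -opprD oppr_lt0 -opprB oppr_gt0.
have case_dn (T : R) : 0 <= T -> (forall s : R, 0 <= s <= T -> Omega (x + s *: - w)) ->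
    (forall t : R, T < t -> (forall s : R, 0 <= s <= t -> Omega (x + s *: - w)) ->
       - u (x + t *: - w) - - u x < t * enorm (- w)) -> decreasing_variation Omega g x y.
  move=> T0 h1 h2; apply: flip; have xyw : x = y + - w by rewrite yw addrK.
  rewrite [X in decreasing_variation _ _ _ X]xyw.
  have w0' : - w != 0 by rewrite oppr_eq0.
  apply: (competitor oO wg' cu' g1' w0' T0 (segy T h1)); rewrite -?xyw//.
  by rewrite enormN -light opprK addrC.
case: up => [[T T0 [h1 h2]]|up|up].
- rewrite [X in decreasing_variation _ _ _ X]yw.
  by apply: (competitor oO wg cu g1 w0 T0 (segx T h1)); rewrite -?yw.
- case: dn => [[T' T0' [h1' h2']]|dn|dn].
  + exact: case_dn T0' h1' h2'.
  + case: hO => [[_ sl bv]|[OT _]]; last by have [T _ [nT _]] := up; case: nT; rewrite OT.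
    exfalso; have [T T0 [nT hT]] := up; have [T' T0' [nT' hT']] := dn.
    rewrite yw in light nT hT; rewrite enormN in hT'.
    exact: (bdry_light_contra sl bv w0 T0 T0' seg light nT hT nT' hT').
  + case: hO => [[bO _ _]|[OT _]]; last by have [T _ [nT _]] := up; case: nT; rewrite OT.
    have [|s [s0 ns]] := bounded_line_exit x bO (w := - w); first by rewrite oppr_eq0.
    by exfalso; apply: ns; have [] := dn s s0.
- exfalso; case: hO => [[bO _ _]|[OT van]].
    by have [s [s0 ns]] := bounded_line_exit y bO w0; apply: ns; have [] := up s s0.
  have [M hM] := van 1 ltr01.
  (* Far enough for the point to have norm larger than [M] while [u], growing linearly along the
     light ray, has reached the value 2. *)
  pose s : R := (`|M| + enorm y + `|u y| + 2) / enorm w.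
  have sn : s * enorm w = `|M| + enorm y + `|u y| + 2 by rewrite divfK ?gt_eqF.
  have s0 : 0 <= s by rewrite divr_ge0 ?enorm_ge0// !addr_ge0 ?enorm_ge0.
  have [_ hs] := up s s0; have := hM (y + s *: w).
  have : enorm (s *: w) <= enorm (y + s *: w) + enorm y.
    by rewrite -[X in enorm X <= _](addKr y) addrC -(enormN y) (le_trans (enormD _ _)).
  rewrite enormZ ger0_norm// sn => h1 h2.
  have M1 : M < enorm (y + s *: w).
    move: h1 (ler_norm M) (normr_ge0 (u y)) (enorm_ge0 y).
    by move: (enorm _) (enorm y) `|M| `|u y| => a b c d; lra.
  have := h2 M1; have -> : u (y + s *: w) = u y + (`|M| + enorm y + `|u y| + 2).
    by rewrite -sn -hs [u y + _]addrC subrK.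
  have := ler_norm (- u y); rewrite normrN => h3 h4.
  have := le_lt_trans (ler_norm _) h4.
  by move: h3 (normr_ge0 M) (enorm_ge0 y); move: (u y) `|u y| `|M| (enorm y) => a b c d; lra.
Qed.

End LightLine.

(** * Lebesgue norms *)

Section Measurability.
Context {R : realType} {m : nat}.
Local Notation mu := (lebesgue_rV R m).
Implicit Types (Omega : set 'rV[R]_m).

(** Integrability on compact sets gives measurability there, and [Omega] is a countable union of
    rational balls contained in compact subsets of it. *)
Lemma measurable_locally_integrable Omega (f : 'rV[R]_m -> \bar R) : open Omega ->
  locally_integrable_on Omega f -> measurable_fun Omega f.
Proof.
move=> oO lf.
pose B (p : 'rV[rat]_m * nat) := ball (map_mx ratr p.1 : 'rV[R]_m) (p.2.+1%:R^-1 : R).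
pose good p := B p `<=` Omega /\ measurable_fun (B p) f.
pose F k := if @unpickle ('rV[rat]_m * nat)%type k is Some p then
   if `[< good p >] then B p else set0 else set0.
have mB p : measurable (B p) by apply: open_measurable_rV; exact: ball_open.
have -> : Omega = \bigcup_k F k.
  apply/seteqP; split => [z Oz|z [k _]]; last first.
    by rewrite /F; case: unpickle => [p|//]; case: ifPn => // /asboolP[h _]; exact: h.
  have /nbhs_ballP[e /= e0 eO] := open_nbhs_nbhs (conj oO Oz).
  have e20 : 0 < e / 2 by rewrite divr_gt0.
  have [q [n [qz qe]]] := rational_ball z e20.
  exists (pickle (q, n)) => //; rewrite /F pickleK ifT//; apply/asboolP.
  pose K := thick [set z] (e / 2).
  have cK : compact K by apply: compact_thick; exact: compact_set1.
  have BK : B (q, n) `<=` K.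
    by move=> s /qe; rewrite -ball_normE/= distrC => /ltW sz; exists z.
  have KO : K `<=` Omega.
    move=> s [_ -> sz]; apply: eO; rewrite -ball_normE/= distrC; apply: le_lt_trans sz _.
    by rewrite ltr_pdivrMr// ltr_pMr// ltr1n.
  split; first exact: subset_trans KO.
  apply: measurable_funS BK _; first exact: compact_measurable_rV.
  by have /integrableP[] := lf K cK KO.
apply/measurable_fun_bigcup.
  by move=> k; rewrite /F; case: unpickle => [p|//]; case: ifPn.
move=> k; rewrite /F; case: unpickle => [p|]; last exact: measurable_fun_set0.
by case: ifPn => [/asboolP[]//|_]; exact: measurable_fun_set0.
Qed.

Lemma measurable_weak_fun Omega v g : open Omega -> weak_gradient Omega v g -> measurable_fun Omega v.
Proof. by move=> oO [lv _ _]; apply/measurable_EFinP; exact: measurable_locally_integrable. Qed.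

Lemma measurable_weak_gradient Omega v g i : open Omega -> weak_gradient Omega v g ->
  measurable_fun Omega (fun z => g z 0 i).
Proof. by move=> oO [_ lg _]; apply/measurable_EFinP; apply: measurable_locally_integrable => //; exact: lg. Qed.

Lemma measurable_dot (D : set 'rV[R]_m) (f f' : 'rV[R]_m -> 'rV[R]_m) : measurable D ->
  (forall i, measurable_fun D (fun z => f z 0 i)) -> (forall i, measurable_fun D (fun z => f' z 0 i)) ->
  measurable_fun D (fun z => dot (f z) (f' z)).
Proof.
move=> mD mf mf'; apply: (@measurable_sum _ _ R D _ _ (fun i z => f z 0 i * f' z 0 i)) => i.
exact: measurable_funM.
Qed.

Lemma measurable_enorm (D : set 'rV[R]_m) (f : 'rV[R]_m -> 'rV[R]_m) : measurable D ->
  (forall i, measurable_fun D (fun z => f z 0 i)) -> measurable_fun D (fun z => enorm (f z)).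
Proof.
move=> mD mf; apply: (measurableT_comp (continuous_measurable_fun (@sqrt_continuous R))) => //.
exact: measurable_dot.
Qed.

Lemma measurable_enorm_weak Omega v g : open Omega -> weak_gradient Omega v g ->
  measurable_fun Omega (fun z => enorm (g z)).
Proof.
move=> oO wg; apply: measurable_enorm; first exact: open_measurable_rV.
by move=> i; exact: measurable_weak_gradient wg.
Qed.

Lemma weak_gradient_grad Omega v : (exists g, weak_gradient Omega v g) ->
  weak_gradient Omega v (grad Omega v).
Proof. by move=> [g wg]; apply: (@xgetPex _ (fun=> 0) [set g | weak_gradient Omega v g]); exists g. Qed.

Lemma grad_ae Omega v g : open Omega -> weak_gradient Omega v g ->
  {ae mu, forall z, Omega z -> grad Omega v z = g z}.
Proof.
move=> oO wg; have wg' : weak_gradient Omega v (grad Omega v) by apply: weak_gradient_grad; exists g.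
exact: (weak_gradient_unique oO wg' wg).
Qed.

End Measurability.

Section LpNorm.
Context {R : realType} {m : nat}.
Local Notation mu := (lebesgue_rV R m).
Implicit Types (Omega : set 'rV[R]_m) (f : 'rV[R]_m -> R).

(** Selects the essential supremum in the definition of the [+oo] norm, which distinguishes whether
    the space has positive measure. *)
Lemma lebesgue_rV_setT_gt0 : (0 < mu setT)%E.
Proof.
apply: (@lt_le_trans _ _ (mu (obox (const_mx (-1)) (const_mx 1)))).
  rewrite lebesgue_rV_obox; last by move=> i; rewrite !mxE; lra.
  by rewrite lte_fin prodr_gt0// => i _; rewrite !mxE; lra.
by apply: le_measure; rewrite ?inE//; exact: measurable_obox.
Qed.

Lemma Lpnorm_oo_leP Omega f (c : R) : 0 <= c ->
  (Lpnorm Omega +oo f <= c%:E)%E <-> {ae mu, forall z, Omega z -> `|f z| <= c}.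
Proof.
move=> c0; rewrite /Lpnorm unlock lebesgue_rV_setT_gt0; split => [/ess_supP|h].
  by apply: filterS => z /= h Oz; move: h; rewrite patchE mem_set// lee_fin.
apply/ess_supP; apply: filterS h => z h /=; rewrite patchE lee_fin.
by have [/set_mem/h//|_] := boolP (z \in Omega); rewrite normr0.
Qed.

Lemma Lpnorm_oo_finP Omega f :
  (Lpnorm Omega +oo f < +oo)%E <-> exists2 c : R, 0 <= c & {ae mu, forall z, Omega z -> `|f z| <= c}.
Proof.
split => [h|[c c0 /(Lpnorm_oo_leP _ _ c0) h]]; last by rewrite (le_lt_trans h)// ltry.
have n0 : (0 <= Lpnorm Omega +oo f)%E by exact: Lnorm_ge0.
have fn : Lpnorm Omega +oo f \is a fin_num by rewrite ge0_fin_numE.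
exists (fine (Lpnorm Omega +oo f)); first exact: fine_ge0.
by apply/Lpnorm_oo_leP; rewrite ?fine_ge0 ?fineK.
Qed.

Lemma Lpnorm_powR Omega (p : R) f : 0 < p ->
  (Lpnorm Omega p%:E f `^ p = \int[mu]_(z in Omega) (`|f z| `^ p)%:E)%E.
Proof.
move=> p0; have pn0 : p != 0 by rewrite gt_eqF.
rewrite /Lpnorm (poweR_Lnorm _ _ pn0) [RHS]integral_mkcond.
apply: eq_integral => z _; rewrite /= !patchE.
by case: ifP => // _; rewrite normr0 powR0// gt_eqF.
Qed.

Lemma Lpnorm_le Omega (p c : R) f : 0 < p -> 0 <= c ->
  (\int[mu]_(z in Omega) (`|f z| `^ p)%:E <= (c `^ p)%:E)%E -> (Lpnorm Omega p%:E f <= c%:E)%E.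
Proof.
move=> p0 c0; rewrite -Lpnorm_powR// => h.
have n0 : (0 <= Lpnorm Omega p%:E f)%E by exact: Lnorm_ge0.
have pi0 : 0 <= p^-1 by rewrite invr_ge0 ltW.
have := @gt0_ler_poweR R _ pi0 _ _ _ _ h.
rewrite !in_itv/= !leey !andbT -poweRrM mulfV ?gt_eqF// poweRe1//.
rewrite -powRrM mulfV ?gt_eqF// powRr1//; apply; [exact: poweR_ge0|by rewrite lee_fin powR_ge0].
Qed.

Lemma Lpnorm_lt_int Omega (p c : R) f : 0 < p -> 0 <= c -> (Lpnorm Omega p%:E f <= c%:E)%E ->
  (\int[mu]_(z in Omega) (`|f z| `^ p)%:E <= (c `^ p)%:E)%E.
Proof.
move=> p0 c0 h; rewrite -Lpnorm_powR//.
have n0 : (0 <= Lpnorm Omega p%:E f)%E by exact: Lnorm_ge0.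
rewrite -[leRHS]poweR_EFin; apply: gt0_ler_poweR => //; first exact: ltW.
  by rewrite in_itv/= n0 leey.
by rewrite in_itv/= lee_fin c0 leey.
Qed.

Lemma measurable_norm_powR (D : set 'rV[R]_m) (p : R) f : measurable_fun D f ->
  measurable_fun D (fun z => `|f z| `^ p).
Proof.
move=> mf; apply: (@measurableT_comp _ _ _ _ _ _ (@powR R ^~ p)); first exact: measurable_powR.
exact: measurableT_comp.
Qed.

Lemma Lpnorm_bounded Omega (p M : R) f : 0 < p -> measurable Omega -> (mu Omega < +oo)%E ->
  measurable_fun Omega f -> {ae mu, forall z, Omega z -> `|f z| <= M} -> (Lpnorm Omega p%:E f < +oo)%E.
Proof.
move=> p0 mO fO mf h; apply: (@lty_poweRy _ _ p); first by rewrite gt_eqF.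
rewrite Lpnorm_powR//; apply: (@le_lt_trans _ _ (\int[mu]_(z in Omega) (`|M| `^ p)%:E)%E).
  apply: ae_ge0_le_integral => //.
  - by apply/measurable_EFinP; exact: measurable_norm_powR.
  - apply: filterS h => z h Oz; rewrite lee_fin ge0_ler_powR ?nnegrE ?(ltW p0)//.
    by apply: le_trans (h Oz) (ler_norm _).
by rewrite integral_cst// lte_mul_pinfty// lee_fin powR_ge0.
Qed.

Lemma Lpnorm_ae_le Omega (p : R) f f' : 0 < p -> measurable Omega ->
  measurable_fun Omega f -> measurable_fun Omega f' ->
  {ae mu, forall z, Omega z -> `|f z| <= `|f' z|} -> (Lpnorm Omega p%:E f <= Lpnorm Omega p%:E f')%E.
Proof.
move=> p0 mO mf mf' h.
have [->|fin] := eqVneq (Lpnorm Omega p%:E f') +oo%E; first by rewrite leey.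
have n0 : (0 <= Lpnorm Omega p%:E f')%E by exact: Lnorm_ge0.
have fn : Lpnorm Omega p%:E f' \is a fin_num by rewrite ge0_fin_numE// ltey.
rewrite -(fineK fn); apply: Lpnorm_le; rewrite ?fine_ge0//.
rewrite -poweR_EFin (fineK fn) (Lpnorm_powR _ _ p0).
apply: ae_ge0_le_integral => //.
- by apply/measurable_EFinP; exact: measurable_norm_powR.
- by apply/measurable_EFinP; exact: measurable_norm_powR.
- by apply: filterS h => z h Oz; rewrite lee_fin ge0_ler_powR ?nnegrE ?(ltW p0)//; exact: h.
Qed.

Lemma Lpnorm_minkowski Omega (p : R) f f' : 1 <= p -> measurable Omega ->
  measurable_fun Omega f -> measurable_fun Omega f' ->
  (Lpnorm Omega p%:E (fun z => f z + f' z)%R <= Lpnorm Omega p%:E f + Lpnorm Omega p%:E f')%E.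
Proof.
move=> p1 mO mf mf'; rewrite /Lpnorm.
have -> : (fun z => f z + f' z) \_ Omega = (f \_ Omega \+ f' \_ Omega)%R.
  by apply/funext => z; rewrite /= !patchE; case: ifP => // _; rewrite addr0.
by apply: minkowski_EFin => //; apply/(measurable_restrictT _ mO).
Qed.

End LpNorm.

(** * Bounded domains *)

Section BoundedDomain.
Context {R : realType} {m : nat}.
Local Notation mu := (lebesgue_rV R m).
Implicit Types (Omega : set 'rV[R]_m) (u v phi : 'rV[R]_m -> R).

(** The infimum of the parameters outside [Omega] is itself outside, the complement being closed,
    and is not 0 as [z] is inside. *)
Lemma first_exit Omega (z q : 'rV[R]_m) : open Omega -> Omega z -> ~ Omega q ->
  exists2 T : R, 0 < T <= 1 & ~ Omega (z + T *: (q - z)) /\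
    forall s : R, 0 <= s < T -> Omega (z + s *: (q - z)).
Proof.
move=> oO Oz nOq; set w := q - z.
pose C := [set t : R | 0 <= t <= 1 /\ ~ Omega (z + t *: w)].
have C1 : C 1 by split; [rewrite ler01 lexx|rewrite scale1r /w addrC subrK].
have iC : has_inf C by split; [exists 1|exists 0 => t [/andP[]]].
pose T := inf C.
have T1 : T <= 1 by apply: ge_inf => //; case: iC.
have T0 : 0 <= T by apply: lb_le_inf; [exists 1|move=> t [/andP[]]].
have below (s : R) : 0 <= s < T -> Omega (z + s *: w).
  move=> /andP[s0 sT]; apply: contrapT => ns.
  suff : T <= s by rewrite leNgt sT.
  apply: ge_inf; first by case: iC.
  by split => //; rewrite s0 (le_trans (ltW sT)).
have nT : ~ Omega (z + T *: w).
  move=> OT.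
  have cl : continuous (fun t : R => z + t *: w) by exact: continuous_line.
  have : \forall t \near T, Omega (z + t *: w).
    by apply: (cl T); exact: (open_nbhs_nbhs (conj oO OT)).
  move=> /nbhs_ballP[e /= e0 he].
  have [t [t01 nt] tTe] := inf_adherent e0 iC.
  have Tt : T <= t by apply: ge_inf => //; case: iC.
  by apply: nt; apply: he; rewrite -ball_normE/= distrC ger0_norm ?subr_ge0// ltrBlDl.
exists T => //; rewrite T1 andbT lt_neqAle T0 andbT; apply/eqP => T00.
by apply: nT; rewrite -T00 scale0r addr0.
Qed.

Lemma boundary_lipschitz Omega phi u (z w : 'rV[R]_m) (T : R) :
  (forall x y, (forall t : R, 0 <= t <= 1 -> Omega (x + t *: (y - x))) -> `|u y - u x| <= enorm (y - x)) ->
  boundary_value Omega phi u -> 0 < T -> ~ Omega (z + T *: w) ->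
  (forall s : R, 0 <= s < T -> Omega (z + s *: w)) ->
  bdry Omega (z + T *: w) /\ `|phi (z + T *: w) - u z| <= T * enorm w.
Proof.
move=> lip bv T0 nO h; have [bd l] := boundary_exit bv T0 nO h; split => //.
have {}l : `|u (z + (T - t * T) *: w) - u z| @[t --> 0^'+] --> `|phi (z + T *: w) - u z|.
  by apply: cvg_norm; apply: cvgB => //; exact: cvg_cst.
apply: (cvgr_to_le l); near=> t.
have t0 : 0 < t by near: t; exact: nbhs_right_gt.
have t1 : t < 1 by near: t; apply: nbhs_right_lt; exact: ltr01.
have sT : 0 <= T - t * T < T by rewrite subr_ge0 ler_piMl ?ltW//= ltrBlDr ltrDl mulr_gt0.
have e : z + (T - t * T) *: w - z = (T - t * T) *: w by rewrite addrC addKr.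
apply: (@le_trans _ _ ((T - t * T) * enorm w)); last first.
  by rewrite ler_wpM2r ?enorm_ge0//; case/andP: sT => _ /ltW.
have : `|u (z + (T - t * T) *: w) - u z| <= enorm (z + (T - t * T) *: w - z).
  apply: lip => r /andP[r0 r1]; rewrite e scalerA; apply: h.
  have /andP[s0 sT'] := sT; rewrite mulr_ge0//=; apply: le_lt_trans sT'.
  by rewrite ler_piMl.
have /andP[s0 _] := sT.
by rewrite e enormZ (ger0_norm s0).
Unshelve. all: by end_near.
Qed.

(** The segment from a nearby [z] to the boundary point [q] may leave [Omega] early, at [q']. Then
    [q'] is no further from [q] than [z] is, so phi(q) - phi(q') is small by continuity of [phi],
    and phi(q') - u(z) is bounded by the length of the piece inside [Omega]. *)
Lemma closure_continuous Omega phi u : open Omega ->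
  (forall x y, (forall t : R, 0 <= t <= 1 -> Omega (x + t *: (y - x))) -> `|u y - u x| <= enorm (y - x)) ->
  {within Omega, continuous u} -> {within bdry Omega, continuous phi} ->
  boundary_value Omega phi u -> (forall x, bdry Omega x -> u x = phi x) ->
  {within closure Omega, continuous u}.
Proof.
move=> oO lip cu cphi bv ub; apply/subspace_continuousP => q cq.
have [Oq|nOq] := pselect (Omega q).
  have : {for q, continuous u} by move: cu; rewrite continuous_open_subspace// => /(_ q (mem_set Oq)).
  by move=> h; apply: cvg_within_filter.
have bq : bdry Omega q by [].
apply/cvgrPdist_le => e e0; rewrite /from_subspace (ub q bq).
have e20 : 0 < e / 2 by rewrite divr_gt0.
have /subspace_continuousP/(_ q bq)/cvgrPdist_le/(_ _ e20) := cphi.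
rewrite near_withinE => /nbhs_ballP[d /= d0 hd].
pose k : R := Num.sqrt m%:R + 1.
have k0 : 0 < k by rewrite ltr_wpDl ?sqrtr_ge0.
pose d' := Num.min d (e / 2 / k).
have d'0 : 0 < d' by rewrite lt_min d0 divr_gt0.
rewrite near_withinE; apply/nbhs_ballP; exists d' => // z.
rewrite -ball_normE/= lt_min => /andP[zd ze] cz.
have [Oz|nOz] := pselect (Omega z); last first.
  have bz : bdry Omega z by [].
  rewrite ub//; apply: le_trans (hd z _ bz) _; first by rewrite -ball_normE.
  by rewrite ler_pdivrMr// ler_peMr ?ltW// ltr1n.
have [T /andP[T0 T1] [nT hT]] := first_exit oO Oz nOq.
have [bT lT] := boundary_lipschitz lip bv T0 nT hT.
set q' := z + T *: (q - z) in nT bT lT.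
have dq : `|q - q'| < d.
  rewrite (_ : q - q' = (1 - T) *: (q - z)); last by apply/rowP => i; rewrite !mxE; ring.
  rewrite normrZ ger0_norm ?subr_ge0//; apply: le_lt_trans zd.
  by rewrite ler_piMl// lerBlDr lerDl ltW.
have h1 : `|phi q - phi q'| <= e / 2 by apply: hd => //; rewrite -ball_normE.
have h2 : T * enorm (q - z) <= e / 2.
  apply: (@le_trans _ _ (enorm (q - z))); first by rewrite ler_piMl ?enorm_ge0.
  apply: le_trans (enorm_le_norm _) _; apply: (@le_trans _ _ (k * `|q - z|)).
    by rewrite ler_wpM2r// lerDl.
  by rewrite mulrC -ler_pdivlMr// ltW.
rewrite (_ : phi q - u z = (phi q - phi q') + (phi q' - u z)); last by ring.
apply: le_trans (ler_normD _ _) _; rewrite [leRHS](splitr e).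
by apply: lerD => //; exact: le_trans h2.
Qed.

Lemma bounded_fin_measure Omega : open Omega -> bounded_set Omega -> (mu Omega < +oo)%E.
Proof.
move=> oO [M [_ hM]].
apply: (@le_lt_trans _ _ (mu [set z : 'rV[R]_m | `|z| <= `|M| + 1])).
  apply: le_measure; rewrite ?inE; [exact: open_measurable_rV| |].
    apply: compact_measurable_rV; exact: closed_norm_ball_compact.
  by move=> z Oz /=; apply: (hM (`|M| + 1)) => //; rewrite ltr_pwDr// ler_norm.
by apply: compact_fin_measure; exact: closed_norm_ball_compact.
Qed.

Lemma bounded_neq_setT Omega : (0 < m)%N -> bounded_set Omega -> Omega <> setT.
Proof.
move=> m0 bO OT; have w0 : const_mx 1 != 0 :> 'rV[R]_m.
  by apply/eqP => /rowP/(_ (Ordinal m0)); rewrite !mxE => /eqP; rewrite oner_eq0.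
by have [s [_ nO]] := bounded_line_exit 0 bO w0; apply: nO; rewrite OT.
Qed.

Lemma Y_bounded_of_bounds Omega (p1 M C : R) v g : open Omega -> bounded_set Omega -> 0 < p1 ->
  weak_gradient Omega v g -> {ae mu, forall z, Omega z -> `|v z| <= M} ->
  {ae mu, forall z, Omega z -> enorm (g z) <= C} -> {within closure Omega, continuous v} ->
  Y_bounded Omega p1 v.
Proof.
move=> oO bO p0 wg vM gC cv; have mO := open_measurable_rV oO; have fO := bounded_fin_measure oO bO.
have wgr : weak_gradient Omega v (grad Omega v) by apply: weak_gradient_grad; exists g.
split => //; split; first by exists g.
- exact: (Lpnorm_bounded p0 mO fO (measurable_weak_fun oO wg) vM).
- apply: (@Lpnorm_bounded _ _ _ _ C) => //; first exact: (measurable_enorm_weak oO wgr).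
  apply: filterS2 gC (grad_ae oO wg) => z h1 h2 Oz.
  by rewrite /grad_norm ger0_norm ?enorm_ge0// h2//; exact: h1.
Qed.

End BoundedDomain.

Section Variation.
Context {R : realType} {m : nat}.
Local Notation mu := (lebesgue_rV R m).

Lemma enorm_variation (p b : 'rV[R]_m) (a t : R) : enorm p <= 1 -> enorm b <= 1 -> -1 <= a <= 0 -> 0 <= t <= 1 ->
  enorm (t *: (a *: (p - b)) + p) <= 1.
Proof.
move=> p1 b1 /andP[a1 a0] /andP[t0 t1].
have -> : t *: (a *: (p - b)) + p = (1 + t * a) *: p + (- (t * a)) *: b.
  by apply/rowP => i; rewrite !mxE; ring.
have h0 : 0 <= - (t * a) by rewrite -mulrN mulr_ge0// oppr_ge0.
have h1 : 0 <= 1 + t * a.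
  by have := ler_wpM2l t0 a1; rewrite mulrN1; move: (t * a) t1 => s; lra.
apply: le_trans (enormD _ _) _; rewrite !enormZ !ger0_norm//.
apply: (@le_trans _ _ ((1 + t * a) * 1 + (- (t * a)) * 1)); last by rewrite !mulr1 addrK.
by apply: lerD; exact: ler_wpM2l.
Qed.

Lemma Yphi_bounded_variation (Omega K : set 'rV[R]_m) phi u eta a (b : 'rV[R]_m -> 'rV[R]_m) (t : R) :
  open Omega -> Yphi_bounded Omega phi u -> compact K -> K `<=` Omega -> (forall z, ~ K z -> eta z = 0) ->
  continuous eta -> weak_gradient Omega eta (fun z => a z *: (grad Omega u z - b z)) ->
  (forall z, -1 <= a z <= 0) -> (forall z, enorm (b z) <= 1) -> 0 <= t <= 1 ->
  Yphi_bounded Omega phi (fun z => t * eta z + u z).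
Proof.
move=> oO [[exg uoo _] cu g1 bv ub] cK KO eta0 ceta wg a1 b1 t01.
have wgu := weak_gradient_grad exg.
have wgt := weak_gradient_lin t oO wg wgu.
have gt1 : {ae mu, forall z, Omega z -> grad_norm Omega (fun z => t * eta z + u z) z <= 1}.
  apply: filterS2 g1 (grad_ae oO wgt) => z h1 h2 Oz; rewrite /grad_norm h2//.
  by apply: enorm_variation => //; exact: h1.
have bK z : bdry Omega z -> eta z = 0 by move=> [_ nO]; apply: eta0 => /KO.
split => //.
- split; first by exists (fun z => t *: (a z *: (grad Omega u z - b z)) + grad Omega u z).
  + have [M M0 hM] := continuous_bounded_on cK (continuous_subspaceT ceta).
    have [c c0 hc] := (Lpnorm_oo_finP _ _).1 uoo.
    apply/Lpnorm_oo_finP; exists (`|t| * M + c); first by rewrite addr_ge0// mulr_ge0.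
    apply: filterS hc => z h Oz; apply: le_trans (ler_normD _ _) _; apply: lerD; last exact: h.
    rewrite normrM ler_wpM2l//; have [Kz|nK] := pselect (K z); first exact: hM.
    by rewrite eta0// normr0.
  + apply/Lpnorm_oo_finP; exists 1 => //; apply: filterS gt1 => z h Oz.
    by rewrite ger0_norm ?enorm_ge0//; exact: h.
- move=> z; apply: cvgD; last exact: cu.
  by apply: cvgM; [exact: cvg_cst|exact: (continuous_subspaceT ceta)].
- move=> x w bx hw; have -> : phi x = t * eta x + phi x by rewrite bK// mulr0 add0r.
  apply: cvgD; last exact: (bv x w bx hw).
  apply: cvgM; first exact: cvg_cst.
  apply: cvg_at_right_filter.
  rewrite -{2}[x]addr0 -(scale0r w).
  by apply: (continuous_comp (@continuous_line R m x w 0)); exact: ceta.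
- by move=> x bx; rewrite bK// mulr0 add0r ub.
Qed.

End Variation.

(** * First variation of the energy *)

Section EnergyDensity.
Context {R : realType} {m : nat}.
Implicit Types (p q : 'rV[R]_m).

Definition BI_density p : R := 1 - Num.sqrt (1 - enorm p ^+ 2).

Lemma BI_density_ge0 p : 0 <= BI_density p.
Proof.
rewrite subr_ge0 -[leRHS]sqrtr1; apply: ler_wsqrtr; rewrite lerBlDr lerDl; exact: sqr_ge0.
Qed.

Lemma BI_density_le1 p : BI_density p <= 1.
Proof. by rewrite lerBlDr lerDl sqrtr_ge0. Qed.

Lemma sqr_enormZD (t : R) p q :
  enorm (t *: q + p) ^+ 2 = enorm p ^+ 2 + 2 * t * dot p q + t ^+ 2 * enorm q ^+ 2.
Proof.
rewrite !sqr_enorm dotDl !dotDr !dotZl !dotZr [dot q p]dotC.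
by move: (dot p q) (dot q q) (dot p p) => a b c; ring.
Qed.

(* The difference of the two square roots times their sum is the difference of
   their squares, which is [2 t p.q + t^2 |q|^2]. *)
Lemma BI_density_diff p q (t : R) : enorm p < 1 -> enorm (t *: q + p) <= 1 ->
  (BI_density (t *: q + p) - BI_density p) *
    (Num.sqrt (1 - enorm p ^+ 2) + Num.sqrt (1 - enorm (t *: q + p) ^+ 2)) =
  t * (2 * dot p q + t * enorm q ^+ 2).
Proof.
move=> p1 pq1; rewrite /BI_density.
have hA : 0 <= 1 - enorm p ^+ 2 by rewrite subr_ge0 expr_le1 ?enorm_ge0// ltW.
have hB : 0 <= 1 - enorm (t *: q + p) ^+ 2 by rewrite subr_ge0 expr_le1 ?enorm_ge0.
have := sqr_sqrtr hA; have := sqr_sqrtr hB.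
set A := Num.sqrt (1 - enorm p ^+ 2); set B := Num.sqrt _ => h1 h2.
rewrite sqr_enormZD in h1.
rewrite (_ : (1 - B - (1 - A)) * (A + B) = A ^+ 2 - B ^+ 2); last by ring.
by rewrite h1 h2; ring.
Qed.

Lemma sqrt_lorentz_gt0 p : enorm p < 1 -> 0 < Num.sqrt (1 - enorm p ^+ 2).
Proof. by move=> p1; rewrite sqrtr_gt0 subr_gt0 expr_lt1 ?enorm_ge0. Qed.

(** By [BI_density_diff] the quotient times A + B equals 2 p.q + t |q|^2, of modulus at most 4 + 4;
    and A + B >= A. *)
Lemma BI_density_quot_le p q (t : R) : enorm p < 1 -> enorm (t *: q + p) <= 1 -> enorm q <= 2 ->
  0 < t <= 1 -> `|t^-1 * (BI_density (t *: q + p) - BI_density p)| <= 8 * (Num.sqrt (1 - enorm p ^+ 2))^-1.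
Proof.
move=> p1 pq1 q2 /andP[t0 t1]; have A0 := sqrt_lorentz_gt0 p1.
have := BI_density_diff p1 pq1; have := cauchy_schwarz_abs p q.
set D := _ - BI_density p; set A := Num.sqrt _ in A0 *; set B := Num.sqrt _.
have B0 : 0 <= B by exact: sqrtr_ge0.
move=> cs e; rewrite normrM ger0_norm ?invr_ge0 ?(ltW t0)//.
rewrite ler_pdivlMr// -mulrA ler_pdivrMl//.
apply: (@le_trans _ _ (`|D| * (A + B))); first by rewrite ler_wpM2l// lerDl.
rewrite -[A + B]ger0_norm ?addr_ge0 ?(ltW A0)// -normrM e normrM (gtr0_norm t0) ler_wpM2l ?(ltW t0)//.
apply: le_trans (ler_normD _ _) _.
have dpq : `|dot p q| <= 2.
  by apply: le_trans cs _; rewrite -[leRHS]mul1r; apply: ler_pM; rewrite ?enorm_ge0// ltW.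
have q4 : enorm q ^+ 2 <= 4.
  rewrite (_ : 4 = 2 ^+ 2); last by ring.
  by rewrite ler_pXn2r ?nnegrE ?enorm_ge0.
have tq0 : 0 <= t * enorm q ^+ 2 by rewrite mulr_ge0 ?sqr_ge0 ?(ltW t0).
rewrite normrM (ger0_norm (ler0n _ 2)) (ger0_norm tq0).
have h : t * enorm q ^+ 2 <= 1 * 4 by apply: ler_pM; rewrite ?sqr_ge0 ?(ltW t0).
by move: h dpq; move: (t * _) `|dot p q| => a b; rewrite mul1r; lra.
Qed.

(** The same identity writes the quotient as (2 p.q + t |q|^2) / (A + B), where B tends to A > 0. *)
Lemma BI_density_quot_cvg p q : enorm p < 1 ->
  (forall n, enorm (harmonic n *: q + p) <= 1) ->
  (harmonic n)^-1 * (BI_density (harmonic n *: q + p) - BI_density p) @[n --> \oo] -->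
    dot p q * (Num.sqrt (1 - enorm p ^+ 2))^-1.
Proof.
move=> p1 h; have A0 := sqrt_lorentz_gt0 p1.
pose t n : R := harmonic n.
have t0 n : 0 < t n by rewrite /t /harmonic/= invr_gt0.
have tc : t n @[n --> \oo] --> (0 : R) by exact: cvg_harmonic.
pose A := Num.sqrt (1 - enorm p ^+ 2); pose B n := Num.sqrt (1 - enorm (t n *: q + p) ^+ 2).
have Bc : B n @[n --> \oo] --> A.
  have c : (1 - enorm (t n *: q + p) ^+ 2) @[n --> \oo] --> 1 - enorm p ^+ 2.
    have : 1 - (enorm p ^+ 2 + 2 * t n * dot p q + t n ^+ 2 * enorm q ^+ 2) @[n --> \oo] -->
        1 - (enorm p ^+ 2 + 2 * 0 * dot p q + 0 ^+ 2 * enorm q ^+ 2).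
      apply: cvgB; first exact: cvg_cst.
      apply: cvgD; first apply: cvgD; first exact: cvg_cst.
        by apply: cvgMr_tmp; apply: cvgMl_tmp.
      by apply: cvgMr_tmp; rewrite expr2; under eq_fun do rewrite expr2; exact: cvgM.
    rewrite mulr0 mul0r addr0 expr0n/= mul0r addr0.
    by under [X in _ -> X @ _ --> _]eq_fun do rewrite sqr_enormZD.
  by apply: (cvg_comp _ _ c); exact: sqrt_continuous.
have -> : (fun n => (harmonic n)^-1 * (BI_density (harmonic n *: q + p) - BI_density p)) =
    (fun n => (2 * dot p q + t n * enorm q ^+ 2) / (A + B n)).
  apply/funext => n; have ABn : A + B n != 0 by rewrite gt_eqF// ltr_pwDl ?sqrtr_ge0.
  apply: (mulIf ABn); rewrite divfK// -mulrA (BI_density_diff p1 (h n)) mulrA mulVf ?mul1r//.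
  by rewrite gt_eqF// t0.
have -> : dot p q * A^-1 = (2 * dot p q + 0 * enorm q ^+ 2) / (A + A).
  have An0 : A != 0 by rewrite gt_eqF.
  rewrite mul0r addr0 -[A + A]mulr2n -[A *+ 2]mulr_natl invfM mulrACA divff ?mul1r//.
apply: cvgM.
  by apply: cvgD; [exact: cvg_cst|apply: cvgMr_tmp; exact: tc].
by apply: cvgV; [rewrite gt_eqF// addr_gt0|apply: cvgD; [exact: cvg_cst|exact: Bc]].
Qed.

End EnergyDensity.

Lemma leeD_cancel (R : realType) (x y z w : \bar R) : x \is a fin_num ->
  w = (z + x)%E -> (x + y <= w)%E -> (y <= z)%E.
Proof. by move=> fx ->; rewrite addeC leeD2rE. Qed.

Section EnergyVariation.
Context {R : realType} {m : nat}.
Local Notation mu := (lebesgue_rV R m).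
Variables (Omega K : set 'rV[R]_m) (u eta a : 'rV[R]_m -> R) (b : 'rV[R]_m -> 'rV[R]_m).
Local Notation g := (grad Omega u).
Let G z := a z *: (g z - b z).
Hypothesis oO : open Omega.
Hypothesis wg : weak_gradient Omega u g.
Hypothesis g1 : {ae mu, forall z, Omega z -> enorm (g z) <= 1}.
Hypothesis cK : compact K.
Hypothesis KO : K `<=` Omega.
Hypothesis a0 : forall z, ~ K z -> a z = 0.
Hypothesis a1 : forall z, -1 <= a z <= 0.
Hypothesis b1 : forall z, enorm (b z) <= 1.
Hypothesis wge : weak_gradient Omega eta G.

Let mO : measurable Omega. Proof. exact: open_measurable_rV. Qed.
Let mK : measurable K. Proof. exact: compact_measurable_rV. Qed.

Let G0 z : ~ K z -> G z = 0. Proof. by move=> /a0; rewrite /G => ->; rewrite scale0r. Qed.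

Let G2 z : enorm (g z) <= 1 -> enorm (G z) <= 2.
Proof.
move=> gz; rewrite /G enormZ.
have -> : 2 = 1 * (1 + 1) :> R by ring.
apply: ler_pM; rewrite ?enorm_ge0//.
  by rewrite ler_norml; case/andP: (a1 z) => -> /= /le_trans; apply.
by apply: le_trans (enormD _ _) _; rewrite enormN; exact: lerD.
Qed.

Let v t z := t * eta z + u z.

Let wgv t : weak_gradient Omega (v t) (fun z => t *: G z + g z).
Proof. exact: weak_gradient_lin. Qed.

Let gvE t : {ae mu, forall z, Omega z -> grad Omega (v t) z = t *: G z + g z}.
Proof. exact: grad_ae. Qed.

Lemma measurable_BI_density (D : set 'rV[R]_m) (f : 'rV[R]_m -> 'rV[R]_m) :
  measurable_fun D (fun z => enorm (f z)) -> measurable_fun D (fun z => BI_density (f z)).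
Proof.
move=> mf; apply: measurable_funB; first exact: measurable_cst.
apply: (measurableT_comp (continuous_measurable_fun (@sqrt_continuous R))).
apply: measurable_funB; first exact: measurable_cst.
exact: measurable_funX.
Qed.

Let diff t z := BI_density (t *: G z + g z) - BI_density (g z).

Let mdiff t : measurable_fun Omega (diff t).
Proof.
apply: measurable_funB; apply: measurable_BI_density.
  exact: (measurable_enorm_weak oO (wgv t)).
exact: (measurable_enorm_weak oO wg).
Qed.

Let diff0 t z : ~ K z -> diff t z = 0.
Proof. by move=> nK; rewrite /diff G0// scaler0 add0r subrr. Qed.

Let diff_integrable t : mu.-integrable K (EFin \o diff t).
Proof.
apply: measurable_bounded_integrable => //; first exact: compact_fin_measure.
  exact: measurable_funS (mdiff t).
exists 1; split; first exact: num_real.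
move=> x x1 z _; apply: le_trans (ltW x1); rewrite ler_norml /diff.
have := BI_density_ge0 (g z); have := BI_density_ge0 (t *: G z + g z).
have := BI_density_le1 (g z); have := BI_density_le1 (t *: G z + g z).
by move: (BI_density _) (BI_density (g z)) => c d; lra.
Qed.

Hypothesis energy_fin : mu.-integrable Omega (EFin \o (fun z => BI_density (g z))).

(** The gradients of [v t] and [u] agree almost everywhere off [K], so the change of energy is the
    integral of a bounded function over a set of finite measure. *)
Lemma energy_difference t :
  (\int[mu]_(z in Omega) (BI_density (grad Omega (v t) z))%:E =
   \int[mu]_(z in K) (diff t z)%:E + \int[mu]_(z in Omega) (BI_density (g z))%:E)%E.
Proof.
have wgr : weak_gradient Omega (v t) (grad Omega (v t)).
  by apply: weak_gradient_grad; exists (fun z => t *: G z + g z).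
have iO : mu.-integrable Omega (EFin \o diff t).
  by apply/(integrable_support mK mO KO (@diff0 t)).
rewrite -(integral_support KO (@diff0 t)) -integralD//.
apply: ae_eq_integral => //.
- apply/measurable_EFinP; apply: measurable_BI_density.
  exact: (measurable_enorm_weak oO wgr).
- apply: emeasurable_funD; apply/measurable_EFinP; first exact: mdiff.
  by apply: measurable_BI_density; exact: (measurable_enorm_weak oO wg).
- apply: filterS (gvE t) => z h Oz; rewrite h// -EFinD; congr EFin.
  by rewrite /diff subrK.
Qed.

Hypothesis lor : locally_integrable_on Omega (lorentz_factor Omega u).
Variable c : R.
Hypothesis energy_le : forall t : R, 0 < t <= 1 ->
  (\int[mu]_(z in Omega) (BI_density (g z))%:E + (t * c)%:E <=
   \int[mu]_(z in Omega) (BI_density (grad Omega (v t) z))%:E)%E.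

Let diff_ge t : 0 < t <= 1 -> ((t * c)%:E <= \int[mu]_(z in K) (diff t z)%:E)%E.
Proof.
move=> t01.
exact: (leeD_cancel (integrable_fin_num mO energy_fin) (energy_difference t) (energy_le t01)).
Qed.

Lemma energy_variation :
  (c%:E <= \int[mu]_(z in Omega) ((dot (g z) (grad Omega eta z))%:E * lorentz_factor Omega u z))%E.
Proof.
have iL : mu.-integrable K (lorentz_factor Omega u) by exact: lor.
have mL : measurable_fun Omega (lorentz_factor Omega u) by exact: measurable_locally_integrable.
have mdot : measurable_fun Omega (fun z => dot (g z) (G z)).
  by apply: measurable_dot => // i; [exact: (measurable_weak_gradient i oO wg)|exact: (measurable_weak_gradient i oO wge)].
pose f z : \bar R := ((dot (g z) (G z))%:E * lorentz_factor Omega u z)%E.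
have mf : measurable_fun Omega f by apply: emeasurable_funM => //; exact/measurable_EFinP.
have -> : (\int[mu]_(z in Omega) ((dot (g z) (grad Omega eta z))%:E * lorentz_factor Omega u z) =
    \int[mu]_(z in K) f z)%E.
  transitivity (\int[mu]_(z in Omega) f z)%E.
    apply: ae_eq_integral => //.
      apply: emeasurable_funM => //; apply/measurable_EFinP.
      have wgr : weak_gradient Omega eta (grad Omega eta) by apply: weak_gradient_grad; exists G.
      by apply: measurable_dot => // i; [exact: (measurable_weak_gradient i oO wg)|exact: (measurable_weak_gradient i oO wgr)].
    by apply: filterS (grad_ae oO wge) => z h Oz; rewrite /f h.
  rewrite integral_mkcond [RHS]integral_mkcond; congr integral; apply/funext => z.
  rewrite !patchE; have [zK|zK] := boolP (z \in K).
    by rewrite mem_set//; apply: KO; exact: set_mem.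
  case: ifP => // _; rewrite /f G0; last by move/mem_set; apply/negP.
  by rewrite dotC /dot big1 ?mul0e// => i _; rewrite mxE mul0r.
pose q n z : \bar R := ((harmonic n)^-1 * diff (harmonic n) z)%:E.
have t0 n : 0 < (harmonic n : R) <= 1 by rewrite /harmonic/= invr_gt0 ltr0n/= invf_le1// ler1n.
(* Integrability on [K] makes the Lorentz factor finite almost everywhere, which excludes
   [enorm (g z) = 1] and leaves a genuine real inverse. *)
have gK : {ae mu, forall z, K z -> enorm (g z) < 1 /\
    lorentz_factor Omega u z = ((Num.sqrt (1 - enorm (g z) ^+ 2))^-1)%:E}.
  apply: filterS2 g1 (integrable_ae mK iL) => z h1 h2 Kz.
  have := h2 Kz; rewrite /lorentz_factor /grad_norm inver.
  have := h1 (KO Kz); rewrite le_eqVlt => /orP[/eqP -> |gz].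
    by rewrite expr1n subrr sqrtr0 eqxx.
  by rewrite gt_eqF//; exact: sqrt_lorentz_gt0.
have tG : {ae mu, forall z, K z -> forall n, enorm (harmonic n *: G z + g z) <= 1}.
  apply: filterS g1 => z h Kz n; apply: enorm_variation => //; first exact/h/KO.
  by have /andP[/ltW -> ->] := t0 n.
have mq n : measurable_fun K (q n).
  apply/measurable_EFinP; apply: measurable_funM; first exact: measurable_cst.
  exact: measurable_funS (mdiff _).
have mfK : measurable_fun K f by exact: measurable_funS mf.
have qf : {ae mu, forall z, K z -> q n z @[n --> \oo] --> f z}.
  apply: filterS2 gK tG => z h1 h2 Kz; have [gz Lz] := h1 Kz; rewrite /f Lz -EFinM.
  apply: cvg_EFin; first exact: nearW.
  exact: (BI_density_quot_cvg gz (h2 Kz)).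
have i8L : mu.-integrable K (fun z => 8%:E * lorentz_factor Omega u z)%E by exact: integrableZl.
have q8 : {ae mu, forall z n, K z -> (`|q n z| <= 8%:E * lorentz_factor Omega u z)%E}.
  apply: filterS3 g1 gK tG => z h0 h1 h2 n Kz; have [gz Lz] := h1 Kz; rewrite Lz -EFinM lee_fin.
  apply: BI_density_quot_le => //; [exact: h2|by apply: G2; exact/h0/KO].
have [_ _ cvgI] := dominated_convergence mK mq mfK qf i8L q8.
rewrite -(cvg_lim _ cvgI)//; apply: lime_ge; first by apply/cvgP: cvgI.
apply: nearW => n; have /andP[tn0 _] := t0 n.
suff : (c%:E <= \int[mu]_(z in K) q n z)%E by [].
have e : (\int[mu]_(z in K) q n z = ((harmonic n)^-1)%:E * \int[mu]_(z in K) (diff (harmonic n) z)%:E)%E.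
  by rewrite -integralZl//; exact: diff_integrable.
have := diff_ge (t0 n); rewrite e; have -> : (\int[mu]_(z in K) (diff (harmonic n) z)%:E = (\int[mu]_(z in K) diff (harmonic n) z)%:E)%E.
  by rewrite /Rintegral fineK//; exact: (integrable_fin_num mK (diff_integrable _)).
by rewrite -EFinM !lee_fin ler_pdivlMl.
Qed.

End EnergyVariation.

(** * The whole space *)

Section Mollification.
Context {R : realType} {m : nat}.
Local Notation mu := (lebesgue_rV R m).
Implicit Types (f : 'rV[R]_m -> R) (z : 'rV[R]_m).

(** Only [s] is confined to the compact set; [z] ranges over all nearby points, as the ball of a
    mollifier does. *)
Lemma compact_uniform_continuity (S : set 'rV[R]_m) f (e : R) : compact S -> continuous f -> 0 < e ->
  \forall r \near (0 : R)^'+, forall s, S s -> forall z, `|z - s| < r -> `|f z - f s| <= e.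
Proof.
move=> /compact_near_coveringP cS cf e0.
have := cS R (0 : R)^'+ (fun r s => forall z, `|z - s| < r -> `|f z - f s| <= e) _.
apply => x _.
have e20 : 0 < e / 2 by rewrite divr_gt0.
have /cvgrPdist_le/(_ _ e20)/nbhs_ballP[d /= d0 hd] := cf x.
have d20 : 0 < d / 2 by rewrite divr_gt0.
near=> x' r.
have xx' : `|x - x'| < d / 2.
  by near: x'; have := nbhsx_ballx x (d / 2) d20; rewrite -ball_normE.
have rd : r <= d / 2 by near: r; exact: nbhs_right_le.
move=> z zx'; rewrite (_ : f z - f x' = (f x - f x') - (f x - f z)); last by ring.
apply: le_trans (ler_normB _ _) _; rewrite [leRHS]splitr; apply: lerD; apply: hd; rewrite -ball_normE/=.
  by apply: lt_le_trans xx' _; rewrite ler_pdivrMr// ler_peMr ?ltW// ltr1n.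
rewrite -[x - z](subrKA x'); apply: le_lt_trans (ler_normD _ _) _; rewrite [ltRHS]splitr.
by apply: ltrD => //; rewrite distrC; exact: lt_le_trans rd.
Unshelve. all: by end_near. Qed.

Lemma continuous_support_integrable f (M : R) : continuous f -> (forall s, M < `|s| -> f s = 0) ->
  mu.-integrable setT (EFin \o f).
Proof.
move=> cf fM; have cT := @closed_norm_ball_compact R m M.
have [c c0 hc] := continuous_bounded_on cT (continuous_subspaceT cf).
have fM' z : ~ `|z| <= M -> f z = 0 by move=> /negP; rewrite -ltNge; exact: fM.
apply: (@bounded_support_integrable _ _ _ f c cT) => //.
  exact: continuous_measurable_rV.
by move=> z; have [/hc//|/fM' ->] := pselect (`|z| <= M); rewrite normr0.
Qed.

Lemma continuous_conv_near f (M e : R) : continuous f -> (forall s, M < `|s| -> f s = 0) -> 0 < e ->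
  \forall r \near (0 : R)^'+, forall z, `|convol f (moll r) z - f z| <= e.
Proof.
move=> cf fM e0.
have cS := @closed_norm_ball_compact R m (M + 1).
have fi := continuous_support_integrable cf fM.
have unif := compact_uniform_continuity cS cf e0.
near=> r.
have r0 : 0 < r by near: r; exact: nbhs_right_gt.
have r1 : r < 1 by near: r; apply: nbhs_right_lt; exact: ltr01.
have hr : forall s, `|s| <= M + 1 -> forall z, `|z - s| < r -> `|f z - f s| <= e by near: r.
move=> z; apply: conv_moll_near => //; apply: nearW => s sz.
have [zM|Mz] := leP `|z| (M + 1); first exact: hr.
rewrite !fM ?subrr ?normr0 ?(ltW e0)//; first by apply: lt_trans Mz; rewrite ltrDl.
have : `|z| <= `|s - z| + `|s|.
  by rewrite addrC -{1}(subKr s z); exact: ler_normB.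
by move: Mz sz r1; move: `|z| `|s| `|s - z| => p q t; lra.
Unshelve. all: by end_near. Qed.

(** Uniform closeness suffices because, for radius below 1, everything happens in the ball of radius
    M + 1, of finite volume [V]. *)
Lemma L1_moll_continuous f (M e : R) : 0 <= M -> continuous f -> (forall s, M < `|s| -> f s = 0) -> 0 < e ->
  \forall r \near (0 : R)^'+, \int[mu]_z `|convol f (moll r) z - f z| <= e.
Proof.
move=> M0 cf fM e0.
pose S := [set z : 'rV[R]_m | `|z| <= M + 1].
have cS : compact S := @closed_norm_ball_compact R m (M + 1).
have mS := compact_measurable_rV cS.
pose V := fine (mu S).
have V0 : 0 <= V by rewrite fine_ge0.
have VE : mu S = V%:E by rewrite /V fineK// ge0_fin_numE// compact_fin_measure.
have e'0 : 0 < e / (V + 1) by rewrite divr_gt0// ltr_wpDl.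
have near1 := continuous_conv_near cf fM e'0.
have fi := continuous_support_integrable cf fM.
near=> r.
have r0 : 0 < r by near: r; exact: nbhs_right_gt.
have r1 : r < 1 by near: r; apply: nbhs_right_lt; exact: ltr01.
have hr : forall z, `|convol f (moll r) z - f z| <= e / (V + 1) by near: r.
have mr (s : 'rV[R]_m) : r < `|s| -> moll r s = 0 by move=> rs; exact: (moll_eq0 r0 (ltW rs)).
have z0 z : ~ S z -> `|convol f (moll r) z - f z| = 0.
  rewrite /S/= => /negP; rewrite -ltNge => Mz.
  rewrite (conv_support fM mr) ?fM ?subrr ?normr0//; first by apply: lt_trans Mz; rewrite ltrDl.
  by apply: lt_trans Mz; rewrite ltrD2l.
rewrite (@Rintegral_support _ _ S setT)//.
have cc := continuous_conv fi (test_moll (m := m) r0).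
have -> : e = (e / (V + 1)) * (V + 1) by rewrite divfK// gt_eqF// ltr_wpDl.
apply: (@le_trans _ _ (\int[mu]_(z in S) (e / (V + 1)))); last first.
  by rewrite Rintegral_cst// -/V ler_wpM2l ?(ltW e'0)// lerDl.
apply: ae_le_Rintegral => //.
- have ci := continuous_support_integrable cc (conv_support fM mr).
  exact: (integrableS measurableT mS (@subsetT _ _) (integrable_norm (integrableB measurableT ci fi))).
- apply: (@compact_integrable _ _ _ _ (e / (V + 1))) => // z _.
  by rewrite ger0_norm// ltW.
- by apply: nearW => z _; exact: hr.
Unshelve. all: by end_near. Qed.

(** An e/3 argument: mollification contracts the L^1 norm, so convergence passes from continuous
    functions to their L^1 limits. The approximability of [f] is a hypothesis, to be supplied from
    the origin of [f]. *)
Lemma L1_moll f (M : R) : 0 <= M -> mu.-integrable setT (EFin \o f) -> (forall s, M < `|s| -> f s = 0) ->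
  (forall e : R, 0 < e -> exists f', [/\ continuous f', forall s, M < `|s| -> f' s = 0 &
     \int[mu]_z `|f z - f' z| <= e]) ->
  forall e : R, 0 < e -> \forall r \near (0 : R)^'+, \int[mu]_z `|f z - convol f (moll r) z| <= e.
Proof.
move=> M0 fi fM h e e0.
have e30 : 0 < e / 3 by rewrite divr_gt0.
have [f' [cf' fM' hf]] := h _ e30.
have fi' := continuous_support_integrable cf' fM'.
have near1 := L1_moll_continuous M0 cf' fM' e30.
near=> r.
have r0 : 0 < r by near: r; exact: nbhs_right_gt.
have hr : \int[mu]_z `|convol f' (moll r) z - f' z| <= e / 3 by near: r.
have tm := test_moll (m := m) r0.
have mr (s : 'rV[R]_m) : r < `|s| -> moll r s = 0 by move=> rs; exact: (moll_eq0 r0 (ltW rs)).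
have int_conv k : mu.-integrable setT (EFin \o k) -> (forall s, M < `|s| -> k s = 0) ->
    mu.-integrable setT (EFin \o convol k (moll r)).
  move=> ki kM; have tk := test_function_conv ki tm kM mr.
  have [c _ hc] := test_function_bounded tk.
  have cT := @closed_norm_ball_compact R m (M + r).
  apply: (@bounded_support_integrable _ _ _ _ c cT) => //.
    by apply: continuous_measurable_rV; exact: (tk.1 [::]).1.
  by move=> z /negP; rewrite -ltNge; exact: conv_support kM mr z.
have di : mu.-integrable setT (EFin \o (fun z => f z - f' z)) := integrableB measurableT fi fi'.
have ci := int_conv f fi fM; have ci' := int_conv f' fi' fM'.
have dM s : M < `|s| -> f s - f' s = 0 by move=> sM; rewrite fM// fM'// subrr.
have cE z : convol (fun z => f z - f' z) (moll r) z = convol f (moll r) z - convol f' (moll r) z.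
  rewrite /convol -RintegralB//; last first.
  - by apply: conv_integrable => //; [exact: continuous_moll|exact: moll_bounded].
  - by apply: conv_integrable => //; [exact: continuous_moll|exact: moll_bounded].
  by apply: eq_Rintegral => s _; rewrite mulrBl.
have hc := conv_contraction r0 di dM.
have ni k : mu.-integrable setT (EFin \o k) -> mu.-integrable setT (EFin \o (fun z => `|k z|)).
  by move=> ki; exact: (integrable_norm ki).
have i1 := ni _ di; have i2 := ni _ (integrableB measurableT ci ci').
have i3 := ni _ (integrableB measurableT ci' fi').
apply: (@le_trans _ _ (\int[mu]_z (`|f z - f' z| + `|convol f (moll r) z - convol f' (moll r) z|
    + `|convol f' (moll r) z - f' z|))).
  apply: ae_le_Rintegral => //.
  - exact: (ni _ (integrableB measurableT fi ci)).
  - exact: (integrableD measurableT (integrableD measurableT i1 i2) i3).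
  - apply: nearW => z _; rewrite (_ : f z - _ = (f z - f' z) - (convol f (moll r) z - convol f' (moll r) z)
      - (convol f' (moll r) z - f' z)); last by ring.
    by apply: le_trans (ler_normB _ _) _; rewrite lerD2r; exact: ler_normB.
rewrite RintegralD//; last exact: (integrableD measurableT i1 i2).
rewrite RintegralD//.
have -> : e = e / 3 + e / 3 + e / 3 by field.
apply: lerD => //; apply: lerD => //; apply: le_trans hf; apply: le_trans hc.
by apply: ae_le_Rintegral => //; [exact: (ni _ (int_conv _ di dM))|apply: nearW => z _; rewrite cE].
Unshelve. all: by end_near. Qed.

End Mollification.

Section WholeSpace.
Context {R : realType} {m : nat}.
Local Notation mu := (lebesgue_rV R m).
Implicit Types (v psi : 'rV[R]_m -> R).

Lemma weak_gradient_test psi : test_function setT psi ->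
  weak_gradient setT psi (fun z => \row_i partial i psi z).
Proof.
move=> tpsi.
have ci f : continuous f -> @locally_integrable_on R m setT (EFin \o f).
  move=> cf K cK _; have [M _ hM] := continuous_bounded_on cK (continuous_subspaceT cf).
  apply: (compact_integrable cK _ hM).
  by apply: measurable_funS (continuous_measurable_rV cf) => //; exact: compact_measurable_rV.
have cpsi : continuous psi := (tpsi.1 [::]).1.
have cd i : continuous (partial i psi) := (tpsi.1 [:: i]).1.
split => [|i|eta i teta]; first exact: ci.
  by under eq_fun do rewrite mxE; exact: ci.
have ceta : continuous eta := (teta.1 [::]).1.
have i1 := integrable_test measurableT (ci _ cpsi) (teta.1 [:: i]).1 (test_function_partial i teta).2.
have i2 := integrable_test measurableT (ci _ (cd i)) ceta teta.2.
have [K [cK _ eK]] := compact_support_fun teta.2.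
pose dF z := psi z * partial i eta z + eta z * partial i psi z.
have cdF : continuous dF.
  by apply: continuous_add; apply: continuous_mul => //; exact: (teta.1 [:: i]).1.
have [M M0 hM] := continuous_bounded_on cK (continuous_subspaceT cdF).
have dF0 z : ~ K z -> dF z = 0.
  by move=> nz; rewrite /dF eK// mul0r (partial_support i cK eK nz) mulr0 addr0.
have e0 : \int[mu]_z dF z = 0.
  apply: (@integral_partial_eq0 _ _ K (fun z => psi z * eta z) dF i M) => //.
  - exact: continuous_mul.
  - by move=> z nz; rewrite eK// mulr0.
  - by move=> z; exact: (is_deriveM (test_function_derive i z tpsi) (test_function_derive i z teta)).
  - move=> z; have [/hM//|/dF0 ->] := pselect (K z); by rewrite normr0.
have e1 : \int[mu]_z (psi z * partial i eta z) + \int[mu]_z (partial i psi z * eta z) = 0.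
  rewrite -RintegralD// -[RHS]e0; apply: eq_Rintegral => z _.
  by rewrite /dF [eta z * _]mulrC.
under [in RHS]eq_integral do rewrite mxE.
have f1 := integrable_fin_num measurableT i1; have f2 := integrable_fin_num measurableT i2.
rewrite -(fineK f1) -(fineK f2) -EFinN; congr EFin.
by apply/eqP; rewrite -addr_eq0; apply/eqP.
Qed.

Lemma test_function_lin (t : R) psi psi' : test_function setT psi -> test_function setT psi' ->
  test_function setT (fun z => t * psi z + psi' z).
Proof.
move=> [s [c _]] [s' [c' _]]; split.
  apply: Ck_smooth => k; apply: Ck_add; last exact: smooth_Ck.
  by apply: Ck_mul; [exact: Ck_cst|exact: smooth_Ck].
apply: (@compact_support_sub _ _ setT (closure [set z | psi z != 0] `|` closure [set z | psi' z != 0])) => //.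
  exact: compactU.
move=> z /not_orP[nz nz'].
have -> : psi z = 0 by apply: contrapT => /eqP h; apply: nz; exact: subset_closure.
have -> : psi' z = 0 by apply: contrapT => /eqP h; apply: nz'; exact: subset_closure.
by rewrite mulr0 addr0.
Qed.

Lemma vanishes_at_infinity_lin (t : R) v v' : `|t| <= 1 -> vanishes_at_infinity v -> vanishes_at_infinity v' ->
  vanishes_at_infinity (fun z => t * v z + v' z).
Proof.
move=> t1 h h' e e0; have e20 : 0 < e / 2 by rewrite divr_gt0.
have [M hM] := h _ e20; have [M' hM'] := h' _ e20.
exists (Num.max M M') => z; rewrite gt_max => /andP[/hM h1 /hM' h2].
apply: le_lt_trans (ler_normD _ _) _; rewrite [ltRHS]splitr; apply: ltrD => //.
by apply: le_lt_trans h1; rewrite normrM ler_piMl.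
Qed.

Lemma vanishes_compact_support (K : set 'rV[R]_m) v : compact K -> (forall z, ~ K z -> v z = 0) ->
  vanishes_at_infinity v.
Proof.
move=> cK vK e e0; have [M [_ hM]] := compact_bounded cK.
exists (Num.sqrt m%:R * (`|M| + 1)) => z hz; rewrite vK ?normr0// => /(hM (`|M| + 1)).
rewrite ltr_pwDr ?ler_norm// => /(_ isT) /= h; move: hz; apply/negP; rewrite -leNgt.
by apply: le_trans (enorm_le_norm _) _; rewrite ler_wpM2l// sqrtr_ge0.
Qed.

Lemma Lpnorm_grad_lin (p t : R) v v' : 1 <= p -> `|t| <= 1 ->
  (exists g, weak_gradient setT v g) -> (exists g, weak_gradient setT v' g) ->
  (Lpnorm setT p%:E (grad_norm setT (fun z => t * v z + v' z)%R) <=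
   Lpnorm setT p%:E (grad_norm setT v) + Lpnorm setT p%:E (grad_norm setT v'))%E.
Proof.
move=> p1 t1 /weak_gradient_grad wg /weak_gradient_grad wg'.
have oT : open [set: 'rV[R]_m] := openT.
have wl := weak_gradient_lin t oT wg wg'.
have wl' : weak_gradient setT (fun z => t * v z + v' z) (grad setT (fun z => t * v z + v' z)).
  by apply: weak_gradient_grad; eexists; exact: wl.
have p0 : 0 < p by exact: lt_le_trans p1.
have mg := measurable_enorm_weak oT wg; have mg' := measurable_enorm_weak oT wg'.
apply: le_trans (Lpnorm_minkowski p1 measurableT mg mg').
apply: (Lpnorm_ae_le p0 measurableT (measurable_enorm_weak oT wl') (measurable_funD mg mg')).
apply: filterS (grad_ae oT wl) => z h _; rewrite /grad_norm h//.
rewrite !ger0_norm ?addr_ge0 ?enorm_ge0//; apply: le_trans (enormD _ _) _.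
by rewrite lerD2r enormZ ler_piMl ?enorm_ge0.
Qed.

Lemma weak_gradient_subr v psi : (exists g, weak_gradient setT v g) -> test_function setT psi ->
  exists g, weak_gradient setT (fun z => v z - psi z) g.
Proof.
move=> [g wg] /weak_gradient_test wp.
have oT : open [set: 'rV[R]_m] := openT.
have := weak_gradient_lin (-1) oT wp wg.
rewrite (_ : (fun z => -1 * psi z + v z) = (fun z => v z - psi z)).
  by move=> h; eexists; exact: h.
by apply/funext => z; rewrite mulN1r addrC.
Qed.

Lemma Y_whole_norm_lin (p1 t : R) v v' : 1 <= p1 -> `|t| <= 1 ->
  (exists g, weak_gradient setT v g) -> (exists g, weak_gradient setT v' g) ->
  (Y_whole_norm p1 (fun z => t * v z + v' z)%R <= Y_whole_norm p1 v + Y_whole_norm p1 v')%E.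
Proof.
move=> p11 t1 ev ev'; rewrite /Y_whole_norm ge_max; apply/andP; split.
  apply: le_trans (Lpnorm_grad_lin _ t1 ev ev') _; first by rewrite ler1n.
  by apply: leeD; rewrite le_max lexx.
apply: le_trans (Lpnorm_grad_lin p11 t1 ev ev') _.
by apply: leeD; rewrite le_max lexx orbT.
Qed.

Lemma Y_whole_lin (p1 t : R) v v' : 1 <= p1 -> `|t| <= 1 -> Y_whole p1 v -> Y_whole p1 v' ->
  Y_whole p1 (fun z => t * v z + v' z).
Proof.
move=> p11 t1 [cv iv wv av] [cv' iv' wv' av']; split.
- by apply: continuous_add => //; apply: continuous_mul => //; exact: cst_continuous.
- exact: vanishes_at_infinity_lin.
- have [[g wg] [g' wg']] := (wv, wv').
  by exists (fun z => t *: g z + g' z); apply: weak_gradient_lin => //; exact: openT.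
- move=> e e0; have e20 : 0 < e / 2 by rewrite divr_gt0.
  have [psi tpsi hpsi] := av _ e20; have [psi' tpsi' hpsi'] := av' _ e20.
  exists (fun z => t * psi z + psi' z); first exact: test_function_lin.
  rewrite (_ : (fun z => _) = (fun z => t * (v z - psi z) + (v' z - psi' z))); last first.
    by apply/funext => z; ring.
  apply: le_lt_trans (Y_whole_norm_lin p11 t1 _ _) _; [exact: weak_gradient_subr|exact: weak_gradient_subr|].
  have -> : e%:E = ((e / 2)%:E + (e / 2)%:E)%E by rewrite -EFinD -splitr.
  exact: lteD hpsi hpsi'.
Qed.

Lemma enorm_le_sum (x : 'rV[R]_m) : enorm x <= Num.sqrt m%:R * \sum_i `|x 0 i|.
Proof.
apply: le_trans (enorm_le_norm x) _; rewrite ler_wpM2l ?sqrtr_ge0//.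
rewrite norm_rV_le ?sumr_ge0//; apply/forallP => i.
by rewrite (bigD1 i)//= lerDl sumr_ge0.
Qed.

Lemma Lpnorm_grad_test_fin (p : R) psi : 0 < p -> test_function setT psi ->
  (Lpnorm setT p%:E (grad_norm setT psi) < +oo)%E.
Proof.
move=> p0 tpsi; have wp := weak_gradient_test tpsi.
have oT : open [set: 'rV[R]_m] := openT.
have wp' : weak_gradient setT psi (grad setT psi) by apply: weak_gradient_grad; eexists; exact: wp.
have [K [cK _ eK]] := compact_support_fun tpsi.2; have mK := compact_measurable_rV cK.
pose f z := enorm (\row_i partial i psi z).
have mf : measurable_fun setT f by exact: (measurable_enorm_weak oT wp).
have f0 z : ~ K z -> f z = 0.
  move=> nK; rewrite /f (_ : \row_i _ = 0) ?enorm0//; apply/rowP => i; rewrite !mxE.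
  exact: partial_support nK.
have /choice[M hM] : forall i : 'I_m, exists M : R, forall z, `|partial i psi z| <= M.
  by move=> i; have [M _ hM] := test_function_bounded (test_function_partial i tpsi); exists M.
have fM z : `|f z| <= Num.sqrt m%:R * \sum_i M i.
  rewrite ger0_norm ?enorm_ge0//; apply: le_trans (enorm_le_sum _) _.
  by rewrite ler_wpM2l ?sqrtr_ge0//; apply: ler_sum => i _; rewrite mxE.
apply: (@le_lt_trans _ _ (Lpnorm setT p%:E f)).
  apply: Lpnorm_ae_le => //; first exact: (measurable_enorm_weak oT wp').
  by apply: filterS (grad_ae oT wp) => z h _; rewrite /grad_norm h.
rewrite (_ : Lpnorm setT p%:E f = Lpnorm K p%:E f); last first.
  rewrite /Lpnorm (_ : f \_ setT = f \_ K)//; apply/funext => z; rewrite !patchE in_setT.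
  by case: ifPn => // /negP nK; apply: f0 => Kz; apply: nK; exact: mem_set.
apply: (Lpnorm_bounded p0 mK (compact_fin_measure cK) (measurable_funS measurableT (@subsetT _ _) mf)).
by apply: nearW => z _; exact: fM.
Qed.

(** Some test function lies within distance 1 of [v], and its own gradient is bounded with compact
    support. *)
Lemma Y_whole_grad_fin (p1 : R) v : Y_whole p1 v -> (Lpnorm setT 2%:E (grad_norm setT v) < +oo)%E.
Proof.
move=> [_ _ ev av]; have [psi tpsi hpsi] := av 1 ltr01.
have := @Lpnorm_grad_lin 2 1 (fun z => v z - psi z) psi; rewrite ler1n normr1 lexx.
move=> /(_ isT isT (weak_gradient_subr ev tpsi)) h.
have {}h := h (ex_intro _ _ (weak_gradient_test tpsi)).
rewrite (_ : (fun z => 1 * _ + _) = v) in h; last by apply/funext => z; rewrite mul1r subrK.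
apply: le_lt_trans h _; apply: lte_add_pinfty; last exact: Lpnorm_grad_test_fin.
by apply: lt_trans (ltry 1); apply: le_lt_trans hpsi; rewrite le_max lexx.
Qed.

(** Makes the energy finite on the whole space, gradients being in L^2. For |p| <= 1 the number s =
    1 - |p|^2 lies in [0, 1], where s <= sqrt s; for |p| > 1 the density is at most 1. *)
Lemma BI_density_le_sqr (p : 'rV[R]_m) : BI_density p <= enorm p ^+ 2.
Proof.
have [p1|p1] := leP (enorm p) 1; last first.
  by apply: le_trans (BI_density_le1 p) _; rewrite -(expr1n _ 2) ler_pXn2r ?nnegrE ?enorm_ge0// ltW.
rewrite /BI_density lerBlDr -lerBlDl; set s := 1 - _.
have s0 : 0 <= s by rewrite subr_ge0 expr_le1 ?enorm_ge0.
have s1 : s <= 1 by rewrite lerBlDr lerDl sqr_ge0.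
rewrite -{1}[s](sqr_sqrtr s0) expr2 ler_piMl ?sqrtr_ge0//.
by rewrite -[leRHS]sqrtr1 ler_wsqrtr.
Qed.

Lemma Y_whole_energy_fin (p1 : R) v : Y_whole p1 v ->
  mu.-integrable setT (EFin \o (fun z => BI_density (grad setT v z))).
Proof.
move=> Yv; have h := Y_whole_grad_fin Yv; have [_ _ /weak_gradient_grad wg _] := Yv.
have oT : open [set: 'rV[R]_m] := openT.
have mg := measurable_enorm_weak oT wg.
have i2 : mu.-integrable setT (EFin \o (fun z => enorm (grad setT v z) ^+ 2)).
  apply/integrableP; split; first by apply/measurable_EFinP; exact: measurable_funX.
  have : (Lpnorm setT 2%:E (grad_norm setT v) `^ 2 < +oo)%E by exact: poweR_lty.
  rewrite Lpnorm_powR//; congr (_ < _)%E; apply: eq_integral => z _ /=.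
  by rewrite powR_mulrn// ger0_norm ?enorm_ge0// ger0_norm ?sqr_ge0.
apply: le_integrable i2 => //; first by apply/measurable_EFinP; exact: measurable_BI_density.
move=> z _ /=; rewrite lee_fin !ger0_norm ?sqr_ge0 ?BI_density_ge0//.
exact: BI_density_le_sqr.
Qed.

(** Interpolation between L^1 and L^oo, by |v|^p <= B^(p-1) |v|: a single L^1 estimate controls both
    the exponents 2 and [p1]. *)
Lemma Lpnorm_le_of_L1 (p B d c : R) v : 1 <= p -> measurable_fun setT v -> 0 <= c ->
  {ae mu, forall z, `|v z| <= B} -> (\int[mu]_z (`|v z|)%:E <= d%:E)%E -> B `^ (p - 1) * d <= c `^ p ->
  (Lpnorm setT p%:E v <= c%:E)%E.
Proof.
move=> p1 mv c0 vB vd h; have p0 : 0 < p by exact: lt_le_trans p1.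
apply: Lpnorm_le => //; apply: (@le_trans _ _ ((B `^ (p - 1))%:E * \int[mu]_z (`|v z|)%:E)%E); last first.
  apply: le_trans (_ : ((B `^ (p - 1))%:E * d%:E <= _)%E); last by rewrite -EFinM lee_fin.
  by apply: lee_wpmul2l => //; rewrite lee_fin powR_ge0.
have mn : measurable_fun setT (fun z => `|v z|) by exact: measurableT_comp.
rewrite -ge0_integralZl//; last by rewrite lee_fin powR_ge0.
  apply: ae_ge0_le_integral => //.
  - by apply/measurable_EFinP; exact: measurable_norm_powR.
  - by move=> z _; rewrite -EFinM lee_fin mulr_ge0// powR_ge0.
  - by apply/measurable_EFinP; apply: measurable_funM; [exact: measurable_cst|].
  - apply: filterS vB => z vB _; rewrite -EFinM lee_fin -(mulr_powRB1 (normr_ge0 _) p0) mulrC.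
    rewrite ler_wpM2r// ge0_ler_powR ?subr_ge0 ?nnegrE//; exact: le_trans vB.
exact/measurable_EFinP.
Qed.

End WholeSpace.

(** * Approximation of the variation by test functions *)

Section VariationWholeSpace.
Context {R : realType} {m : nat}.
Local Notation mu := (lebesgue_rV R m).

(** The local formula with a cut-off at a ball containing both [K] and the [r]-ball around [z],
    where cutting off changes nothing. *)
Lemma is_derive_convol_support (K : set 'rV[R]_m) (v : 'rV[R]_m -> R) (G : 'rV[R]_m -> 'rV[R]_m) (r : R) i z :
  weak_gradient setT v G -> compact K -> (forall s, ~ K s -> v s = 0) -> (forall s, ~ K s -> G s = 0) -> 0 < r ->
  is_derive z (delta_mx 0 i) (convol v (moll r)) (convol (fun s => G s 0 i) (moll r) z).
Proof.
move=> wG cK v0 G0 r0.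
have [M [_ hM]] := compact_bounded cK.
pose c : R := `|M| + 1 + `|z| + r.
pose B := [set s : 'rV[R]_m | `|s| <= c].
have cB : compact B := @closed_norm_ball_compact R m c.
have KB : K `<=` B.
  move=> s /(hM (`|M| + 1)); rewrite ltr_pwDr ?ler_norm// => /(_ isT) /= h.
  by apply: le_trans h _; rewrite /c -[leRHS]addrA lerDl addr_ge0// ltW.
have zB s : `|s - z| <= r -> B s.
  move=> sz; rewrite /B/= -(subrK z s); apply: le_trans (ler_normD _ _) _; rewrite /c.
  by move: sz (normr_ge0 M); move: `|s - z| `|z| `|M| => p q t; lra.
have := is_derive_convol_weak wG cB (@subsetT _ _) (delta_mx 0 i) r0 zB.
have -> : v \_ B = v.
  by apply/funext => s; rewrite patchE; case: ifPn => // /negP nB; rewrite v0// => /KB/mem_set.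
have -> : (fun s => dot (delta_mx 0 i) (G s)) \_ B = (fun s => G s 0 i); last by [].
apply/funext => s; rewrite patchE.
have e : dot (delta_mx 0 i) (G s) = G s 0 i.
  rewrite /dot (bigD1 i)//= mxE !eqxx mul1r big1 ?addr0// => j ji.
  by rewrite mxE eqxx (negbTE ji) mul0r.
case: ifPn => // /negP nB; rewrite G0 ?mxE// => /KB/mem_set; exact: nB.
Qed.

Variables (p1 : R) (K : set 'rV[R]_m) (u eta a : 'rV[R]_m -> R) (b : 'rV[R]_m -> 'rV[R]_m).
Local Notation g := (grad setT u).
Let G z := a z *: (g z - b z).
Hypothesis p11 : 1 <= p1.
Hypothesis Yu : Y_whole p1 u.
Hypothesis g1 : {ae mu, forall z, [set: 'rV[R]_m] z -> enorm (g z) <= 1}.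
Hypothesis cK : compact K.
Hypothesis eta0 : forall z, ~ K z -> eta z = 0.
Hypothesis a0 : forall z, ~ K z -> a z = 0.
Hypothesis ceta : continuous eta.
Hypothesis wge : weak_gradient setT eta G.
Hypothesis ca : continuous a.
Hypothesis cb : forall i, continuous (fun z => b z 0 i).
Hypothesis a1 : forall z, -1 <= a z <= 0.
Hypothesis b1 : forall z, enorm (b z) <= 1.

Let oT : open [set: 'rV[R]_m]. Proof. exact: openT. Qed.
Let mK : measurable K. Proof. exact: compact_measurable_rV. Qed.
Let G0 z : ~ K z -> G z = 0. Proof. by move=> /a0; rewrite /G => ->; rewrite scale0r. Qed.

Let a_le1 z : `|a z| <= 1.
Proof. by rewrite ler_norml; case/andP: (a1 z) => -> /= /le_trans; apply. Qed.

Let wu : weak_gradient setT u g.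
Proof. by have [_ _ h _] := Yu; exact: weak_gradient_grad. Qed.

Let G_integrable i : mu.-integrable setT (EFin \o (fun z => G z 0 i)).
Proof.
have [_ lG _] := wge.
by apply/(integrable_support mK measurableT) => //; [move=> z /G0 ->; rewrite mxE|exact: lG].
Qed.

(* The approximation of [Du] by gradients of test functions yields continuous
   approximations of [D eta] in L^1. *)
Let G_approx i (e : R) : 0 < e -> exists f : 'rV[R]_m -> R,
  [/\ continuous f, forall z, ~ K z -> f z = 0 & \int[mu]_z `|G z 0 i - f z| <= e].
Proof.
move=> e0; pose V := fine (mu K); have V0 : 0 <= V by rewrite fine_ge0.
pose c := e / (V + 1); have c0 : 0 < c by rewrite divr_gt0// ltr_wpDl.
have [_ _ eu au] := Yu; have [psi tpsi hpsi] := au _ c0.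
have wp := weak_gradient_test tpsi.
pose w z := grad setT (fun z => u z - psi z) z.
have ww : weak_gradient setT (fun z => u z - psi z) w.
  by apply: weak_gradient_grad; exact: weak_gradient_subr.
have wE : {ae mu, forall z, w z = g z - \row_i partial i psi z}.
  have := weak_gradient_lin (-1) oT wp wu.
  rewrite (_ : (fun z => -1 * psi z + u z) = (fun z => u z - psi z)); last first.
    by apply/funext => z; rewrite mulN1r addrC.
  move=> /(grad_ae oT); apply: filterS => z /(_ I) h.
  by rewrite /w h scaleN1r addrC.
exists (fun z => a z * (partial i psi z - b z 0 i)); split.
- apply: continuous_mul => //; apply: continuous_sub; [exact: (tpsi.1 [:: i]).1|exact: cb].
- by move=> z /a0 ->; rewrite mul0r.
have mw : measurable_fun setT (fun z => enorm (w z)) := measurable_enorm_weak oT ww.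
have w2 : (\int[mu]_z (enorm (w z) ^+ 2)%:E <= (c ^+ 2)%:E)%E.
  have h : (Lpnorm setT 2%:E (grad_norm setT (fun z => u z - psi z)%R) <= c%:E)%E.
    by apply: le_trans (ltW hpsi); rewrite le_max lexx.
  have := Lpnorm_lt_int (ltr0n _ 2) (ltW c0) h; rewrite powR_mulrn ?(ltW c0)//.
  congr (_ <= _)%E; apply: eq_integral => z _.
  by rewrite powR_mulrn// ger0_norm ?enorm_ge0.
have iw2 : mu.-integrable setT (EFin \o (fun z => enorm (w z) ^+ 2)).
  apply/integrableP; split; first by apply/measurable_EFinP; exact: measurable_funX.
  apply: le_lt_trans (ltry (c ^+ 2)); apply: le_trans w2; rewrite le_eqVlt; apply/orP; left; apply/eqP.
  by apply: eq_integral => z _ /=; rewrite ger0_norm ?sqr_ge0.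
have w2' : \int[mu]_z (enorm (w z) ^+ 2) <= c ^+ 2.
  by rewrite -lee_fin /Rintegral fineK//; exact: (integrable_fin_num measurableT iw2).
pose F z := G z 0 i - a z * (partial i psi z - b z 0 i).
have F0 z : ~ K z -> `|F z| = 0 by move=> nK; rewrite /F G0// a0// mxE mul0r subrr normr0.
have FE : {ae mu, forall z, `|F z| <= enorm (w z)}.
  apply: filterS wE => z hz; rewrite /F /G !mxE -mulrBr normrM.
  rewrite (_ : g z 0 i - b z 0 i - _ = w z 0 i); last by rewrite hz !mxE; ring.
  apply: le_trans (coord_le_enorm _ i); by rewrite ler_piMl.
have fi : mu.-integrable setT (EFin \o (fun z => a z * (partial i psi z - b z 0 i))).
  have [M [_ hM]] := compact_bounded cK.
  apply: (@continuous_support_integrable _ _ _ (`|M| + 1)).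
    apply: continuous_mul => //; apply: continuous_sub; [exact: (tpsi.1 [:: i]).1|exact: cb].
  move=> s sM; rewrite a0 ?mul0r// => /(hM (`|M| + 1)).
  by rewrite ltr_pwDr ?ler_norm// => /(_ isT) /=; rewrite leNgt sM.
have Fi : mu.-integrable setT (EFin \o F) := integrableB measurableT (G_integrable i) fi.
have iK : mu.-integrable K (EFin \o cst (c / 2)).
  by apply: (@compact_integrable _ _ _ _ (c / 2)) => // z _; rewrite /= ger0_norm// ltW// divr_gt0.
have i2K : mu.-integrable K (EFin \o (fun z => (2 * c)^-1 * enorm (w z) ^+ 2)).
  have h : mu.-integrable K (EFin \o (fun z => enorm (w z) ^+ 2)) := integrableS measurableT mK (@subsetT _ _) iw2.
  exact: (integrableZl mK (2 * c)^-1 h).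
rewrite (@Rintegral_support _ _ K setT)//.
(* The inequality s <= c/2 + s^2/(2c), integrated over [K], turns L^2 smallness into L^1 smallness:
   the result c V/2 + c/2 is at most c V + c = e. *)
apply: (@le_trans _ _ (\int[mu]_(z in K) (cst (c / 2) z + (2 * c)^-1 * enorm (w z) ^+ 2))).
  apply: ae_le_Rintegral => //.
  - exact: (integrableS measurableT mK (@subsetT _ _) (integrable_norm Fi)).
  - exact: (integrableD mK iK i2K).
  apply: filterS FE => z h _; apply: le_trans h _; rewrite /cst; set s := enorm _.
  have : 0 <= (2 * c)^-1 * (s - c) ^+ 2 by rewrite mulr_ge0 ?sqr_ge0// invr_ge0 mulr_ge0// ltW.
  rewrite (_ : (2 * c)^-1 * (s - c) ^+ 2 = (c / 2 + (2 * c)^-1 * s ^+ 2) - s).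
    by rewrite subr_ge0.
  by field; rewrite gt_eqF.
rewrite RintegralD// Rintegral_cst// -/V.
have hK : mu.-integrable K (EFin \o (fun z => enorm (w z) ^+ 2)) := integrableS measurableT mK (@subsetT _ _) iw2.
have h2 : \int[mu]_(z in K) ((2 * c)^-1 * enorm (w z) ^+ 2) <= c / 2.
  rewrite RintegralZl//; have -> : c / 2 = (2 * c)^-1 * c ^+ 2 by field; rewrite gt_eqF.
  have c20 : 0 <= (2 * c)^-1 by rewrite invr_ge0 mulr_ge0// ltW.
  apply: (ler_wpM2l c20); apply: le_trans w2'.
  rewrite -lee_fin /Rintegral !fineK; last first.
  - exact: (integrable_fin_num mK hK).
  - exact: (integrable_fin_num measurableT iw2).
  by apply: ge0_subset_integral => //; [apply/measurable_EFinP; exact: measurable_funX|move=> z _; rewrite lee_fin sqr_ge0].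
apply: le_trans (lerD (lexx _) h2) _.
have -> : e = c * V + c by rewrite -{2}[c]mulr1 -mulrDr /c divfK// gt_eqF// ltr_wpDl.
have : 0 <= c * V by rewrite mulr_ge0// ltW.
have -> : c / 2 * V = c * V / 2 by rewrite mulrAC.
by move: (c * V) (c) c0 => p q; lra.
Qed.

Let k : R := Num.sqrt m%:R.
Let k0 : 0 <= k. Proof. exact: sqrtr_ge0. Qed.

(** The approximants are the mollifications of [eta], whose gradients are the mollified [G]. They
    converge in L^1 by [G_approx] and [L1_moll] and are uniformly bounded, so interpolation gives
    both norms. *)
Lemma Y_whole_variation : Y_whole p1 eta.
Proof.
have [M [_ hM]] := compact_bounded cK; pose N := `|M| + 1.
have N0 : 0 <= N by rewrite addr_ge0.
have KN s : N < `|s| -> ~ K s.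
  by move=> sN /(hM N); rewrite ltr_pwDr ?ler_norm// => /(_ isT) /=; rewrite leNgt sN.
split => //; [exact: (vanishes_compact_support cK)|by exists G|move=> e e0].
have GN i s : N < `|s| -> G s 0 i = 0 by move=> /KN/G0 ->; rewrite mxE.
have etaN s : N < `|s| -> eta s = 0 by move=> /KN; exact: eta0.
have ieta : mu.-integrable setT (EFin \o eta) := continuous_support_integrable ceta etaN.
(* Each coordinate of [G] and of its mollification is at most 2 in modulus, hence 4 for the
   difference; the factor [k] comes from [enorm_le_sum]. *)
pose B : R := k * (\sum_(i < m) 4); have B0 : 0 <= B by rewrite mulr_ge0// sumr_ge0.
pose c := e / 2; have c0 : 0 < c by rewrite divr_gt0.
(* The L^1 accuracy that interpolation requires at exponent [p]; the smaller of the two accuracies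
   serves both exponents. *)
have dp (p : R) : 1 <= p -> exists2 d : R, 0 < d & B `^ (p - 1) * d <= c `^ p.
  move=> p1'; exists (c `^ p / (B `^ (p - 1) + 1)).
    by rewrite divr_gt0 ?powR_gt0// ltr_wpDl// powR_ge0.
  rewrite mulrCA ler_piMr ?powR_ge0// ler_pdivrMr ?mul1r; last by rewrite ltr_wpDl// powR_ge0.
  by rewrite lerDl.
have [d2 d20 hd2] := dp 2 (ler1n _ 2); have [d1 d10 hd1] := dp p1 p11.
pose d := Num.min d1 d2; have d0 : 0 < d by rewrite lt_min d10.
have d'0 : 0 < d / (k * m%:R + 1) by rewrite divr_gt0// ltr_wpDl// mulr_ge0.
have near1 : \forall r \near (0 : R)^'+, forall i, \int[mu]_z `|G z 0 i - convol (fun s => G s 0 i) (moll r) z| <= d / (k * m%:R + 1).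
  apply: filter_forall => i; apply: (@L1_moll _ _ _ N) => // [s|e' e'0]; first exact: GN.
  have [f [cf f0 hf]] := G_approx i e'0; exists f; split => // s /KN; exact: f0.
near (0 : R)^'+ => r.
have r0 : 0 < r by near: r; exact: nbhs_right_gt.
have hr : forall i, \int[mu]_z `|G z 0 i - convol (fun s => G s 0 i) (moll r) z| <= d / (k * m%:R + 1) by near: r.
have mr (s : 'rV[R]_m) : r < `|s| -> moll r s = 0 by move=> rs; exact: (moll_eq0 r0 (ltW rs)).
pose psi := convol eta (moll r).
have tm := test_moll (m := m) r0.
have tpsi : test_function setT psi := test_function_conv ieta tm etaN mr.
exists psi => //.
pose D z i := G z 0 i - convol (fun s => G s 0 i) (moll r) z.
have wE : {ae mu, forall z, enorm (grad setT (fun z => eta z - psi z) z) <= k * \sum_i `|D z i|}.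
  have := weak_gradient_lin (-1) oT (weak_gradient_test tpsi) wge.
  rewrite (_ : (fun z => -1 * psi z + eta z) = (fun z => eta z - psi z)); last first.
    by apply/funext => z; rewrite mulN1r addrC.
  move=> /(grad_ae oT); apply: filterS => z /(_ I) ->.
  apply: le_trans (enorm_le_sum _) _; rewrite ler_wpM2l//; apply: ler_sum => i _.
  rewrite !mxE mulN1r addrC.
  by rewrite (partialE (is_derive_convol_support i z wge cK eta0 G0 r0)) /D !mxE.
have Gi2 : {ae mu, forall z, forall i, `|G z 0 i| <= 2}.
  apply: filterS g1 => z /(_ I) gz i; apply: le_trans (coord_le_enorm _ _) _.
  rewrite /G enormZ (_ : 2 = 1 * (1 + 1)); last by ring.
  apply: ler_pM; rewrite ?enorm_ge0 ?a_le1//; apply: le_trans (enormD _ _) _; rewrite enormN; exact: lerD.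
have conv2 z i : `|convol (fun s => G s 0 i) (moll r) z| <= 2.
  rewrite -[X in `|X|]subr0; apply: conv_moll_near => //.
  by apply: filterS Gi2 => s h _; rewrite subr0; exact: h.
have gB : {ae mu, forall z, `|grad_norm setT (fun z => eta z - psi z) z| <= B}.
  apply: filterS2 wE Gi2 => z h h2; rewrite ger0_norm ?enorm_ge0//; apply: le_trans h _.
  rewrite ler_wpM2l//; apply: ler_sum => i _; apply: le_trans (ler_normB _ _) _.
  by rewrite (_ : 4 = 2 + 2); [apply: lerD; [exact: h2|exact: conv2]|ring].
have Di i : mu.-integrable setT (EFin \o (fun z => `|D z i|)).
  apply: (integrable_norm (f := fun z => D z i)).
  have tc := test_function_conv (G_integrable i) tm (GN i) mr.
  have ci := continuous_support_integrable (tc.1 [::]).1 (conv_support (GN i) mr).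
  exact: (integrableB measurableT (G_integrable i) ci).
have ew : exists h, weak_gradient setT (fun z => eta z - psi z) h.
  by apply: weak_gradient_subr => //; exists G.
have mg : measurable_fun setT (grad_norm setT (fun z => eta z - psi z)).
  exact: (measurable_enorm_weak oT (weak_gradient_grad ew)).
have iS := integrable_sum_fun (index_enum 'I_m) measurableT Di.
have gd : (\int[mu]_z (`|grad_norm setT (fun z => eta z - psi z)%R z|)%:E <= d%:E)%E.
  apply: (@le_trans _ _ (\int[mu]_z (k * \sum_i `|D z i|)%:E)%E).
    apply: ae_ge0_le_integral => //.
    - by apply/measurable_EFinP; exact: measurableT_comp.
    - by move=> z _; rewrite lee_fin mulr_ge0// sumr_ge0.
    - by apply/measurable_EFinP; apply: measurable_funM => //; have /integrableP[/measurable_EFinP] := iS.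
    - by apply: filterS wE => z h _; rewrite lee_fin ger0_norm ?enorm_ge0.
  have h : \int[mu]_z (k * \sum_i `|D z i|) <= d.
    rewrite RintegralZl// Rintegral_sum//.
    apply: (@le_trans _ _ (k * \sum_(i < m) (d / (k * m%:R + 1)))).
      by rewrite ler_wpM2l//; apply: ler_sum => i _; exact: hr.
    rewrite sumr_const card_ord -[X in k * X]mulr_natr mulrCA.
    rewrite -[leRHS]mulr1 -mulrA ler_wpM2l ?(ltW d0)// mulrC ler_pdivrMr; last by rewrite ltr_wpDl// mulr_ge0.
    by rewrite mul1r lerDl.
  move: h; rewrite -lee_fin /Rintegral fineK//.
  have ikS : mu.-integrable setT (EFin \o (fun z => k * \sum_i `|D z i|)) := integrableZl measurableT k iS.
  exact: (integrable_fin_num measurableT ikS).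
have gd' (d' : R) : d <= d' -> (\int[mu]_z (`|grad_norm setT (fun z => eta z - psi z)%R z|)%:E <= d'%:E)%E.
  by move=> dd'; apply: le_trans gd _; rewrite lee_fin.
have dd1 : d <= d1 by rewrite ge_min lexx.
have dd2 : d <= d2 by rewrite ge_min lexx orbT.
apply: (@le_lt_trans _ _ c%:E); last by rewrite lte_fin /c ltr_pdivrMr// ltr_pMr// ltr1n.
rewrite /Y_whole_norm ge_max; apply/andP; split.
  exact: (Lpnorm_le_of_L1 (ler1n _ 2) mg (ltW c0) gB (gd' _ dd2) hd2).
exact: (Lpnorm_le_of_L1 p11 mg (ltW c0) gB (gd' _ dd1) hd1).
Unshelve. all: by end_near. Qed.

End VariationWholeSpace.

(** * Reduction to the two kinds of domain and conclusion *)

Section Bridges.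
Context {R : realType} {m : nat}.
Local Notation mu := (lebesgue_rV R m).

Lemma Yphi_weak (Omega : set 'rV[R]_m) (p1 : R) phi v : Yphi Omega p1 phi v ->
  [/\ {within Omega, continuous v}, weak_gradient Omega v (grad Omega v) &
      {ae mu, forall z, Omega z -> enorm (grad Omega v z) <= 1}].
Proof.
rewrite /Yphi; case: asboolP => [->|_].
  move=> [[cv _ ev _]] /(Lpnorm_oo_leP _ _ ler01) h; split.
  - exact: continuous_subspaceT.
  - exact: weak_gradient_grad.
  - by apply: filterS h => z h /h; rewrite ger0_norm ?enorm_ge0.
by move=> [[ev _ _] cv h _ _]; split => //; exact: weak_gradient_grad.
Qed.

Lemma YE_bounded (Omega : set 'rV[R]_m) (p1 : R) : Omega <> setT -> Y Omega p1 = Y_bounded Omega p1.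
Proof. by move=> nT; rewrite /Y asboolF. Qed.

Lemma YphiE_bounded (Omega : set 'rV[R]_m) (p1 : R) phi :
  Omega <> setT -> Yphi Omega p1 phi = Yphi_bounded Omega phi.
Proof. by move=> nT; rewrite /Yphi asboolF. Qed.

Lemma YE_whole (p1 : R) : Y [set: 'rV[R]_m] p1 = Y_whole p1.
Proof. by rewrite /Y asboolT. Qed.

Lemma YphiE_whole (p1 : R) (phi : 'rV[R]_m -> R) : Yphi [set: 'rV[R]_m] p1 phi = Yphi_whole p1.
Proof. by rewrite /Yphi asboolT. Qed.

Lemma BI_energy_shift (A B : \bar R) (r s c d : R) : (A - r%:E <= B - s%:E)%E -> c <= d ->
  (A - (r + d)%:E <= B - (s + c)%:E)%E.
Proof.
move=> h cd; rewrite !EFinD !fin_num_oppeD// !addeA; apply: leeD => //.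
by rewrite leeN2 lee_fin.
Qed.

Lemma BI_energy_le (A B : \bar R) (r s : R) : A \is a fin_num -> (A - r%:E <= B - (s + r)%:E)%E ->
  (A + s%:E <= B)%E.
Proof.
case: A => [A||]//; case: B => [B||]// _; rewrite ?leey//.
by rewrite -!EFinB -EFinD !lee_fin; lra.
Qed.

Lemma lipschitz_setT (eta : 'rV[R]_m -> R) (L : R) :
  (forall z z', `|eta z' - eta z| <= L * `|z' - z|) -> [lipschitz eta z | z in setT].
Proof.
move=> h; exists L; split; first exact: num_real.
move=> M LM [z z'] _ /=; apply: le_trans (h z' z) _.
by rewrite ler_wpM2r// ltW.
Qed.

End Bridges.

Theorem theorem1p9 (R : realType) (m : nat) (p1 : R)
  (Omega : set 'rV[R]_m) (phi : 'rV[R]_m -> R)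
  (hp1 : m%:R < p1)
  (hp1_3 : m = 3%N -> 2 * m%:R / (m%:R - 2) <= p1)
  (hOmega : [/\ (2 <= m)%N, bounded_domain Omega & spacelike_data Omega phi] \/
            [/\ (3 <= m)%N, Omega = setT & phi = (fun=> 0)])
  (rho : ('rV[R]_m -> R) -> R) (hrho : Y_dual Omega p1 rho)
  (u : 'rV[R]_m -> R)
  (hu : minimizes (BI_energy Omega rho) (Yphi Omega p1 phi) u)
  (x y : 'rV[R]_m) (hxy : light_segment Omega u x y)
  (alpha : R) (halpha : 0 < alpha) :
  let rho_alpha := fun v => rho v + alpha * (delta y v - delta x v) in
  minimizes (BI_energy Omega rho_alpha) (Yphi Omega p1 phi) u /\
  ~ BI_weak_solution Omega p1 phi rho_alpha u.
Proof.
move=> rho_alpha; have [Yu min_u] := hu.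
have oO : open Omega by case: hOmega => [[_ [oO _ _ _] _]//|[_ -> _]]; exact: openT.
have m2 : (2 <= m)%N by case: hOmega => [[]|[/ltnW]].
have p11 : 1 <= p1 by apply: le_trans (ltW hp1); rewrite ler1n; exact: ltnW.
have p10 : 0 < p1 by exact: lt_le_trans p11.
have [cu wg g1] := Yphi_weak Yu.
have [xy seg light] := hxy.
split.
  split => // v Yv; have [cv wgv g1v] := Yphi_weak Yv.
  apply: (BI_energy_shift (min_u v Yv)); rewrite ler_pM2l// /delta light.
  exact: (lipschitz_of_weak_gradient oO wgv cv g1v).
move=> [_ lor ws].
have hO : [/\ bounded_set Omega, spacelike_data Omega phi & boundary_value Omega phi u] \/
    (Omega = setT /\ vanishes_at_infinity u).
  case: hOmega => [[_ [_ _ _ bO] sl]|[_ OT _]]; [left|right]; move: Yu.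
    by rewrite YphiE_bounded; [case|apply: bounded_neq_setT => //; exact: ltnW].
  by rewrite OT YphiE_whole => -[[_ h _ _] _].
have [eta [a [b [L [K [[cK KO e0 a0] [ceta lipeta wge] [ca cb a1 b1] neg]]]]]] :=
  light_competitor oO wg cu g1 hxy hO.
(* The facts whose proofs depend on the kind of domain: membership in Y(Omega), admissibility of the
   perturbations and finiteness of the energy. The rest is common to both. *)
have [Yu' Ye Yv Eu] : [/\ Y Omega p1 u, Y Omega p1 eta,
    forall t : R, 0 <= t <= 1 -> Yphi Omega p1 phi (fun z => t * eta z + u z) &
    (lebesgue_rV R m).-integrable Omega (EFin \o (fun z => BI_density (grad Omega u z)))].
  case: hOmega => [[_ [_ _ _ bO] sl]|[_ OT _]].
    have nT : Omega <> setT by apply: bounded_neq_setT => //; exact: ltnW.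
    rewrite (YE_bounded _ nT) (YphiE_bounded _ _ nT).
    rewrite (YphiE_bounded _ _ nT) in Yu.
    have [[_ uoo _] _ _ bv ub] := Yu; have [c c0 hc] := (Lpnorm_oo_finP _ _).1 uoo.
    have [M M0 hM] := continuous_bounded_on cK (continuous_subspaceT ceta).
    have cuc : {within closure Omega, continuous u}.
      apply: (closure_continuous oO _ cu sl.1 bv ub) => z z' zz'.
      rewrite ler_norml lerNl opprB (lipschitz_of_weak_gradient oO wg cu g1 zz') andbT.
      rewrite -enormN opprB; apply: (lipschitz_of_weak_gradient oO wg cu g1) => t /andP[t0 t1].
      rewrite (_ : _ + _ = z + (1 - t) *: (z' - z)); last by apply/rowP => i; rewrite !mxE; ring.
      by apply: zz'; rewrite subr_ge0 t1 lerBlDr lerDl.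
    have g2 : {ae lebesgue_rV R m, forall z, Omega z -> enorm (a z *: (grad Omega u z - b z)) <= 2}.
      apply: filterS g1 => z h Oz; rewrite enormZ (_ : 2 = 1 * (1 + 1)); last by ring.
      apply: ler_pM; rewrite ?enorm_ge0//.
        by rewrite ler_norml; case/andP: (a1 z) => -> /= /le_trans; apply.
      by apply: le_trans (enormD _ _) _; rewrite enormN; apply: lerD => //; exact: h.
    split.
    - exact: (Y_bounded_of_bounds oO bO p10 wg hc g1 cuc).
    - apply: (Y_bounded_of_bounds oO bO p10 wge _ g2); last exact: continuous_subspaceT.
      apply: nearW => z _; have [Kz|nK] := pselect (K z); first exact: hM.
      by rewrite e0// normr0.
    - by move=> t t01; exact: (Yphi_bounded_variation oO Yu cK KO e0 ceta wge a1 b1 t01).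
    - apply: measurable_bounded_integrable; first exact: open_measurable_rV.
      + exact: bounded_fin_measure.
      + by apply: measurable_BI_density; exact: measurable_enorm_weak wg.
      + exists 1; split; first exact: num_real.
        move=> M' M'1 z _; apply: le_trans (ltW M'1).
        by rewrite ger0_norm ?BI_density_ge0// BI_density_le1.
  rewrite OT in wg cu g1 wge Yu *.
  rewrite YE_whole YphiE_whole; rewrite YphiE_whole in Yu; have [{}Yu _] := Yu.
  have Ye := Y_whole_variation p11 Yu g1 cK e0 a0 ceta wge ca cb a1 b1.
  split; [exact: Yu|exact: Ye|move=> t t01|exact: Y_whole_energy_fin Yu].
  split; first by apply: Y_whole_lin => //; case/andP: t01 => t0 t1; rewrite ger0_norm.
  apply/Lpnorm_oo_leP => //.
  apply: filterS2 g1 (grad_ae (@openT _) (weak_gradient_lin t (@openT _) wge wg)) => z h1 h2 _.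
  by rewrite ger0_norm ?enorm_ge0// /grad_norm h2//; apply: enorm_variation => //; exact: h1.
(* Minimality against [u + t eta]; linearity of [rho], available for the members [eta] and [u] of
   Y(Omega), splits off [t * rho eta], and finite energy permits the cancellation. *)
have energy_le (t : R) : 0 < t <= 1 ->
  (\int[lebesgue_rV R m]_(z in Omega) (BI_density (grad Omega u z))%:E + (t * rho eta)%:E <=
   \int[lebesgue_rV R m]_(z in Omega) (BI_density (grad Omega (fun z => t * eta z + u z)%R z))%:E)%E.
  move=> /andP[t0 t1]; have t01 : 0 <= t <= 1 by rewrite ltW.
  apply: (@BI_energy_le _ _ _ (rho u)); first exact: (integrable_fin_num (open_measurable_rV oO) Eu).
  by rewrite -(hrho.1 t eta u Ye Yu'); exact: min_u (Yv t t01).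
have := energy_variation oO wg g1 cK KO a0 a1 b1 wge Eu lor energy_le.
rewrite ws; last first.
- exact: compact_support_sub cK KO e0.
- exact: lipschitz_setT lipeta.
by rewrite lee_fin /rho_alpha /delta lerDl pmulr_rge0// leNgt neg.
Qed.
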